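(* Let $C>0$ be a constant and let $\epsilon>0$ be a sufficiently small constant. Let $G^{(1)},\dots,G^{(t)}$ be graphs such that for all $j\in[t]$, $1\le \Delta(G^{(j)})\le C$ and $i(G^{(j)})\ge t^{-t^{1/4}}$. Let $G=G^{(1)}\square\cdots\square G^{(t)}$, let $d$ be the average degree of $G$, and let $p=\frac{1+\epsilon}{d}$. Then, with probability tending to $1$ as $t\to\infty$: (a) $G_p$ contains a unique giant component, of order $(1+o(1))y(\epsilon)|V(G)|$; and (b) all other components of $G_p$ have order $o(|V(G)|)$.
   Context: For graphs $G^{(1)},\dots,G^{(t)}$, the Cartesian product $G=G^{(1)}\square\cdots\square G^{(t)}$ has vertex set $\{(v_1,\dots,v_t): v_i\in V(G^{(i)})\}$, with $uv$ an edge iff there is an $i$ such that $u_iv_i\in E(G^{(i)})$ and $u_j=v_j$ for all $j\ne i$. For a graph $H$, $\Delta(H)$ is its maximum degree and its isoperimetric constant is $i(H)=\min_{S\subseteq V(H),\,|S|\le |V(H)|/2} \frac{e(S,V(H)\setminus S)}{|S|}$. $G_p$ is the random subgraph of $G$ obtained by retaining each edge independently with probability $p$. For $\epsilon>0$, $y(\epsilon)$ is the unique solution in $(0,1)$ of $y=1-\exp(-(1+\epsilon)y)$. All asymptotics are as $t\to\infty$. *)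

(* Defs.v *)
From HB Require Import structures.
From mathcomp Require Import all_boot all_order all_algebra.
From mathcomp Require Import all_classical all_reals all_analysis.
From mathcomp Require Import ring lra.
Set Implicit Arguments. Unset Strict Implicit. Unset Printing Implicit Defensive.
Import Order.TTheory GRing.Theory Num.Theory.
Import numFieldNormedType.Exports.
Local Open Scope ring_scope.

Record sgraph := SGraph {
  vertex :> finType;
  adj : rel vertex;
  adj_sym : symmetric adj;
  adj_irrefl : irreflexive adj }.

Section Graph.
Variable G : sgraph.
Implicit Types (x y : G) (S : {set G}).

Definition edges : {set {set G}} :=
  [set f | [exists x : G, exists y : G, adj x y && (f == [set x; y])]].

Definition degree x : nat := #|[set y | adj x y]|.

Definition max_degree : nat := \max_(x : G) degree x.

Definition average_degree (R : realType) : R :=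
  (\sum_(x : G) degree x)%:R / #|G|%:R.

(* e(S, V \ S): a crossing edge is counted once, oriented out of S. *)
Definition edge_boundary S : nat :=
  #|[set u : G * G | [&& u.1 \in S, u.2 \notin S & adj u.1 u.2]]|.

(* The infimum of a finite set of reals, hence a minimum as soon as G has at
   least two vertices; it is 0 by convention on graphs with fewer vertices. *)
Definition isoperimetric_constant (R : realType) : R :=
  inf [set (edge_boundary S)%:R / #|S|%:R | S in
        [set S : {set G} | (0 < #|S|)%N /\ (#|S|%:R <= #|G|%:R / 2 :> R)]]%classic.

Definition components : {set {set G}} :=
  [set [set y | connect (@adj G) x y] | x : G].

Section Spanning.
Variable F : {set {set G}}.

Definition spanning_adj x y := adj x y && ([set x; y] \in F).

Lemma spanning_adj_sym : symmetric spanning_adj.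
Proof. by move=> x y; rewrite /spanning_adj adj_sym finset.setUC. Qed.

Lemma spanning_adj_irrefl : irreflexive spanning_adj.
Proof. by move=> x; rewrite /spanning_adj adj_irrefl. Qed.

Definition spanning_subgraph : sgraph :=
  SGraph spanning_adj_sym spanning_adj_irrefl.
End Spanning.
End Graph.

Section CartesianProduct.
Variables (t : nat) (G : 'I_t -> sgraph).

Definition cartesian_adj : rel {dffun forall i : 'I_t, G i} := fun u v =>
  [exists i : 'I_t, adj (u i) (v i) && [forall j : 'I_t, (j != i) ==> (u j == v j)]].

Lemma cartesian_adj_sym : symmetric cartesian_adj.
Proof.
move=> u v; rewrite /cartesian_adj; apply: eq_existsb => i.
by rewrite adj_sym; congr (_ && _); apply: eq_forallb => j; rewrite (eq_sym (u j)).
Qed.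

Lemma cartesian_adj_irrefl : irreflexive cartesian_adj.
Proof. by move=> u; apply/negbTE/existsP => -[i]; rewrite adj_irrefl. Qed.

Definition cartesian_product : sgraph :=
  SGraph cartesian_adj_sym cartesian_adj_irrefl.
End CartesianProduct.

(* The probability that G_p satisfies P, for 0 <= p <= 1 (outside this range it
   is only a polynomial expression in p). *)
Definition percolation_prob (R : realType) (G : sgraph) (p : R)
    (P : sgraph -> bool) : R :=
  \sum_(F : {set {set G}} | (F \subset edges G) && P (spanning_subgraph F))
    p ^+ #|F| * (1 - p) ^+ #|edges G :\: F|.

Definition survival_equation (R : realType) (eps y : R) : Prop :=
  0 < y < 1 /\ y = 1 - expR (- (1 + eps) * y).

Definition survival_prob (R : realType) (eps : R) : R :=
  xget 0 [set y | survival_equation eps y]%classic.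

Lemma survival_equation_unique (R : realType) (eps : R) :
  0 < eps -> exists! y, survival_equation eps y.
Proof.
move=> e0; set a := 1 + eps; have a1 : 1 < a by rewrite /a; lra.
have tangent (x y : R) : x != y ->
    expR (- a * x) * (1 - a * (y - x)) < expR (- a * y).
  move=> xy; have -> : - a * y = - a * x + - a * (y - x) by ring.
  rewrite expRD ltr_pM2l ?expR_gt0//.
  have : 1 + (- a * (y - x)) < expR (- a * (y - x)).
    by apply: expR_gt1Dx; rewrite mulf_neq0 ?subr_eq0 1?eq_sym//; lra.
  by rewrite mulNr.
have noltsol (y z : R) : survival_equation eps y -> survival_equation eps z ->
    ~~ (y < z).
  rewrite /survival_equation -/a => -[/andP[y0 y1] yE] -[/andP[z0 z1] zE].
  apply/negP => yz.
  have Ey : expR (- a * y) = 1 - y by lra.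
  have Ez : expR (- a * z) = 1 - z by lra.
  have := tangent y 0; rewrite Ey mulr0 expR0 gt_eqF// => /(_ isT) h0.
  have := tangent y z; rewrite Ey Ez lt_eqF// => /(_ isT) hz.
  have c1 : a * (1 - y) < 1.
    rewrite -(ltr_pM2r y0); nra.
  have : (a * (1 - y)) * (z - y) < 1 * (z - y) by rewrite ltr_pM2r//; lra.
  by nra.
pose f (y : R) := y + expR (- a * y) - 1.
pose b := (a - 1) / (2 * a).
have b0 : 0 < b by rewrite /b divr_gt0//; lra.
have ba : a * b = (a - 1) / 2 by rewrite /b; field; lra.
have b1 : b < 1 by nra.
have fb : f b < 0.
  have ab0 : 0 < 1 + a * b by nra.
  have XY : expR (- a * b) * expR (a * b) = 1.
    by rewrite -expRD mulNr addNr expR0.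
  have h : expR (- a * b) * (1 + a * b) <= 1.
    by rewrite -[leRHS]XY ler_pM2l ?expR_gt0// expR_ge1Dx.
  have h2 : (1 - b) * (1 + a * b) = 1 + a * b * b.
    have -> : (1 - b) * (1 + a * b) = 1 + a * b - b - a * b * b by ring.
    have -> : a = 1 + 2 * (a * b) by lra.
    by nra.
  have h3 : 0 < a * b * b by rewrite mulr_gt0//; nra.
  have : (expR (- a * b)) * (1 + a * b) < (1 - b) * (1 + a * b) by lra.
  by rewrite ltr_pM2r// /f; lra.
have f1 : 0 < f 1 by rewrite /f; have := expR_gt0 (- a * 1); lra.
have cf : ({within `[b, 1], continuous f})%classic.
  apply: continuous_subspaceT => x; rewrite /f.
  apply: cvgB; last exact: cvg_cst.
  apply: cvgD; first exact: cvg_id.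
  apply: (continuous_comp (f := fun x => - a * x)).
    exact: mulrl_continuous.
  exact: continuous_expR.
have [|c /[!in_itv]/= /andP[bc c1] fc] := @IVT R f b 1 0 (ltW b1) cf.
  by rewrite ge_min le_max (ltW fb) (ltW f1) orbT.
have c_neq1 : c != 1 by apply/eqP => cE; move: f1; rewrite -cE fc ltxx.
have Sc : survival_equation eps c.
  split; last by move: fc; rewrite /f -/a; lra.
  by rewrite (lt_le_trans b0 bc) lt_neqAle c_neq1.
exists c; split=> // z Sz; apply/eqP; rewrite eq_le !leNgt.
by rewrite (noltsol _ _ Sc Sz) (noltsol _ _ Sz Sc).
Qed.

Section GiantComponent.
Variables (R : realType) (H : sgraph) (y o1 o2 : R).

(* The order of K is (1 + o1) y |V(H)|, with o1 read as a bound on the relative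
   error. *)
Definition giant_order (K : {set H}) : bool :=
  `| #|K|%:R - y * #|H|%:R | <= o1 * (y * #|H|%:R).

Definition unique_giant_component : bool :=
  [exists K in components H,
    [&& giant_order K,
        [forall K' in components H, giant_order K' ==> (K' == K)] &
        [forall K' in components H,
           (K' != K) ==> (#|K'|%:R <= o2 * #|H|%:R)]]].
End GiantComponent.

(* Main.v *)
Require Import Defs.
From HB Require Import structures.
From mathcomp Require Import all_classical all_reals all_analysis.
From mathcomp Require Import all_boot all_order all_algebra.
From mathcomp Require Import ring lra zify.
Set Implicit Arguments. Unset Strict Implicit. Unset Printing Implicit Defensive.
Import Order.TTheory GRing.Theory Num.Theory.
Import numFieldNormedType.Exports.
Local Open Scope ring_scope.

(** The cluster of a vertex is explored edge by edge. If the exploration stops with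
   open edges [O] and closed edges [Z], the ratio of the probabilities of this
   outcome at two parameters depends only on [|O|] and [|Z|], and both are governed
   by the number of vertices found: in a product of [t] graphs of degree at most
   [c], a set of fewer than [2 ^ m.+1] vertices contains one with at most [c * m]
   neighbours inside, so that small sets lose almost none of their volume, and all
   but exponentially few vertices have degree close to [d]. Comparing
   [(1 + eps) / d] with the critical parameter [1 / d] shows that clusters of order
   between [k] and [K = 2 ^ (r ^ 3)], with [r] about [t ^ (1 / 4)], are
   exponentially rare; comparing it with the dual parameter [(1 + eps) (1 - y) / d],
   where clusters are small with high probability, shows that a cluster has order at most
   [k] with probability close to [1 - y].

   The Efron-Stein inequality then concentrates the number of vertices in large
   clusters near [y |V|]. It also shows that almost every vertex is within distance
   [r ^ 2] of a large cluster, since almost every ball of that radius is large.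
   Finally a few extra edges are sprinkled. Large clusters number at most [|V| / K],
   so there are at most [2 ^ (|V| / K)] ways to split them into two groups; the
   isoperimetric constant of the product is at least half the least one
   among the factors, which yields enough disjoint short paths between the two
   groups for the sprinkling to join them, for all splittings at once. *)

(** * Bernoulli edge percolation *)

(** The exponent 1/4 comes from a ladder of scales, where each power of [r] must beat the one below
    it times [log t]. Isoperimetry may cost a factor [t ^ (r + 1)], so vertices far from large
    clusters must have smaller density than that; a ball of radius [r ^ 2] has at least
    [2 ^ (r ^ 2)] vertices, and Chebyshev's inequality on it is accurate enough. Paths of length
    about [r ^ 2] cost a factor [t ^ O(r ^ 2)], both in their number and in their probability of
    being sprinkled, and must still outweigh [2 ^ (|V| / K)] splittings: hence [K = 2 ^ (r ^ 3)]. A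
    set of [K] vertices loses [O(r ^ 3)] of degree per vertex, which is negligible because
    [d >= t >= r ^ 4]; the fraction [exp (- Omega (r ^ 4))] of atypical vertices also beats [K]. One
    obstacle remains: the variance bound grows with the square of the cluster threshold, too much
    for balls only known to have [2 ^ (r ^ 2)] vertices if the threshold is [K]. Inside balls the
    threshold is therefore [r ^ 3]: the variance per vertex is then polynomial in [t], while
    clusters of order between [r ^ 3] and [K] are rarer than the inverse volume of a ball. *)

Lemma set_ind_rem (T : finType) (P : {set T} -> Prop) :
  P set0 -> (forall (e : T) (E : {set T}), e \in E -> P (E :\ e) -> P E) ->
  forall E, P E.
Proof.
move=> P0 PS E; move: {2}#|E| (leqnn #|E|) => n; elim: n E => [|n IH] E.
  by rewrite leqn0 cards_eq0 => /eqP ->.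
move=> En; have [->//|[e eE]] := set_0Vmem E.
by apply: (PS e) => //; apply: IH; move: En; rewrite (cardsD1 e) eE.
Qed.

Section BernoulliExpectation.
Variables (R : realType) (T : finType).
Implicit Types (p : R) (E F : {set T}) (f g : {set T} -> R).

(** Kept as a finite polynomial sum, the expectation satisfies its linearity and conditioning
    identities for every [p]; [0 <= p <= 1] enters only with inequalities. *)
Definition bexp p E f : R :=
  \sum_(F : {set T} | F \subset E) p ^+ #|F| * (1 - p) ^+ #|E :\: F| * f F.

Definition bvar p E f : R := bexp p E (fun F => f F ^+ 2) - bexp p E f ^+ 2.

Lemma eq_bexp p E f g :
  (forall F, F \subset E -> f F = g F) -> bexp p E f = bexp p E g.
Proof. by move=> fg; apply: eq_bigr => F /fg ->. Qed.

Lemma bexp0 p f : bexp p set0 f = f set0.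
Proof.
rewrite /bexp (big_pred1 set0) => [|F]; last by rewrite subset0.
by rewrite setD0 cards0 !expr0 !mul1r.
Qed.

(** Conditioning on whether [e] is kept; this is the step of the inductions on [E]. *)
Lemma bexp_rem p E f e : e \in E ->
  bexp p E f =
    p * bexp p (E :\ e) (fun F => f (e |: F)) + (1 - p) * bexp p (E :\ e) f.
Proof.
move=> eE; rewrite /bexp (bigID (fun F : {set T} => e \in F)) /=; congr (_ + _).
  rewrite mulr_sumr (reindex_onto (fun F => e |: F) (fun F => F :\ e)) /=; last first.
    by move=> F /andP[_ eF]; rewrite setD1K.
  apply: eq_big => [F|F].
    rewrite setU11 andbT subUset sub1set eE /= subsetD1.
    have [eF|eF] := boolP (e \in F); last first.
      rewrite andbT; have -> : (e |: F) :\ e = F by rewrite setU1K.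
      by rewrite eqxx andbT.
    by rewrite andbF; apply/negP => /andP[_ /eqP FE]; move: eF; rewrite -FE setD11.
  rewrite setU11 andbT => /andP[_ /eqP FE].
  have eF : e \notin F by rewrite -FE setD11.
  have -> : E :\: (e |: F) = (E :\ e) :\: F by rewrite setDDl.
  by rewrite cardsU1 eF add1n exprS !mulrA.
rewrite mulr_sumr; apply: eq_big => [F|F /andP[FE eF]].
  by rewrite subsetD1.
have -> : #|E :\: F| = #|(E :\ e) :\: F|.+1.
  rewrite (cardsD1 e) !inE eF eE /= add1n; congr (#|pred_of_set _|.+1).
  by apply/setP => x; rewrite !inE; case: (x == e); rewrite ?andbF.
by rewrite exprS !mulrA; congr (_ * _ * _); rewrite mulrC.
Qed.

Lemma bexpD p E f g : bexp p E (fun F => f F + g F) = bexp p E f + bexp p E g.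
Proof. by rewrite -big_split; apply: eq_bigr => F _; rewrite mulrDr. Qed.

Lemma bexpZ p E f c : bexp p E (fun F => c * f F) = c * bexp p E f.
Proof. by rewrite /bexp mulr_sumr; apply: eq_bigr => F _; rewrite mulrCA. Qed.

Lemma bexpN p E f : bexp p E (fun F => - f F) = - bexp p E f.
Proof. by rewrite /bexp -sumrN; apply: eq_bigr => F _; rewrite mulrN. Qed.

Lemma bexpB p E f g : bexp p E (fun F => f F - g F) = bexp p E f - bexp p E g.
Proof. by rewrite bexpD bexpN. Qed.

Lemma bexp_sum p E (I : Type) (s : seq I) (P : pred I) (f : I -> {set T} -> R) :
  bexp p E (fun F => \sum_(i <- s | P i) f i F) = \sum_(i <- s | P i) bexp p E (f i).
Proof. by rewrite /bexp exchange_big; apply: eq_bigr => F _; rewrite mulr_sumr. Qed.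

Lemma bexp_cst p E c : bexp p E (fun=> c) = c.
Proof.
elim/set_ind_rem: E => [|e E eE IH]; first exact: bexp0.
by rewrite (bexp_rem _ _ eE) IH; ring.
Qed.

Lemma bexp_disjointU p E1 E2 f : [disjoint E1 & E2] ->
  bexp p (E1 :|: E2) f = bexp p E1 (fun F1 => bexp p E2 (fun F2 => f (F1 :|: F2))).
Proof.
elim/set_ind_rem: E1 f => [|e E eE IH] f dis.
  by rewrite set0U bexp0; apply: eq_bexp => F _; rewrite set0U.
have eE2 : e \notin E2 by rewrite (disjointFr dis eE).
have dis' : [disjoint E :\ e & E2] by apply: disjointWl dis; apply: subsetDl.
have eU : (E :|: E2) :\ e = (E :\ e) :|: E2.
  by apply/setP => x; rewrite !inE; case: eqP => //= ->; rewrite (negbTE eE2).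
rewrite (bexp_rem p f (e := e)) ?inE ?eE// eU !IH//.
rewrite (bexp_rem p _ eE); congr (_ * _ + _).
by apply: eq_bexp => F1 _; apply: eq_bexp => F2 _; rewrite setUA.
Qed.

(** Two-round exposure: an element is missing from the union exactly when both rounds omit it,
    whence the relation between the three parameters. *)
Lemma bexp_sprinkle p p1 p2 E f : 1 - p = (1 - p1) * (1 - p2) ->
  bexp p E f = bexp p1 E (fun F1 => bexp p2 E (fun F2 => f (F1 :|: F2))).
Proof.
move=> pE; elim/set_ind_rem: E f => [|e E eE IH] f.
  by rewrite !bexp0 setU0.
have pE' : p = p1 + (1 - p1) * p2 by move: pE; lra.
rewrite (bexp_rem _ _ eE) (bexp_rem p1 _ eE) !IH.
under [X in _ = p1 * X + _]eq_bexp => F1 _ do rewrite (bexp_rem p2 _ eE).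
under [X in _ = _ + _ * X]eq_bexp => F1 _ do rewrite (bexp_rem p2 _ eE).
set a := bexp p1 _ (fun F1 => bexp p2 _ (fun F2 => f (e |: _))).
set b := bexp p1 _ _.
rewrite !bexpD !bexpZ -/b.
under [X in p1 * (p2 * X + _)]eq_bexp => F1 _ do under eq_bexp => F2 _ do
  rewrite -setUUr setUA.
under [X in p1 * (_ + _ * X)]eq_bexp => F1 _ do under eq_bexp => F2 _ do
  rewrite -setUA.
under [X in _ + (1 - p1) * (p2 * X + _)]eq_bexp => F1 _ do under eq_bexp => F2 _ do
  rewrite setUCA.
under [X in p1 * (p2 * X + _)]eq_bexp => F1 _ do under eq_bexp => F2 _ do
  rewrite -setUA.
by rewrite -/a pE'; ring.
Qed.

Section Positive.
Variable p : R.
Hypothesis p01 : 0 <= p <= 1.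

Lemma ler_bexp E f g : (forall F, F \subset E -> f F <= g F) -> bexp p E f <= bexp p E g.
Proof.
have /andP[p0 p1] := p01; move=> fg; apply: ler_sum => F /fg.
by move=> h; rewrite ler_wpM2l// mulr_ge0// exprn_ge0// subr_ge0.
Qed.

Lemma bexp_ge0 E f : (forall F, F \subset E -> 0 <= f F) -> 0 <= bexp p E f.
Proof. by move=> f0; rewrite -[leLHS](bexp_cst p E 0) ler_bexp. Qed.

Lemma bexp_le_cst E f c : (forall F, F \subset E -> f F <= c) -> bexp p E f <= c.
Proof. by move=> fc; rewrite -[leRHS](bexp_cst p E c) ler_bexp. Qed.

Lemma sqr_bexp_le E f : bexp p E f ^+ 2 <= bexp p E (fun F => f F ^+ 2).
Proof.
set m := bexp p E f; rewrite -subr_ge0.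
have : 0 <= bexp p E (fun F => (f F - m) ^+ 2).
  by apply: bexp_ge0 => F _; rewrite sqr_ge0.
under eq_bexp => F _ do rewrite sqrrB -mulr_natl [f F * m]mulrC mulrA.
rewrite bexpD bexpB bexpZ bexp_cst -/m => /le_trans; apply.
by rewrite le_eqVlt; apply/orP; left; apply/eqP; ring.
Qed.

(** Conditioning on [e] splits the variance into the mean of the two conditional variances and
    [p * (1 - p)] times the squared difference of the conditional means, which Jensen's inequality
    bounds by the mean square of the increment. The indicator of [e \notin F] supplies the factor
    [1 - p]. *)
Lemma efron_stein E f :
  bvar p E f <= p * \sum_(e in E) bexp p E (fun F => (e \notin F)%:R * (f (e |: F) - f F) ^+ 2).
Proof.
have /andP[p0 p1] := p01; elim/set_ind_rem: E f => [|e E eE IH] f.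
  by rewrite /bvar !bexp0 subrr big_set0 mulr0.
have IH1 := IH (fun F => f (e |: F)); have IH0 := IH f.
rewrite /bvar in IH1 IH0 *; rewrite !(bexp_rem p _ eE) (big_setD1 e)//=.
rewrite (bexp_rem p (fun F => (e \notin F)%:R * _) eE).
under [X in p * (p * X + _ + _)]eq_bexp => F _ do rewrite setU11 mul0r.
rewrite bexp_cst mulr0 add0r.
under [X in p * (_ * X + _)]eq_bexp => F FE.
  have -> : e \notin F by move: FE; rewrite subsetD1 => /andP[].
  rewrite mul1r; over.
set S := \sum_(i in E :\ e) _.
have -> : S = p * (\sum_(i in E :\ e) bexp p (E :\ e)
      (fun F => (i \notin F)%:R * (f (e |: (i |: F)) - f (e |: F)) ^+ 2)) +
    (1 - p) * (\sum_(i in E :\ e) bexp p (E :\ e)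
      (fun F => (i \notin F)%:R * (f (i |: F) - f F) ^+ 2)).
  rewrite /S !mulr_sumr -big_split; apply: eq_bigr => i; rewrite !inE => /andP[ie iE].
  rewrite (bexp_rem _ _ eE); congr (_ * _ + _).
  apply: eq_bexp => F _; rewrite inE inE (negbTE ie) /=.
  by rewrite setUCA.
set S1 := \sum_(i in _) _ in IH1 *; set S0 := \sum_(i in _) _ in IH0 *.
set a1 := bexp p (E :\ e) (fun F => f (e |: F)) in IH1 *.
set b1 := bexp p (E :\ e) (fun F => f (e |: F) ^+ 2) in IH1 *.
set a0 := bexp p (E :\ e) f in IH0 *.
set b0 := bexp p (E :\ e) (fun F => f F ^+ 2) in IH0 *.
have J := sqr_bexp_le (E :\ e) (fun F => f (e |: F) - f F).
rewrite bexpB -/a1 -/a0 in J; set j := bexp _ _ _ in J *.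
have q0 : 0 <= 1 - p by lra.
have h1 := ler_wpM2l p0 IH1; have h0 := ler_wpM2l q0 IH0.
have hJ := ler_wpM2l (mulr_ge0 p0 q0) J.
by nra.
Qed.

Lemma bexp_markov E f (a : R) : 0 < a -> (forall F, F \subset E -> 0 <= f F) ->
  bexp p E (fun F => (a <= f F)%R%:R) <= bexp p E f / a.
Proof.
move=> a0 f0; rewrite ler_pdivlMr// mulrC -bexpZ; apply: ler_bexp => F FE.
by case: (lerP a (f F)) => h; rewrite ?mulr1 ?mulr0 ?f0.
Qed.

Lemma bexp_chebyshev E f (a : R) : 0 < a ->
  bexp p E (fun F => (a <= `|f F - bexp p E f|)%R%:R) <= bvar p E f / a ^+ 2.
Proof.
move=> a0; have a20 : 0 < a ^+ 2 by rewrite exprn_gt0.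
set m := bexp p E f.
apply: (@le_trans _ _ (bexp p E (fun F => (a ^+ 2 <= (f F - m) ^+ 2)%R%:R))).
  apply: ler_bexp => F _; rewrite -[(f F - m) ^+ 2]real_normK ?num_real//.
  by rewrite ler_pXn2r ?nnegrE ?(ltW a0).
apply: le_trans (bexp_markov _ _) _ => //; first by move=> F _; rewrite sqr_ge0.
rewrite ler_pM2r ?invr_gt0//.
under eq_bexp => F _ do rewrite sqrrB -mulr_natl [f F * m]mulrC mulrA.
rewrite bexpD bexpB bexpZ bexp_cst -/m /bvar -/m.
by rewrite le_eqVlt; apply/orP; left; apply/eqP; ring.
Qed.

(** Events on disjoint sets of edges are independent, and each [P x] is entirely kept with
    probability at least [p ^+ l]. The induction splits off [P x] from [E] as a factor of the
    product space. *)
Lemma bexp_none_sub E (I : finType) (X : {set I}) (P : I -> {set T}) (l : nat) :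
  (forall x, x \in X -> P x \subset E) ->
  (forall x, x \in X -> (#|P x| <= l)%N) ->
  (forall x y, x \in X -> y \in X -> x != y -> [disjoint P x & P y]) ->
  bexp p E (fun F => [forall x in X, ~~ (P x \subset F)]%:R) <= (1 - p ^+ l) ^+ #|X|.
Proof.
have /andP[p0 p1] := p01.
elim/set_ind_rem: X E => [|x X xX IH] E PE Pl Pd.
  by rewrite cards0 expr0; apply: bexp_le_cst => F _; rewrite lern1; case: [forall _ in _, _].
have EP : E = P x :|: (E :\: P x).
  by rewrite setUC setDE setUIl [~: _ :|: _]setUC setUCr setIT; apply/esym/setUidPl/PE.
rewrite EP bexp_disjointU; last first.
  by apply/pred0P => z; rewrite /= !inE; case: (z \in P x).
have {}IH := IH (E :\: P x) _ _ _.
apply: (@le_trans _ _ (bexp p (P x) (fun F1 => (~~ (P x \subset F1))%:R *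
    bexp p (E :\: P x) (fun F2 => [forall y in X :\ x, ~~ (P y \subset F2)]%:R)))).
  apply: ler_bexp => F1 F1P; rewrite -bexpZ; apply: ler_bexp => F2 F2E.
  case: (boolP [forall y in X, ~~ (P y \subset F1 :|: F2)]) => [/forall_inP h|_]; last by rewrite mulr_ge0.
  have -> /= : ~~ (P x \subset F1).
    by apply: contra (h _ xX) => /subset_trans; apply; apply: subsetUl.
  rewrite mul1r; suff -> : [forall y in X :\ x, ~~ (P y \subset F2)] by [].
  apply/forall_inP => y; rewrite !inE => /andP[yx yX].
  by apply: contra (h _ yX) => /subset_trans; apply; apply: subsetUr.
under eq_bexp => F _ do rewrite mulrC.
rewrite bexpZ mulrC (cardsD1 x) xX add1n exprS; apply: ler_pM.
- by apply: bexp_ge0 => F _; case: (~~ _).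
- by apply: bexp_ge0 => F _; case: [forall _ in _, _].
- have -> : bexp p (P x) (fun F => (~~ (P x \subset F))%:R) = 1 - p ^+ #|P x|.
    rewrite -[X in X - _](bexp_cst p (P x)); apply/eqP; rewrite eq_sym subr_eq.
    have -> : p ^+ #|P x| = bexp p (P x) (fun F => (P x \subset F)%:R).
      rewrite /bexp (bigD1 (P x))//= setDv cards0 subxx expr0 !mulr1 big1 ?addr0//.
      move=> F /andP[FP nF]; case: (boolP (P x \subset F)) => h; last by rewrite mulr0.
      by move: nF; rewrite eqEsubset FP h.
    rewrite -bexpD; apply/eqP/eq_bexp => F _.
    by case: (P x \subset F); rewrite ?addr0 ?add0r.
  by rewrite lerD2l lerN2 ler_wiXn2l// Pl.
- apply: IH => [y|y|y z]; rewrite !inE.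
  + move=> /andP[yx yX]; rewrite subsetD PE//= disjoint_sym Pd// eq_sym//.
  + by move=> /andP[_ /Pl].
  + by move=> /andP[_ yX] /andP[_ zX]; apply: Pd.
Qed.

End Positive.
End BernoulliExpectation.

(** * Clusters and their exploration *)

Section Clusters.
Variable G : sgraph.
Implicit Types (x y v : G) (S : {set G}) (F : {set {set G}}).

Definition cluster F v : {set G} := [set y | connect (spanning_adj F) v y].

Definition volume S : nat := \sum_(x in S) degree x.

Definition ball v (k : nat) : {set G} :=
  iter k (fun S => S :|: [set y | [exists x in S, adj x y]]) [set v].

Lemma edgesP (e : {set G}) :
  reflect (exists x y, adj x y /\ e = [set x; y]) (e \in edges G).
Proof.
rewrite inE; apply: (iffP existsP) => [[x /existsP[y /andP[xy /eqP ->]]]|[x [y [xy ->]]]].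
  by exists x, y.
by exists x; apply/existsP; exists y; rewrite xy eqxx.
Qed.

Lemma mem_edges x y : adj x y -> [set x; y] \in edges G.
Proof. by move=> xy; apply/edgesP; exists x, y. Qed.

Lemma adj_neq x y : adj x y -> x != y.
Proof. by move=> xy; apply/eqP => E; move: xy; rewrite E adj_irrefl. Qed.

Lemma spanning_connect_sym F : connect_sym (@spanning_adj G F).
Proof. exact/sym_connect_sym/spanning_adj_sym. Qed.

Lemma cluster_id F v : v \in cluster F v.
Proof. by rewrite inE connect0. Qed.

Lemma cluster_sym F x y : (x \in cluster F y) = (y \in cluster F x).
Proof. by rewrite !inE spanning_connect_sym. Qed.

Lemma cluster_eq F x y : x \in cluster F y -> cluster F x = cluster F y.
Proof.
rewrite inE => h; apply/setP => z; rewrite !inE.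
by rewrite (same_connect (@spanning_connect_sym F) h).
Qed.

Lemma cluster_mono F F' v : F \subset F' -> cluster F v \subset cluster F' v.
Proof.
move=> FF'; apply/subsetP => x; rewrite !inE; apply: connect_sub => a b.
by case/andP=> ab abF; apply/connect1/andP; split => //; apply: (subsetP FF').
Qed.

Lemma cluster_step F v x y : x \in cluster F v -> adj x y -> [set x; y] \in F ->
  y \in cluster F v.
Proof.
rewrite !inE => vx xy xyF; apply: connect_trans vx (connect1 _).
by rewrite /spanning_adj xy.
Qed.

Lemma cluster_sub F v S : v \in S ->
  (forall x y, x \in S -> y \notin S -> adj x y -> [set x; y] \notin F) ->
  cluster F v \subset S.
Proof.
move=> vS cl; apply/subsetP => x; rewrite inE => /connectP[p].
elim: p v vS => [|a p IH] v vS /= => [_ ->//|/andP[/andP[va vaF] pp] xE].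
apply: (IH a) => //; apply: contraT => aS.
by have := cl _ _ vS aS va; rewrite vaF.
Qed.

Lemma ballS v k y : (y \in ball v k.+1) = (y \in ball v k) || [exists x in ball v k, adj x y].
Proof. by rewrite /ball iterS !inE. Qed.

Lemma ballP v k y :
  reflect (exists p, [/\ path (@adj G) v p, last v p = y & (size p <= k)%N]) (y \in ball v k).
Proof.
apply: (iffP idP).
  elim: k y => [|k IH] y; first by rewrite inE => /eqP ->; exists [::].
  rewrite ballS => /orP[/IH [p [pp pl ps]]|/existsP[x /andP[/IH [p [pp pl ps]] xy]]].
    by exists p; split => //; apply: leqW.
  exists (rcons p y); rewrite rcons_path pp pl xy last_rcons size_rcons.
  by split.
move=> [p [pp pl ps]]; elim: k p pp y pl ps => [|k IH] p; elim/last_ind: p => [|p a _] //=.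
- by move=> _ y <- _; rewrite inE.
- by rewrite size_rcons.
- by move=> _ y <- _; rewrite ballS (IH [::]).
rewrite rcons_path size_rcons last_rcons => /andP[pp pa] y <-; rewrite ltnS => ps.
by rewrite ballS; apply/orP; right; apply/existsP; exists (last v p); rewrite (IH p).
Qed.

Lemma ball_le v k l : (k <= l)%N -> ball v k \subset ball v l.
Proof.
move=> kl; apply/subsetP => x /ballP[p [pp pl ps]]; apply/ballP; exists p; split => //.
exact: leq_trans kl.
Qed.

Lemma ball_center v k : v \in ball v k.
Proof. by apply/ballP; exists [::]. Qed.

Lemma ball_sym v k y : (y \in ball v k) = (v \in ball y k).
Proof.
have imp a b : b \in ball a k -> a \in ball b k.
  move=> /ballP[p [pp <- ps]]; apply/ballP; exists (rev (belast a p)).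
  rewrite size_rev size_belast; split => //.
    by rewrite rev_path (eq_path (e' := @adj G))// => c d; rewrite adj_sym.
  by case: p {pp ps} => //= c p; rewrite rev_cons last_rcons.
by apply/idP/idP; apply: imp.
Qed.

Lemma ball_trans x y z k l : y \in ball x k -> z \in ball y l -> z \in ball x (k + l).
Proof.
move=> /ballP[p [pp pl ps]] /ballP[q [qp ql qs]]; apply/ballP; exists (p ++ q).
by rewrite cat_path pp pl last_cat pl ql size_cat leq_add.
Qed.

Lemma ball_adj x y z k : y \in ball x k -> adj y z -> z \in ball x k.+1.
Proof. by move=> yx yz; rewrite ballS; apply/orP; right; apply/existsP; exists y; rewrite yx. Qed.

Lemma degree_le x : (degree x <= max_degree G)%N.
Proof. exact: leq_bigmax. Qed.

Lemma volumeE S : volume S = #|[set u : G * G | (u.1 \in S) && adj u.1 u.2]|.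
Proof.
rewrite /volume /degree; pose f x := [set y | adj x y].
transitivity (\sum_(x in S) \sum_(y | adj x y) 1)%N.
  by apply: eq_bigr => x _; rewrite sum1dep_card.
rewrite pair_big_dep /= sum1dep_card.
by apply: eq_card => u; rewrite !inE.
Qed.

Lemma volume_le S : (volume S <= #|S| * max_degree G)%N.
Proof. by rewrite -sum_nat_const; apply: leq_sum => x _; apply: degree_le. Qed.

Lemma card_ball v k : (#|ball v k| <= (max_degree G).+1 ^ k)%N.
Proof.
elim: k => [|k IH]; first by rewrite cards1.
rewrite /ball iterS -/(ball v k); apply: leq_trans (leq_card_setU _ _) _.
rewrite expnS mulSn leq_add//.
apply: (@leq_trans #|[set u.2 | u in [set u : G * G | (u.1 \in ball v k) && adj u.1 u.2]]|).
  apply/subset_leq_card/subsetP => y; rewrite inE => /existsP[x /andP[xb xy]].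
  by apply/imsetP; exists (x, y); rewrite ?inE //= xb.
apply: leq_trans (leq_imset_card _ _) _; rewrite -volumeE.
by apply: leq_trans (volume_le _) _; rewrite mulnC leq_mul.
Qed.

Lemma card_edges_touching S (Z : {set {set G}}) : Z \subset edges G ->
  (forall e, e \in Z -> exists2 x, x \in S & x \in e) -> (#|Z| <= volume S)%N.
Proof.
move=> ZE ZS; rewrite volumeE.
apply: leq_trans (leq_imset_card (fun u : G * G => [set u.1; u.2]) _).
apply/subset_leq_card/subsetP => e eZ.
have /edgesP[a [b [ab eE]]] := subsetP ZE _ eZ.
have [x xS] := ZS _ eZ; rewrite eE !inE => /orP[] /eqP xE; apply/imsetP.
  by exists (a, b); rewrite ?inE //= -xE xS xE.
by exists (b, a); rewrite ?inE /= -?xE ?xS ?xE 1?adj_sym // setUC.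
Qed.

Lemma card_edge_boundary S (Z : {set {set G}}) :
  (forall x y, x \in S -> y \notin S -> adj x y -> [set x; y] \in Z) ->
  (edge_boundary S <= #|Z|)%N.
Proof.
move=> SZ; rewrite /edge_boundary -(card_in_imset (f := fun u : G * G => [set u.1; u.2])).
  apply/subset_leq_card/subsetP => e /imsetP[[a b]]; rewrite inE /= => /and3P[aS bS ab] ->.
  exact: SZ.
move=> [a b] [c d]; rewrite !inE /= => /and3P[aS bS _] /and3P[cS dS _] E.
have : a \in [set c; d] by rewrite -E !inE eqxx.
have : b \in [set c; d] by rewrite -E !inE eqxx orbT.
rewrite !inE => /orP[/eqP bc|/eqP ->]; first by move: bS; rewrite bc cS.
by case/orP => /eqP aE; [rewrite aE | move: aS; rewrite aE (negbTE dS)].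
Qed.

(** * Comparison of two edge probabilities along an exploration *)

Section Exploration.
Variables (R : realType) (p q M : R) (v : G) (N : nat) (P : pred {set G}).
Hypotheses (p01 : 0 <= p <= 1) (q01 : 0 <= q <= 1) (N0 : (0 < N)%N).
Hypothesis P_large : forall S S', (N <= #|S|)%N -> (N <= #|S'|)%N -> P S = P S'.
Hypothesis weights : forall S z, v \in S -> S \subset ball v #|S|.-1 ->
  (#|S| <= N)%N -> (z <= volume S)%N -> ((#|S| < N)%N -> (edge_boundary S <= z)%N) ->
  P S -> p ^+ #|S|.-1 * (1 - p) ^+ z <= M * (q ^+ #|S|.-1 * (1 - q) ^+ z).

(** [Q] holds the edges not yet queried, [O] the open queried ones, [S] the vertices found; all
    other edges are closed. Each open query adds exactly one vertex, so [O] spans [S] as a tree,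
    which gives [#|O| = #|S|.-1] and the containment in a ball. Every queried edge touches [S], so
    the closed ones number at most [volume S]. *)
Definition explored (Q O : {set {set G}}) S :=
  [/\ [/\ Q \subset edges G, O \subset edges G & [disjoint O & Q]],
   [/\ v \in S, S \subset ball v #|S|.-1, (#|S| <= N)%N & #|O| = #|S|.-1],
   (forall e, e \in O -> e \subset S),
   (forall e, e \in edges G :\: Q -> exists2 x, x \in S & x \in e) &
   S \subset cluster O v].

Let weight (r : R) (Q O : {set {set G}}) : R :=
  r ^+ #|O| * (1 - r) ^+ #|edges G :\: Q :\: O|.

Let prob (r : R) (Q O : {set {set G}}) : R :=
  bexp r Q (fun F => (P (cluster (O :|: F) v))%:R).

(** At a stopped state [P] is already decided: by [P_large] if [N] vertices are found, and otherwise
    because every edge leaving [S] is known to be closed, so that [S] is the whole cluster. In the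
    second case the closed edges include the boundary of [S], which is the lower bound on [z]
    granted in [weights]. *)
Lemma exploration_leaf Q O S : explored Q O S ->
  (#|S| == N) || [forall u : G * G,
    [&& u.1 \in S, u.2 \notin S & adj u.1 u.2] ==> ([set u.1; u.2] \notin Q)] ->
  weight p Q O * prob p Q O <= M * weight q Q O * prob q Q O.
Proof.
move=> [[QE OE OQ] [vS Sb SN OS] OinS touch Scl] leaf.
have nO x y : x \in S -> y \notin S -> [set x; y] \notin O.
  move=> xS yS; apply/negP => /OinS /subsetP /(_ y).
  by rewrite !inE eqxx orbT (negbTE yS) => /(_ isT).
have nQ x y : (#|S| < N)%N -> x \in S -> y \notin S -> adj x y -> [set x; y] \notin Q.
  move=> SltN xS yS xy; case/orP: leaf => [/eqP SE|/forallP/(_ (x, y))].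
    by rewrite SE ltnn in SltN.
  by rewrite /= xS yS xy.
have PE F : F \subset Q -> P (cluster (O :|: F) v) = P S.
  move=> FQ; have Ssub : S \subset cluster (O :|: F) v.
    by apply: subset_trans Scl (cluster_mono _ (subsetUl _ _)).
  have [NS|SltN] := leqP N #|S|.
    by apply: P_large => //; apply: leq_trans (subset_leq_card Ssub).
  congr P; apply/eqP; rewrite eqEsubset Ssub andbT; apply: cluster_sub => // x y xS yS xy.
  rewrite in_setU negb_or nO//=; apply/negP => /(subsetP FQ).
  by apply/negP/nQ.
have probE r : prob r Q O = (P S)%:R.
  by rewrite /prob -[RHS](bexp_cst r Q); apply: eq_bexp => F /PE ->.
rewrite !probE; case: (boolP (P S)) => PS; last by rewrite !mulr0.
rewrite !mulr1 /weight OS; apply: weights => //.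
  apply: card_edges_touching => [|e].
    by apply: subset_trans (subsetDl _ _) (subsetDl _ _).
  by rewrite in_setD => /andP[_]; apply: touch.
move=> SltN; apply: card_edge_boundary => x y xS yS xy.
by rewrite !in_setD nO// nQ// mem_edges.
Qed.

Lemma explored_closed Q O S x y : explored Q O S -> x \in S -> [set x; y] \in Q ->
  explored (Q :\ [set x; y]) O S.
Proof.
move=> [[QE OE OQ] H1 OinS touch Scl] xS eQ; split => //.
  by split=> //; [apply: subset_trans (subsetDl _ _) QE | apply: disjointWr OQ; apply: subsetDl].
move=> f; rewrite in_setD in_setD1 negb_and negbK => /andP[/orP[/eqP -> _|fQ fE]].
  by exists x; rewrite // !inE eqxx.
by apply: touch; rewrite in_setD fQ.
Qed.

Lemma explored_open Q O S x y : explored Q O S -> x \in S -> y \notin S -> adj x y ->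
  [set x; y] \in Q -> (#|S| < N)%N ->
  explored (Q :\ [set x; y]) ([set x; y] |: O) (y |: S).
Proof.
move=> ex xS yS xy eQ SltN.
have [[Q'E _ _] _ _ touch' _] := explored_closed ex xS eQ.
move: ex => [[QE OE OQ] [vS Sb SN OS] OinS touch Scl].
set e := [set x; y] in eQ Q'E touch' *.
have S0 : (0 < #|S|)%N by apply/card_gt0P; exists v.
have cS' : #|y |: S| = #|S|.+1 by rewrite cardsU1 yS.
have eO : e \notin O by apply/negP => /(disjointFr OQ); rewrite eQ.
split.
- split => //; first by rewrite subUset sub1set OE andbT (subsetP QE).
  apply/pred0P => z /=; rewrite !inE; case: (altP (z =P e)) => //= ze.
  by apply/negbTE/negP => /andP[zO]; rewrite (disjointFr OQ zO).
- split; last 2 first.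
  + by rewrite cS'.
  + by rewrite cS' cardsU1 eO OS /= add1n prednK.
  + by rewrite in_setU vS orbT.
  + rewrite cS' /= subUset sub1set; apply/andP; split.
      have := subsetP Sb _ xS => /ball_adj /(_ xy).
      by rewrite prednK.
    by apply: subset_trans Sb (ball_le _ (leq_pred _)).
- move=> f; rewrite in_setU1 => /orP[/eqP ->|/OinS fS].
    by apply/subsetP => z; rewrite !inE => /orP[/eqP ->|->//]; rewrite xS orbT.
  by apply: subset_trans fS (subsetUr _ _).
- by move=> f /touch'[z zS zf]; exists z; rewrite // inE zS orbT.
- have OeO : S \subset cluster (e |: O) v.
    by apply: subset_trans Scl (cluster_mono _ (subsetUr _ _)).
  rewrite subUset OeO andbT sub1set; apply: (@cluster_step _ _ x) => //.
    exact: (subsetP OeO).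
  by rewrite !inE eqxx.
Qed.

(** Weight times conditional probability is additive over the two answers to a query, so the
    inequality climbs from the leaves of the decision tree to its root with the same [M]. *)
Lemma exploration_state Q O S : explored Q O S ->
  weight p Q O * prob p Q O <= M * weight q Q O * prob q Q O.
Proof.
move: {2}#|Q| (leqnn #|Q|) => n; elim: n Q O S => [|n IH] Q O S Qn ex.
  apply: (exploration_leaf ex); apply/orP; right; apply/forallP => u.
  by move: Qn; rewrite leqn0 cards_eq0 => /eqP ->; rewrite inE implybT.
have [leaf|] := boolP ((#|S| == N) || [forall u : G * G,
    [&& u.1 \in S, u.2 \notin S & adj u.1 u.2] ==> ([set u.1; u.2] \notin Q)]).
  exact: exploration_leaf leaf.
rewrite negb_or => /andP[SN' /forallPn[[x y]]].
rewrite negb_imply negbK /= => /andP[/and3P[xS yS xy] eQ].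
have SltN : (#|S| < N)%N by case: ex => _ [_ _ SN _] _ _ _; rewrite ltn_neqAle SN'.
have Q'n : (#|Q :\ [set x; y]| <= n)%N by move: Qn; rewrite (cardsD1 [set x; y]) eQ.
have h0 := IH _ _ _ Q'n (explored_closed ex xS eQ).
have h1 := IH _ _ _ Q'n (explored_open ex xS yS xy eQ SltN).
move: ex => [[QE OE OQ] _ _ _ _].
set e := [set x; y] in eQ h0 h1.
have eO : e \notin O by apply/negP => /(disjointFr OQ); rewrite eQ.
have eE : e \in edges G by apply: mem_edges.
have cZ0 : #|edges G :\: (Q :\ e) :\: O| = #|edges G :\: Q :\: O|.+1.
  rewrite (cardsD1 e) !in_setD in_set1 eqxx eO eE /= add1n; congr (#|pred_of_set _|.+1).
  apply/setP => z; rewrite !in_setD !in_set1; case: (altP (z =P e)) => [->|] //=.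
  by rewrite eO eQ.
have cZ1 : #|edges G :\: (Q :\ e) :\: (e |: O)| = #|edges G :\: Q :\: O|.
  congr (#|pred_of_set _|); apply/setP => z; rewrite !in_setD in_setU !in_set1.
  by case: (altP (z =P e)) => [->|] //=; rewrite eQ /= andbF.
have probE r : prob r Q O = r * prob r (Q :\ e) (e |: O) + (1 - r) * prob r (Q :\ e) O.
  rewrite /prob (bexp_rem _ _ eQ); congr (_ * _ + _).
  by apply: eq_bexp => F _; rewrite setUCA setUA.
rewrite !probE !mulrDr; apply: lerD.
- have w r : weight r Q O * r = weight r (Q :\ e) (e |: O).
    by rewrite /weight cZ1 cardsU1 eO add1n mulrAC -exprSr.
  have w' r X : weight r Q O * (r * X) = weight r (Q :\ e) (e |: O) * X by rewrite mulrA w.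
  by rewrite w' -[leRHS]mulrA w' [leRHS]mulrA.
- have w r : weight r Q O * (1 - r) = weight r (Q :\ e) O.
    by rewrite /weight cZ0 -mulrA -exprSr.
  have w' r X : weight r Q O * ((1 - r) * X) = weight r (Q :\ e) O * X by rewrite mulrA w.
  by rewrite w' -[leRHS]mulrA w' [leRHS]mulrA.
Qed.

Lemma exploration_comparison :
  bexp p (edges G) (fun F => (P (cluster F v))%:R) <=
  M * bexp q (edges G) (fun F => (P (cluster F v))%:R).
Proof.
have := @exploration_state (edges G) set0 [set v].
rewrite /weight /prob setDv set0D !cards0 !expr0 !mul1r mulr1.
have E r : bexp r (edges G) (fun F => (P (cluster (set0 :|: F) v))%:R) =
    bexp r (edges G) (fun F => (P (cluster F v))%:R).
  by apply: eq_bexp => F _; rewrite set0U.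
rewrite !E; apply; split => //.
- by rewrite sub0set; split=> //; apply/pred0P => e; rewrite /= inE.
- by rewrite inE eqxx cards1 sub1set ball_center cards0.
- by move=> e; rewrite inE.
- by move=> e; rewrite setDv inE.
- by rewrite sub1set cluster_id.
Qed.
End Exploration.
End Clusters.

(** * Expansion and isoperimetry in Cartesian products *)

Section SmallSets.
Variable G : sgraph.
Implicit Types (x y : G) (S : {set G}).

Definition internal_degree S x : nat := #|[set y in S | adj x y]|.

Lemma volume_boundary S :
  volume S = (edge_boundary S + \sum_(x in S) internal_degree S x)%N.
Proof.
rewrite /edge_boundary volumeE.
rewrite -(cardsID [set u : G * G | u.2 \in S]) addnC; congr (_ + _)%N.
  by apply: eq_card => u; rewrite !inE; case: (u.1 \in S); case: (u.2 \in S); rewrite ?andbF.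
rewrite /internal_degree; under eq_bigr => x _ do rewrite -sum1dep_card.
rewrite pair_big_dep /= sum1dep_card; apply: eq_card => u; rewrite !inE.
by rewrite -!andbA; congr (_ && _); rewrite andbC.
Qed.

(** Degeneracy: removing a vertex of low internal degree destroys at most [c] edges, and each edge
    is counted at both ends. *)
Lemma internal_degree_sum (c : nat) S :
  (forall S', S' \subset S -> S' != set0 ->
    exists2 x, x \in S' & (internal_degree S' x <= c)%N) ->
  (\sum_(x in S) internal_degree S x <= 2 * c * #|S|)%N.
Proof.
move: {2}#|S| (leqnn #|S|) => n; elim: n S => [|n IH] S Sn degen.
  by move: Sn; rewrite leqn0 cards_eq0 => /eqP ->; rewrite big_set0.
have [->|S0] := eqVneq S set0; first by rewrite big_set0.
have [x xS xc] := degen S (subxx _) S0.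
have card_S : #|S| = #|S :\ x|.+1 by rewrite (cardsD1 x) xS.
have {}IH : (\sum_(y in S :\ x) internal_degree (S :\ x) y <= 2 * c * #|S :\ x|)%N.
  apply: IH; first by rewrite -ltnS -card_S.
  by move=> S' S'S; apply: degen; apply: subset_trans S'S (subsetDl _ _).
rewrite (big_setD1 x)//=.
have -> : (\sum_(y in S :\ x) internal_degree S y =
    \sum_(y in S :\ x) (internal_degree (S :\ x) y + adj x y))%N.
  apply: eq_bigr => y; rewrite in_setD1 => /andP[yx yS].
  rewrite /internal_degree (cardsD1 x) inE xS adj_sym addnC; congr (_ + _)%N.
  by apply: eq_card => z; rewrite !inE andbA.
have -> : (\sum_(y in S :\ x) (internal_degree (S :\ x) y + adj x y) =
    \sum_(y in S :\ x) internal_degree (S :\ x) y + internal_degree S x)%N.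
  rewrite big_split /=; congr (_ + _)%N.
  rewrite /internal_degree -sum1dep_card big_mkcondr /= [RHS](big_setD1 x)//= adj_irrefl add0n.
  by apply: eq_bigr => y _; case: (adj x y).
by rewrite card_S; lia.
Qed.

End SmallSets.

(** * Coordinates, fibres and small sets in a product *)

Section Product.
Variables (t : nat) (G : 'I_t -> sgraph).
Notation V := (cartesian_product G).
Implicit Types (x y : V) (S : {set V}).

Definition upd x (k : 'I_t) (a : G k) : V := [ffun j => dfwith x a j].

Lemma upd_same x k (a : G k) : upd x a k = a.
Proof. by rewrite ffunE dfwith_in. Qed.

Lemma upd_other x k (a : G k) j : j != k -> upd x a j = x j.
Proof. by move=> jk; rewrite ffunE dfwith_out // eq_sym. Qed.

Lemma upd_eq x y k : (forall j, j != k -> x j = y j) -> upd x (y k) = y.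
Proof.
move=> xy; apply/ffunP => j; have [->|jk] := eqVneq j k; first exact: upd_same.
by rewrite upd_other// xy.
Qed.

Lemma upd_id x k : upd x (x k) = x.
Proof. exact: upd_eq. Qed.

Lemma updK x k (a b : G k) : upd (upd x a) b = upd x b.
Proof.
apply/ffunP => j; have [->|jk] := eqVneq j k; first by rewrite !upd_same.
by rewrite !upd_other.
Qed.

Lemma adj_upd x k (a : G k) : adj (x k) a -> adj x (upd x a).
Proof.
move=> xa; apply/existsP; exists k; rewrite upd_same xa.
by apply/forallP => j; apply/implyP => jk; rewrite upd_other.
Qed.

(** The direction of an edge is unique, since a second one would make a vertex of a factor adjacent
    to itself. *)
Lemma sum_neighbours x (phi : V -> nat) :
  (\sum_(y | adj x y) phi y =
   \sum_(k < t) \sum_(b | adj (x k) b) phi (upd x b))%N.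
Proof.
pose cond k y := adj (x k) (y k) && [forall j : 'I_t, (j != k) ==> (x j == y j)].
have condE k : (\sum_(y | cond k y) phi y = \sum_(b | adj (x k) b) phi (upd x b))%N.
  rewrite (reindex_onto (@upd x k) (fun y => y k)) /=; last first.
    by move=> y /andP[_ /forallP h]; apply: upd_eq => j jk; apply/eqP/(implyP (h j)).
  apply: eq_bigl => b; rewrite upd_same eqxx andbT /cond upd_same.
  case: (adj (x k) b) => //=.
  by apply/forallP => j; apply/implyP => jk; rewrite upd_other.
under [RHS]eq_bigr => k _ do rewrite -condE big_mkcond.
rewrite exchange_big big_mkcond /=; apply: eq_bigr => y _.
case: ifPn => [/existsP[k kc]|]; last first.
  move=> /existsPn h; rewrite big1// => k _.
  by rewrite /cond (negbTE (h k)).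
rewrite (bigD1 k)//= /cond kc big1 ?addn0// => j jk.
case: ifP => // /andP[xyj _]; move: kc => /andP[_ /forallP /(_ j)].
by rewrite jk /= => /eqP E; rewrite E adj_irrefl in xyj.
Qed.

Lemma degree_product x : degree x = (\sum_(k < t) degree (x k))%N.
Proof.
rewrite /degree -sum1dep_card sum_neighbours.
by apply: eq_bigr => k _; rewrite sum1dep_card.
Qed.

(** Exchanging [x k] with [a] is an involution on the pairs [(x, a)]. *)
Lemma sum_resample (M : nmodType) k (phi : V -> M) :
  \sum_x \sum_(a : G k) phi (upd x a) = (\sum_x phi x) *+ #|G k|.
Proof.
transitivity (\sum_(x : V) \sum_(a : G k) phi x); last first.
  by rewrite -sumrMnl; apply: eq_bigr => x _; rewrite sumr_const.
rewrite !pair_big /=.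
pose h (u : V * G k) := (upd u.1 u.2, u.1 k).
have hK : involutive h by move=> [x a]; rewrite /h /= updK upd_same upd_id.
by rewrite (reindex_inj (inv_inj hK)) /=; apply: eq_bigr => u _; rewrite updK upd_id.
Qed.

Lemma sum_coordinate (M : nmodType) k (phi : G k -> M) :
  (\sum_(x : V) phi (x k)) *+ #|G k| = (\sum_a phi a) *+ #|V|.
Proof.
rewrite -(sum_resample k (fun x => phi (x k))).
under eq_bigr => x _ do under eq_bigr => a _ do rewrite upd_same.
by rewrite sumr_const.
Qed.

Lemma natr_mulrn_nat (m n : nat) : (m *+ n)%R = (m * n)%N.
Proof. by elim: n => [|n IH]; rewrite ?muln0 // mulrS IH mulnS. Qed.

Lemma sum_resample_nat k (phi : V -> nat) :
  (\sum_x \sum_(a : G k) phi (upd x a) = (\sum_x phi x) * #|G k|)%N.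
Proof. by rewrite -natr_mulrn_nat; apply: (@sum_resample nat). Qed.

Lemma sum_coordinate_nat k (phi : G k -> nat) :
  ((\sum_(x : V) phi (x k)) * #|G k| = (\sum_a phi a) * #|V|)%N.
Proof. by rewrite -!natr_mulrn_nat; apply: (@sum_coordinate nat). Qed.

(** Independence of the coordinates of a uniform vertex, in the form needed for exponential moments;
    the factors have different types, hence the detour through dependent finite functions. *)
Lemma prod_sum (R : comPzRingType) (f : forall k, G k -> R) :
  \prod_(k < t) (\sum_(a : G k) f k a) = \sum_(x : V) \prod_(k < t) f k (x k).
Proof.
have fE (k : 'I_t) : \sum_(a : G k) f k a = \sum_(a : G k) (finfun (f k) : {ffun _ -> R}) a.
  by apply: eq_bigr => a _; rewrite ffunE.
under eq_bigr => k _ do rewrite fE (big_tag (fun k => (finfun (f k) : {ffun _ -> R}))).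
rewrite bigA_distr_big_dep -(@big_fprod _ _ _ _ _ _ _ (fun k => finfun (f k))).
rewrite [RHS](reindex (@dffun_of_fprod _ _)); last exact/onW_bij/dffun_of_fprod_bij.
by apply: eq_bigr => x _; apply: eq_bigr => k _; rewrite !ffunE.
Qed.

Section SmallSetsInProducts.
Variable c : nat.
Hypothesis max_degree_le : forall k, (max_degree (G k) <= c)%N.

(** Two points of [S] that differ in coordinate [k] lie in disjoint fibres, and the smaller of these
    has at most half the points. The vertex that induction finds in it has few neighbours in its
    fibre; its other neighbours in [S] differ from it in coordinate [k] alone, so there are at most
    [c] of them. For [c = 1] subcubes attain the bound. *)
Lemma small_internal_degree m S : S != set0 -> (#|S| < 2 ^ m.+1)%N ->
  exists2 x, x \in S & (internal_degree S x <= c * m)%N.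
Proof.
elim: m S => [|m IH] S S0 Sm.
  have /set0Pn[x xS] := S0; exists x => //; rewrite muln0 leqn0 cards_eq0.
  have : #|S| == 1%N by rewrite eqn_leq -ltnS Sm card_gt0.
  case/cards1P => y SE; move: xS; rewrite SE inE => /eqP ->.
  by apply/eqP/setP => z; rewrite !inE; case: eqP => // ->; rewrite adj_irrefl.
have [small|large] := ltnP #|S| (2 ^ m.+1).
  by have [x xS xd] := IH S S0 small; exists x => //; apply: leq_trans xd _; rewrite leq_mul.
have /card_gt1P[y [z [yS zS yz]]] : (1 < #|S|)%N.
  by apply: leq_trans large; rewrite -[1%N]/(2 ^ 0)%N ltn_exp2l.
have [k yzk] : exists k, y k != z k.
  apply/existsP; apply: contraR yz => /existsPn h; apply/eqP/ffunP => k.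
  by apply/eqP; have := h k; rewrite negbK.
pose fib (a : G k) := [set x in S | x k == a].
have [x0 [x0S small]] : exists x0, x0 \in S /\ (#|fib (x0 k)| < 2 ^ m.+1)%N.
  have : (#|fib (y k)| + #|fib (z k)| <= #|S|)%N.
    rewrite -cardsUI [X in (_ + X)%N](_ : _ = 0%N) ?addn0.
      by apply/subset_leq_card/subsetP => x; rewrite !inE => /orP[] /andP[].
    apply/eqP; rewrite cards_eq0; apply/eqP/setP => x; rewrite !inE.
    by case: eqP => [->|]; rewrite ?andbF// (negbTE yzk) !andbF.
  move=> le2; have [ly|ly] := ltnP #|fib (y k)| (2 ^ m.+1); first by exists y.
  exists z; split=> //; move: Sm; rewrite [(2 ^ m.+2)%N]expnS; lia.
have fib0 : fib (x0 k) != set0 by apply/set0Pn; exists x0; rewrite inE x0S eqxx.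
have [x xf xd] := IH _ fib0 small; exists x.
  by move: xf; rewrite inE => /andP[].
have -> : internal_degree S x =
    (internal_degree (fib (x0 k)) x + #|[set w in S | adj x w && (w k != x0 k)]|)%N.
  rewrite /internal_degree -(cardsID (fib (x0 k))); congr (_ + _)%N; apply: eq_card => w;
    rewrite !inE; case: (w \in S) => //=; by rewrite andbC.
rewrite mulnS addnC leq_add//.
move: xf; rewrite inE => /andP[_ /eqP xk].
apply: leq_trans (max_degree_le k); apply: leq_trans (degree_le (x k)).
rewrite /degree; apply: leq_trans (leq_imset_card (@upd x k) _).
apply/subset_leq_card/subsetP => w; rewrite inE => /and3P[_ /existsP[j /andP[xw /forallP h]] wk].
have kj : k = j.
  apply/eqP; apply: contraNT wk => kj; rewrite -xk eq_sym.
  exact: (implyP (h k) kj).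
rewrite -kj in xw h; apply/imsetP; exists (w k); rewrite ?inE//.
by apply/esym/upd_eq => i ik; apply/eqP/(implyP (h i)).
Qed.

Lemma small_boundary m S : (#|S| < 2 ^ m.+1)%N ->
  (volume S <= edge_boundary S + 2 * (c * m) * #|S|)%N.
Proof.
move=> Sm; rewrite volume_boundary leq_add2l; apply: internal_degree_sum => S' S'S S'0.
by apply: small_internal_degree => //; apply: leq_ltn_trans Sm; apply: subset_leq_card.
Qed.

Lemma max_degree_product : (max_degree V <= c * t)%N.
Proof.
apply/bigmax_leqP => x _; rewrite degree_product.
apply: (@leq_trans (\sum_(k < t) c)); last by rewrite sum_nat_const card_ord mulnC.
by apply: leq_sum => k _; apply: leq_trans (degree_le _) (max_degree_le k).
Qed.

End SmallSetsInProducts.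

(** Toggling each of the first [L] coordinates between its value at [v] and one neighbour spans a
    subcube. The last clause says that later coordinates are untouched, which keeps the two halves
    of the next doubling disjoint. *)
Lemma cube_in_ball (v : V) L : (L <= t)%N -> (forall k (a : G k), (0 < degree a)%N) ->
  exists T : {set V}, [/\ #|T| = (2 ^ L)%N, T \subset ball v L &
    forall (x : V) (k : 'I_t), x \in T -> (L <= k)%N -> x k = v k].
Proof.
move=> + deg0; elim: L => [|L IH] Lt.
  by exists [set v]; rewrite cards1; split => // x k; rewrite inE => /eqP ->.
have [T [cT Tb Tv]] := IH (ltnW Lt).
pose k := Ordinal Lt.
have [b vb] : exists b, adj (v k) b.
  by have /card_gt0P[b] := deg0 k (v k); rewrite inE; exists b.
have bv : b != v k by apply/eqP => E; move: vb; rewrite E adj_irrefl.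
exists (T :|: [set upd x b | x in T]); split.
- rewrite cardsU card_in_imset; last first.
    move=> x y xT yT E; have xk := Tv _ k xT (leqnn L); have yk := Tv _ k yT (leqnn L).
    by rewrite -(upd_id x k) -(upd_id y k) xk yk -(updK x b) E updK.
  rewrite (_ : T :&: _ = set0) ?cards0 ?subn0 ?cT ?expnS ?mul2n ?addnn//.
  apply/setP => x; rewrite !inE; apply/negP => /andP[xT /imsetP[y yT xE]].
  by move: bv; rewrite -(Tv _ k xT (leqnn L)) xE upd_same eqxx.
- rewrite subUset (subset_trans Tb (ball_le _ _))//=.
  apply/subsetP => _ /imsetP[x xT ->]; apply: (ball_adj (subsetP Tb _ xT)).
  by apply: adj_upd; rewrite (Tv _ k).
- move=> x j; rewrite inE => /orP[xT Lj|/imsetP[y yT ->] Lj]; first by rewrite Tv// ltnW.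
  have jk : j != k by apply/eqP => E; rewrite E /= ltnn in Lj.
  by rewrite upd_other// (Tv _ _ yT (ltnW Lj)).
Qed.

Lemma edge_boundary_sum S : edge_boundary S =
  (\sum_(x in S) \sum_(k < t) \sum_(b | adj (x k) b) (upd x b \notin S))%N.
Proof.
rewrite /edge_boundary; transitivity (\sum_(x in S) \sum_(y | adj x y) (y \notin S))%N.
  rewrite -sum1dep_card; under [RHS]eq_bigr => x _ do rewrite -big_mkcondr.
  rewrite pair_big_dep /=; apply: eq_bigl => u.
  by congr (_ && _); rewrite andbC.
by apply: eq_bigr => x _; rewrite sum_neighbours.
Qed.

(* Changing the coordinates of [x] into those of [y] one at a time leaves [S] at
   some step [k]; exchanging the first [k] coordinates of [x] and [y] is an
   involution. *)
Lemma card_pairs_le_resample S :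
  (#|S| * #|~: S| <= \sum_(k < t) \sum_(x in S) \sum_(y : V) (upd x (y k) \notin S))%N.
Proof.
pose h (k : nat) (x y : V) : V :=
  [ffun j : 'I_t => if (j < k)%N then y j else x j].
have h0 x y : h 0%N x y = x by apply/ffunP => j; rewrite ffunE.
have ht x y : h t x y = y by apply/ffunP => j; rewrite ffunE ltn_ord.
have hS (k : 'I_t) x y : h k.+1 x y = upd (h k x y) (h k y x k).
  apply/ffunP => j; have [->|jk] := eqVneq j k.
    by rewrite upd_same !ffunE ltnSn ltnn.
  by rewrite upd_other// !ffunE ltnS [(j <= k)%N]leq_eqVlt (negbTE (jk : nat_of_ord j != k)).
have -> : (#|S| * #|~: S| = \sum_(x : V) \sum_(y : V) ((x \in S) && (y \notin S)))%N.
  rewrite -cardsX -sum1_card pair_big /= [LHS]big_mkcond; apply: eq_bigr => u _.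
  by rewrite !inE; case: (_ && _).
have step x y : (((x \in S) && (y \notin S)) <=
    \sum_(k < t) ((h k x y \in S) && (h k.+1 x y \notin S)))%N.
  case: (boolP (x \in S)) => // xS; case: (boolP (y \in S)) => // yS.
  have : exists k, (k <= t)%N && (h k x y \notin S) by exists t; rewrite leqnn ht.
  move=> ex; case: (ex_minnP ex) => -[|m]; first by rewrite h0 xS.
  move=> /andP[mt hm] min; rewrite (bigD1 (Ordinal mt))//= hm andbT.
  have -> : h m x y \in S; last by [].
  by apply: contraT => hmS; have := min m; rewrite hmS (ltnW mt) ltnn => /(_ isT).
apply: (@leq_trans (\sum_x \sum_y \sum_(k < t) ((h k x y \in S) && (h k.+1 x y \notin S)))%N).
  by apply: leq_sum => x _; apply: leq_sum => y _; apply: step.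
under eq_bigr => x _ do rewrite exchange_big.
rewrite exchange_big /=; apply: leq_sum => k _.
rewrite pair_big /= [in leqRHS]big_mkcond /=.
have E x : (if x \in S then \sum_(y : V) (upd x (y k) \notin S) else 0)%N =
    (\sum_(y : V) ((x \in S) && (upd x (y k) \notin S)))%N.
  by case: (x \in S) => //=; rewrite big1.
under [in leqRHS]eq_bigr => x _ do rewrite E.
rewrite [in leqRHS]pair_big /=.
pose f (u : V * V) := (h k u.1 u.2, h k u.2 u.1).
have fK : involutive f.
  move=> [x y]; rewrite /f /=; congr (_, _); apply/ffunP => j; rewrite !ffunE;
  by case: ltnP.
rewrite [leqRHS](reindex_inj (inv_inj fK)) /=.
by apply: leq_sum => -[x y] _ /=; rewrite hS.
Qed.

(** * Isoperimetry of the product from that of its factors *)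

Section Isoperimetry.
Variables (R : realType) (i : R).
Hypothesis i0 : 0 <= i.
Hypothesis factor : forall k (A : {set G k}),
  i * (#|A| * #|~: A|)%:R <= (#|G k| * edge_boundary A)%:R.

(** The inequality of [G k], applied in every fibre of direction [k] and averaged. From a fibre
    meeting [S] in [A], a uniform new coordinate leaves [S] with probability [#|~: A| / #|G k|],
    which produces the product [#|A| * #|~: A|]. *)
Lemma resample_boundary S k :
  i * (\sum_(x in S) \sum_(y : V) (upd x (y k) \notin S))%:R <=
  #|V|%:R * (\sum_(x in S) \sum_(b | adj (x k) b) (upd x b \notin S))%:R.
Proof.
have [V0|/card_gt0P[x0 _]] := posnP #|V|.
  rewrite (eq_bigl (fun=> false)) ?big_pred0_eq; last first.
    by move=> x; have := max_card (mem [set x]); rewrite cards1 V0.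
  by rewrite mulr0 V0 mul0r.
have g0 : (0 < #|G k|)%N by apply/card_gt0P; exists (x0 k).
have g0R : 0 < (#|G k|%:R : R) by rewrite ltr0n.
pose fib x : {set G k} := [set a | upd x a \in S].
have fibU x (a : G k) : fib (upd x a) = fib x by apply/setP => b; rewrite !inE updK.
have fib_card x : #|fib x| = (\sum_(a : G k) (upd x a \in S))%N.
  by rewrite /fib -sum1dep_card big_mkcond /=; apply: eq_bigr => a _; case: (_ \in _).
have fibC_card x : #|~: fib x| = (\sum_(a : G k) (upd x a \notin S))%N.
  rewrite -sum1_card big_mkcond /=.
  by apply: eq_bigr => a _; rewrite !inE; case: (_ \in _).
(* One factor [#|G k|] accounts for drawing the new coordinate from a vertex of [V], the other for
   counting each fibre once per vertex. *)
have lhs : ((\sum_(x in S) \sum_(y : V) (upd x (y k) \notin S)) * #|G k| * #|G k| =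
    (\sum_x #|fib x| * #|~: fib x|) * #|V|)%N.
  have E1 x : ((\sum_(y : V) (upd x (y k) \notin S)) * #|G k| = #|~: fib x| * #|V|)%N.
    by rewrite fibC_card (sum_coordinate_nat (fun a => (upd x a \notin S) : nat)).
  rewrite big_distrl /= [in LHS]big_distrl /=.
  under eq_bigr => x xS do rewrite E1.
  rewrite big_mkcond /=.
  have := @sum_resample_nat k (fun x => if x \in S then (#|~: fib x| * #|V|)%N else 0%N).
  move=> E2; transitivity ((\sum_x if x \in S then (#|~: fib x| * #|V|)%N else 0%N) * #|G k|)%N.
    by rewrite big_distrl /=; apply: eq_bigr => x _; case: (x \in S).
  transitivity (\sum_x \sum_(a : G k)
      (if upd x a \in S then (#|~: fib (upd x a)| * #|V|)%N else 0%N))%N; first exact/esym.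
  rewrite big_distrl /=; apply: eq_bigr => x _.
  rewrite fib_card !big_distrl /=; apply: eq_bigr => a _.
  by rewrite fibU; case: (upd x a \in S); rewrite ?mul1n.
have rhs : ((\sum_(x in S) \sum_(b | adj (x k) b) (upd x b \notin S)) * #|G k| =
    \sum_x edge_boundary (fib x))%N.
  rewrite big_mkcond.
  have <- := @sum_resample_nat k
    (fun x => if x \in S then (\sum_(b | adj (x k) b) (upd x b \notin S))%N else 0%N).
  apply: eq_bigr => x _; rewrite /edge_boundary.
  under eq_bigr => a _ do rewrite upd_same.
  rewrite -sum1dep_card -big_mkcond /=.
  under eq_bigr => a _ do under eq_bigr => b _ do rewrite updK.
  under eq_bigr => a _ do rewrite -big_mkcondr.
  rewrite pair_big_dep /=; apply: eq_bigl => u; rewrite !inE.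
  by congr (_ && _); rewrite andbC.
have key : i * (\sum_x #|fib x| * #|~: fib x|)%:R <= #|G k|%:R * (\sum_x edge_boundary (fib x))%:R.
  rewrite !natr_sum !mulr_sumr; apply: ler_sum => x _.
  by apply: le_trans (factor _) _; rewrite -natrM.
move/(congr1 (fun n : nat => n%:R : R)): lhs; rewrite !natrM => lhs.
move/(congr1 (fun n : nat => n%:R : R)): rhs; rewrite natrM => rhs.
rewrite -rhs in key; rewrite -(ler_pM2r g0R) -(ler_pM2r g0R).
rewrite -[X in X * _ <= _]mulrA -[leLHS]mulrA lhs mulrA.
apply: le_trans (ler_wpM2r (ler0n _ _) key) _.
by rewrite le_eqVlt; apply/orP; left; apply/eqP; ring.
Qed.

(** The form with [#|S| * #|~: S|] tensorises without loss: a pair of points decomposes into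
    one-coordinate changes, and each of these is controlled by its own factor. *)
Lemma product_isoperimetry S :
  i * (#|S| * #|~: S|)%:R <= (#|V| * edge_boundary S)%:R.
Proof.
apply: (@le_trans _ _ (i * (\sum_(k < t) \sum_(x in S) \sum_(y : V) (upd x (y k) \notin S))%:R)).
  by rewrite ler_wpM2l// ler_nat card_pairs_le_resample.
rewrite natr_sum mulr_sumr edge_boundary_sum exchange_big /= natrM natr_sum mulr_sumr.
by apply: ler_sum => k _; apply: resample_boundary.
Qed.
End Isoperimetry.

End Product.

(** * Typical degrees *)

Section ExponentialBounds.
Variable R : realType.
Implicit Types (p q z B M : R) (m : nat).

Lemma expR_le_quadratic (z : R) : z <= 2^-1 -> expR z <= 1 + z + 2 * z ^+ 2.
Proof.
move=> z2; have h : expR z * (1 - z) <= 1.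
  rewrite [leRHS](_ : 1 = expR z * expR (- z)); last by rewrite -expRD subrr expR0.
  by rewrite ler_pM2l ?expR_gt0//; apply: expR_ge1Dx.
have z1 : 0 < 1 - z by lra.
rewrite -(ler_pM2r z1); apply: le_trans h _.
have -> : (1 + z + 2 * z ^+ 2) * (1 - z) = 1 + z ^+ 2 * (1 - 2 * z) by ring.
by rewrite lerDl mulr_ge0 ?sqr_ge0//; lra.
Qed.

(** [x * expR (1 - x)] is the exponential rate of the size tail of a Poisson branching process of
    mean [x]. It is below 1 on both sides of criticality, so it serves the supercritical and the
    dual parameter alike. *)
Lemma mul_expR1B_lt1 (x : R) : x != 1 -> x * expR (1 - x) < 1.
Proof.
move=> x1; have h : x < expR (x - 1).
  by have := @expR_gt1Dx _ (x - 1); rewrite subr_eq0 => /(_ x1); lra.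
rewrite [ltRHS](_ : 1 = expR (x - 1) * expR (1 - x)); last first.
  by rewrite -expRD addrC subrKA subrr expR0.
by rewrite ltr_pM2r ?expR_gt0.
Qed.

(** Going from [p] to a smaller [q], each closed edge contributes a factor at most
    [expR (- (p - q))], so a lower bound on their number is needed; [weight_le_increase] needs an
    upper bound. This is why the exploration provides both. *)
Lemma weight_le_decrease p q M B m (z : nat) : 0 <= q -> q <= p -> p <= 1 -> B <= z%:R ->
  p ^+ m * expR (- ((p - q) * B)) <= M * q ^+ m ->
  p ^+ m * (1 - p) ^+ z <= M * (q ^+ m * (1 - q) ^+ z).
Proof.
move=> q0 qp p1 Bz H; have p0 := le_trans q0 qp.
have h1 : 1 - p <= (1 - q) * expR (- (p - q)).
  apply: (@le_trans _ _ ((1 - q) * (1 - (p - q)))); first by nra.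
  by rewrite ler_wpM2l//; [lra | exact: expR_ge1Dx].
have h2 : (1 - p) ^+ z <= (1 - q) ^+ z * expR (- ((p - q) * B)).
  apply: (@le_trans _ _ (((1 - q) * expR (- (p - q))) ^+ z)).
    by rewrite lerXn2r// ?nnegrE; [lra | apply: mulr_ge0; [lra|exact: expR_ge0]].
  rewrite exprMn -expRM_natr ler_wpM2l//; first by rewrite exprn_ge0//; lra.
  by rewrite ler_expR mulNr lerN2 ler_wpM2l//; lra.
apply: le_trans (ler_wpM2l (exprn_ge0 _ p0) h2) _.
rewrite mulrCA mulrC !mulrA ler_wpM2r//; first by rewrite exprn_ge0//; lra.
Qed.

Lemma weight_le_increase p q M B m (z : nat) : 0 <= p -> p <= q -> q < 1 -> z%:R <= B ->
  p ^+ m * expR ((q - p) / (1 - q) * B) <= M * q ^+ m ->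
  p ^+ m * (1 - p) ^+ z <= M * (q ^+ m * (1 - q) ^+ z).
Proof.
move=> p0 pq q1 zB H; have q10 : 0 < 1 - q by lra.
have h1 : 1 - p <= (1 - q) * expR ((q - p) / (1 - q)).
  have -> : 1 - p = (1 - q) * (1 + (q - p) / (1 - q)) by field; lra.
  by rewrite ler_wpM2l//; [exact: ltW | exact: expR_ge1Dx].
have h2 : (1 - p) ^+ z <= (1 - q) ^+ z * expR ((q - p) / (1 - q) * B).
  apply: (@le_trans _ _ (((1 - q) * expR ((q - p) / (1 - q))) ^+ z)).
    by rewrite lerXn2r// ?nnegrE; [lra | apply: mulr_ge0; [lra|exact: expR_ge0]].
  rewrite exprMn -expRM_natr ler_wpM2l//; first by rewrite exprn_ge0//; lra.
  by rewrite ler_expR ler_wpM2l// divr_ge0//; lra.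
apply: le_trans (ler_wpM2l (exprn_ge0 _ p0) h2) _.
rewrite mulrCA mulrC !mulrA ler_wpM2r//; first by rewrite exprn_ge0//; lra.
Qed.

End ExponentialBounds.

Section TypicalDegrees.
Variables (R : realType) (t : nat) (G : 'I_t -> sgraph) (c : nat).
Notation V := (cartesian_product G).
Hypothesis degree_bounds : forall k (a : G k), (1 <= degree a <= c)%N.
Hypothesis nonempty : forall k, (0 < #|G k|)%N.

Let avg k : R := average_degree (G k) R.

Lemma average_degree_bounds k : 1 <= avg k <= c%:R.
Proof.
have g0 : 0 < (#|G k|%:R : R) by rewrite ltr0n.
rewrite /avg /average_degree ler_pdivlMr// mul1r ler_pdivrMr// -natrM !ler_nat.
have E n : (n * #|G k| = \sum_(a : G k) n)%N by rewrite sum_nat_const mulnC.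
rewrite -[X in (X <= _)%N]mul1n !E.
by apply/andP; split; apply: leq_sum => a _; have /andP[] := degree_bounds a.
Qed.

Lemma card_product : (2 ^ t <= #|V|)%N.
Proof.
have v : V by apply: finfun => k; exact: (enum_default (Ordinal (nonempty k))).
have [//|k a|T [<- _ _]] := @cube_in_ball _ G v t _ _; last exact: max_card.
by have /andP[] := degree_bounds a.
Qed.

Lemma average_degree_product : average_degree V R = \sum_(k < t) avg k.
Proof.
have n0 : (0 < #|V|)%N by apply: leq_trans card_product; rewrite expn_gt0.
have n0' : (#|V|%:R : R) != 0 by rewrite pnatr_eq0 -lt0n.
rewrite /average_degree; apply: (mulIf n0'); rewrite divfK// mulr_suml.
under eq_bigr => x _ do rewrite degree_product.
rewrite exchange_big /= natr_sum; apply: eq_bigr => k _.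
have g0 : (#|G k|%:R : R) != 0 by rewrite pnatr_eq0 -lt0n.
apply: (mulIf g0); rewrite -natrM sum_coordinate_nat natrM.
by rewrite /avg /average_degree mulrAC divfK.
Qed.

Let d : R := average_degree V R.

Lemma average_degree_product_bounds : t%:R <= d <= (c * t)%:R.
Proof.
have E (r : R) : r * t%:R = \sum_(k < t) r by rewrite sumr_const card_ord mulr_natr.
rewrite /d average_degree_product; apply/andP; split.
  by rewrite -[leLHS]mul1r E; apply: ler_sum => k _; have /andP[] := average_degree_bounds k.
by rewrite natrM E; apply: ler_sum => k _; have /andP[] := average_degree_bounds k.
Qed.

(** The degree of a uniform vertex is a sum of independent coordinate degrees, so the moment
    factorises; in each factor the linear term of [expR_le_quadratic] averages to zero. *)
Lemma degree_moment (s : R) : `|s| * c%:R <= 2^-1 ->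
  \sum_(x : V) expR (s * ((degree x)%:R - d)) <= #|V|%:R * expR (2 * (s * c%:R) ^+ 2 * t%:R).
Proof.
move=> sc.
have E (x : V) : expR (s * ((degree x)%:R - d)) = \prod_(k < t) expR (s * ((degree (x k))%:R - avg k)).
  rewrite -expR_sum -mulr_sumr; congr (expR (_ * _)).
  by rewrite big_split /= sumrN /d average_degree_product degree_product natr_sum.
under eq_bigr => x _ do rewrite E.
rewrite -(prod_sum (fun k a => expR (s * ((degree a)%:R - avg k)))).
have -> : (#|V|%:R : R) = \prod_(k < t) #|G k|%:R.
  have -> : (#|V|%:R : R) = \sum_(x : V) \prod_(k < t) 1.
    by under eq_bigr => x _ do rewrite big1//; rewrite sumr_const.
  rewrite -(prod_sum (fun k _ => 1)).
  by apply: eq_bigr => k _; rewrite sumr_const.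
have -> : expR (2 * (s * c%:R) ^+ 2 * t%:R) = \prod_(k < t) expR (2 * (s * c%:R) ^+ 2).
  by rewrite prodr_const card_ord expRM_natr.
rewrite -big_split /=; apply: ler_prod => k _; apply/andP; split.
  by apply: sumr_ge0 => a _; apply: expR_ge0.
have g0 : 0 < (#|G k|%:R : R) by rewrite ltr0n.
have c0 : 0 <= (c%:R : R) by [].
apply: (@le_trans _ _ (\sum_(a : G k) (1 + s * ((degree a)%:R - avg k) + 2 * (s * c%:R) ^+ 2))).
  apply: ler_sum => a _; have /andP[m1 mc] := average_degree_bounds k.
  have /andP[] := degree_bounds a; rewrite -(ler_nat R) -(ler_nat R) => d1 dc.
  have dev : `|(degree a)%:R - avg k| <= c%:R by rewrite ler_norml; apply/andP; split; lra.
  have sdev : `|s * ((degree a)%:R - avg k)| <= `|s| * c%:R by rewrite normrM ler_wpM2l.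
  apply: le_trans (expR_le_quadratic _) _.
    by apply: le_trans (ler_norm _) (le_trans sdev sc).
  rewrite lerD2l ler_wpM2l// -[leLHS]real_normK ?num_real//.
  rewrite -[leRHS]real_normK ?num_real// lerXn2r ?nnegrE//.
  by rewrite [X in _ <= X]normrM (ger0_norm c0).
have sumC (r : R) : \sum_(a : G k) r = r *+ #|G k| by rewrite sumr_const.
rewrite !big_split /= -mulr_sumr big_split /= sumrN !sumC.
have -> : \sum_(a : G k) (degree a)%:R - avg k *+ #|G k| = 0 :> R.
  by rewrite -mulr_natr /avg /average_degree divfK ?gt_eqF// natr_sum subrr.
rewrite mulr0 addr0; apply: (@le_trans _ _ (#|G k|%:R * (1 + 2 * (s * c%:R) ^+ 2))).
  by rewrite mulrDr mulr1 [X in _ <= _ + X]mulr_natl.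
by rewrite ler_wpM2l//; exact: expR_ge1Dx.
Qed.

Definition atypical (delta : R) : {set V} :=
  [set x | delta * d < `|(degree x)%:R - d| ].

Lemma card_atypical (delta : R) : 0 < delta <= 1 ->
  #|atypical delta|%:R <= 2 * #|V|%:R * expR (- (delta ^+ 2 / (8 * c%:R ^+ 2) * t%:R)).
Proof.
move=> /andP[de0 de1].
have [t0|tpos] := posnP t.
  rewrite [X in - (_ * X)](_ : _ = 0) ?mulr0 ?oppr0 ?expR0 ?mulr1; last by rewrite t0.
  have : (#|atypical delta| <= #|V|)%N by apply: max_card.
  rewrite -(ler_nat R) => /le_trans; apply; rewrite ler_peMl//; lra.
have c1 : 1 <= (c%:R : R).
  pose k := Ordinal tpos; have /card_gt0P[a _] := nonempty k.
  by have /andP[h1 h2] := degree_bounds a; rewrite ler1n (leq_trans h1 h2).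
have c0 : 0 < (c%:R : R) by lra.
have /andP[dt _] := average_degree_product_bounds.
(* This [s] minimises the exponent [2 * (s * c) ^+ 2 * t - s * delta * t]. *)
pose s := delta / (4 * c%:R ^+ 2).
have s0 : 0 < s by rewrite divr_gt0// mulr_gt0// exprn_gt0.
have scE : s * c%:R = delta / (4 * c%:R) by rewrite /s; field; lra.
have sc : s * c%:R <= 2^-1.
  by rewrite scE ler_pdivrMr; [lra | lra].
have hp := @degree_moment s; have hn := @degree_moment (- s).
rewrite normrN (gtr0_norm s0) in hp hn.
have {}hp := hp sc; have {}hn := hn sc.
rewrite mulNr sqrrN in hn.
have markov : #|atypical delta|%:R * expR (s * (delta * d)) <=
    \sum_(x : V) (expR (s * ((degree x)%:R - d)) + expR (- s * ((degree x)%:R - d))).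
  rewrite -sum1_card natr_sum mulr_suml big_mkcond; apply: ler_sum => x _.
  case: ifP => [|_]; last by rewrite addr_ge0 ?expR_ge0.
  rewrite inE mul1r => xd.
  have [h|h] := lerP 0 ((degree x)%:R - d).
    rewrite (ger0_norm h) in xd; rewrite ler_wpDr ?expR_ge0// ler_expR ler_wpM2l ?ltW//.
  rewrite (ltr0_norm h) in xd; rewrite ler_wpDl ?expR_ge0// ler_expR mulNr -mulrN.
  by rewrite ler_wpM2l ?ltW.
rewrite big_split /= in markov.
have {}markov := le_trans markov (lerD hp hn).
have -> : expR (- (delta ^+ 2 / (8 * c%:R ^+ 2) * t%:R)) =
    expR (2 * (s * c%:R) ^+ 2 * t%:R) / expR (s * (delta * t%:R)).
  rewrite -expRN -expRD; congr expR; rewrite scE /s; field; lra.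
rewrite mulrA ler_pdivlMr ?expR_gt0//.
apply: (@le_trans _ _ (#|atypical delta|%:R * expR (s * (delta * d)))).
  by rewrite ler_wpM2l// ler_expR ler_pM2l// ler_pM2l.
by apply: le_trans markov _; lra.
Qed.

End TypicalDegrees.

(** * Cluster sizes *)

Section ClusterSize.
Variables (R : realType) (G : sgraph) (d delta : R) (K : nat) (Typ : {set G}).
Hypotheses (d1 : 1 < d) (delta01 : 0 <= delta <= 2^-1).
Hypothesis typical_degree : forall x, x \in Typ ->
  (1 - delta) * d <= (degree x)%:R <= (1 + delta) * d.
Hypothesis small_sets : forall S : {set G}, (#|S| <= K)%N ->
  (volume S)%:R <= (edge_boundary S)%:R + delta * d * #|S|%:R.

Let d0 : 0 < d. Proof. exact: lt_trans d1. Qed.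

Lemma boundary_typical (S : {set G}) : S \subset Typ -> (#|S| <= K)%N ->
  (1 - 2 * delta) * d * #|S|%:R <= (edge_boundary S)%:R.
Proof.
move=> ST /small_sets h.
have : (1 - delta) * d * #|S|%:R <= (volume S)%:R.
  rewrite mulr_natr -sumr_const natr_sum; apply: ler_sum => x xS.
  by have /andP[] := typical_degree (subsetP ST _ xS).
by lra.
Qed.

Lemma volume_typical (S : {set G}) : S \subset Typ ->
  (volume S)%:R <= (1 + delta) * d * #|S|%:R.
Proof.
move=> ST; rewrite mulr_natr -sumr_const natr_sum; apply: ler_sum => x xS.
by have /andP[] := typical_degree (subsetP ST _ xS).
Qed.

(** A perturbation of [a * expR (1 - a)]: each vertex of a small typical set sees at least
    [(1 - 2 * delta) * d] boundary edges on average. *)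
Definition decay (a : R) : R := a * expR (- ((a - 1) * (1 - 2 * delta))).

Lemma decay_ge0 a : 0 <= a -> 0 <= decay a.
Proof. by move=> a0; rewrite mulr_ge0 ?expR_ge0. Qed.

Lemma prob_div_d (a : R) : 0 <= a <= d -> 0 <= a / d <= 1.
Proof.
by move=> /andP[a0 ad]; rewrite divr_ge0 ?(ltW d0)//= ler_pdivrMr// mul1r.
Qed.

Lemma bexp_pred_le1 (p : R) (A : {set {set G}} -> bool) : 0 <= p <= 1 ->
  bexp p (edges G) (fun F => (A F)%:R) <= 1.
Proof. by move=> p01; apply: bexp_le_cst => // F _; rewrite lern1; case: (A F). Qed.

(** Comparison with [1 / d], where the probability is bounded by 1: a cluster of [s] vertices shows
    [s - 1] open edges and at least [(1 - 2 * delta) * d * s] closed ones. The limit [s.+1] on the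
    exploration ensures that a cluster of order [s] is explored completely. *)
Lemma prob_cluster_eq (a : R) v s : 1 <= a <= d -> (s <= K)%N ->
  bexp (a / d) (edges G) (fun F => ((#|cluster F v| == s) && (cluster F v \subset Typ))%:R)
    <= decay a ^+ s.
Proof.
move=> /andP[a1 ad] sK.
have p01 : 0 <= a / d <= 1 by apply: prob_div_d; rewrite ad; lra.
have q01 : 0 <= 1 / d <= 1 by apply: prob_div_d; rewrite ltW//; lra.
have rho0 : 0 <= decay a by apply: decay_ge0; lra.
apply: (@le_trans _ _ (decay a ^+ s * bexp (1 / d) (edges G)
    (fun F => ((#|cluster F v| == s) && (cluster F v \subset Typ))%:R))); last first.
  by rewrite ler_piMr ?exprn_ge0// bexp_pred_le1.
apply: (@exploration_comparison _ _ _ _ _ v s.+1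
  (fun S : {set G} => (#|S| == s) && (S \subset Typ))) => //.
  move=> S S' hS hS'; have -> : (#|S| == s) = false by apply: gtn_eqF.
  by have -> : (#|S'| == s) = false by apply: gtn_eqF.
move=> S z vS _ _ _ bz /andP[/eqP Ss ST].
have Sb := boundary_typical ST; rewrite Ss in Sb bz *.
apply: (@weight_le_decrease _ _ _ _ ((1 - 2 * delta) * d * s%:R)).
- by case/andP: q01.
- by rewrite ler_pM2r ?invr_gt0//.
- by case/andP: p01.
- by apply: le_trans (Sb sK) _; rewrite ler_nat bz.
have -> : (a / d - 1 / d) * ((1 - 2 * delta) * d * s%:R) = (a - 1) * (1 - 2 * delta) * s%:R.
  by field; lra.
rewrite div1r exprMn -mulNr expRM_natr /decay.
have q0 : 0 <= d^-1 by rewrite invr_ge0 ltW.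
rewrite exprMn mulrAC; apply: ler_wpM2r; first exact: exprn_ge0.
by apply: ler_wpM2r; [apply/exprn_ge0/expR_ge0 | rewrite ler_weXn2l// leq_pred].
Qed.

Lemma geometric_tail (r : R) (k m : nat) : 0 <= r -> r < 1 ->
  \sum_(k <= s < m) r ^+ s <= r ^+ k / (1 - r).
Proof.
move=> r0 r1; have r1' : 0 < 1 - r by lra.
rewrite ler_pdivlMr//; have [mk|km] := leqP m k.
  by rewrite big_geq// mul0r exprn_ge0.
rewrite mulr_suml (eq_bigr (fun s => - (r ^+ s.+1 - r ^+ s))); last first.
  by move=> s _; rewrite exprS; ring.
rewrite sumrN telescope_sumr 1?ltnW// opprB lerBlDr lerDl exprn_ge0//.
Qed.

Lemma prob_cluster_range (a : R) v k m : 1 <= a <= d -> (m <= K.+1)%N -> decay a < 1 ->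
  bexp (a / d) (edges G)
    (fun F => ((k <= #|cluster F v| < m)%N && (cluster F v \subset Typ))%:R)
    <= decay a ^+ k / (1 - decay a).
Proof.
move=> a1d mK rho1; have a0 : 0 <= a by lra.
have p01 : 0 <= a / d <= 1 by apply: prob_div_d; lra.
apply: le_trans (geometric_tail k m (decay_ge0 a0) rho1).
have -> : bexp (a / d) (edges G)
    (fun F => ((k <= #|cluster F v| < m)%N && (cluster F v \subset Typ))%:R) =
  \sum_(k <= s < m) bexp (a / d) (edges G)
    (fun F => ((#|cluster F v| == s) && (cluster F v \subset Typ))%:R).
  rewrite -bexp_sum; apply: eq_bexp => F _.
  have [ST|] := boolP (cluster F v \subset Typ); last first.
    by rewrite andbF big1// => s _; rewrite andbF.
  rewrite andbT; have [km|nkm] := boolP (k <= _ < _)%N.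
    rewrite (bigD1_seq #|cluster F v|) ?mem_index_iota ?iota_uniq//= eqxx.
    by rewrite big1 ?addr0// => s /negbTE h; rewrite eq_sym h.
  rewrite big_seq big1// => s; rewrite mem_index_iota => ks.
  by case: eqP => // E; move: nkm; rewrite E ks.
rewrite big_seq [leRHS]big_seq; apply: ler_sum => s; rewrite mem_index_iota => /andP[_ sm].
by apply: prob_cluster_eq => //; rewrite -ltnS; apply: leq_trans mK.
Qed.

(** From [1 + lambda * y < expR (lambda * y)] and the survival equation,
    [(1 + lambda * y) * (1 - y) < 1], which rearranges to [y * mu < y]. *)
Lemma dual_lt1 (lambda y mu : R) : 1 < lambda -> 0 < y < 1 -> expR (- (lambda * y)) = 1 - y ->
  mu = lambda * (1 - y) -> 0 < mu < 1.
Proof.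
move=> lambda1 y01 survival muE.
have /andP[y0 y1] := y01; apply/andP; split; first by rewrite muE mulr_gt0//; lra.
have ly0 : 0 < lambda * y by rewrite mulr_gt0//; lra.
have h : 1 + lambda * y < expR (lambda * y) by apply: expR_gt1Dx; rewrite gt_eqF.
have E : expR (lambda * y) * (1 - y) = 1 by rewrite -survival -expRD subrr expR0.
have h2 : (1 + lambda * y) * (1 - y) < 1 by rewrite -[ltRHS]E ltr_pM2r//; lra.
have h3 : y * mu < y * 1 by rewrite muE; lra.
by move: h3; rewrite ltr_pM2l.
Qed.

(** For [s] vertices and [d * s] closed edges, going from [lambda / d] to [mu / d] changes the
    weight by about [(1 - y) ^- s.-1 * expR (- (lambda * y) * s)], which the survival equation makes
    equal to [1 - y] whatever [s] is. The exponential factor pays for [delta] and for an [a] below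
    [lambda], the first round of the sprinkling. *)
Lemma prob_cluster_small (lambda y mu a : R) v k : lambda <= d -> 1 < lambda -> 0 < y < 1 -> expR (- (lambda * y)) = 1 - y ->
  mu = lambda * (1 - y) ->
  1 <= a <= lambda -> (k <= K.+1)%N ->
  bexp (a / d) (edges G) (fun F => ((#|cluster F v| < k)%N && (cluster F v \subset Typ))%:R)
    <= (1 - y) * expR ((lambda - a + 2 * delta * lambda) * k%:R).
Proof.
move=> lambdad lambda1 y01 survival muE /andP[a1 al] kK; have /andP[y0 y1] := y01; have /andP[de0 de1] := delta01.
have /andP[mu0 mu1] := dual_lt1 lambda1 y01 survival muE.
have p01 : 0 <= a / d <= 1 by apply: prob_div_d; lra.
have q01 : 0 <= mu / d <= 1 by apply: prob_div_d; lra.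
set M := _ * expR _.
have M0 : 0 <= M by rewrite mulr_ge0 ?expR_ge0//; lra.
apply: (@le_trans _ _ (M * bexp (mu / d) (edges G)
    (fun F => ((#|cluster F v| < k)%N && (cluster F v \subset Typ))%:R))); last first.
  by rewrite ler_piMr// bexp_pred_le1.
have [->|k0] := posnP k.
  by do 2 (rewrite (eq_bexp _ (g := fun=> 0))//; rewrite ?bexp_cst ?mulr0//).
apply: (@exploration_comparison _ _ _ _ _ v k
  (fun S : {set G} => (#|S| < k)%N && (S \subset Typ))) => //.
  by move=> S S' hS hS'; rewrite !ltnNge hS hS'.
move=> S z vS _ _ _ bz /andP[Sk ST].
have SK : (#|S| <= K)%N by rewrite -ltnS; apply: leq_trans kK.
have S0 : (0 < #|S|)%N by apply/card_gt0P; exists v.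
apply: (@weight_le_decrease _ _ _ _ ((1 - 2 * delta) * d * #|S|%:R)).
- by case/andP: q01.
- by rewrite ler_pM2r ?invr_gt0//; lra.
- by case/andP: p01.
- by apply: le_trans (boundary_typical ST SK) _; rewrite ler_nat bz.
have -> : (a / d - mu / d) * ((1 - 2 * delta) * d * #|S|%:R) =
    (a - mu) * (1 - 2 * delta) * #|S|%:R by field; lra.
have -> : mu / d = lambda / d * (1 - y) by rewrite muE; ring.
rewrite [(lambda / d * (1 - y)) ^+ _]exprMn [leRHS]mulrCA; apply: ler_pM.
- by rewrite exprn_ge0//; case/andP: p01.
- exact: expR_ge0.
- by rewrite lerXn2r ?nnegrE ?ler_pM2r ?invr_gt0// divr_ge0//; lra.
have -> : M * (1 - y) ^+ #|S|.-1 = (1 - y) ^+ #|S| *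
    expR ((lambda - a + 2 * delta * lambda) * k%:R).
  by rewrite /M mulrAC -exprS prednK.
rewrite -survival -expRM_natr -expRD ler_expR.
have Sk' : (#|S|%:R : R) <= k%:R by rewrite ler_nat ltnW.
have S0' : 0 <= (#|S|%:R : R) by [].
have h1 : 0 <= lambda - a + 2 * delta * lambda.
  by rewrite addr_ge0 ?subr_ge0// mulr_ge0 ?mulr_ge0//; lra.
apply: (@le_trans _ _ (- (lambda * y) * #|S|%:R + (lambda - a + 2 * delta * lambda) * #|S|%:R)).
  rewrite -mulrDl -mulNr ler_wpM2r// muE.
  have : 0 <= delta * (lambda - a + (lambda - lambda * y)).
    by rewrite mulr_ge0//; nra.
  have : 0 <= delta * mu by rewrite mulr_ge0// ltW.
  by rewrite muE; nra.
by rewrite lerD2l ler_wpM2l.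
Qed.

(* Duality in the other direction is only needed up to a fixed size [k], where the
   number of queried edges is controlled by the degrees in the ball of radius [k]. *)
Lemma prob_cluster_small_ge (lambda y mu : R) v k : lambda <= d -> 1 < lambda -> 0 < y < 1 -> expR (- (lambda * y)) = 1 - y ->
  mu = lambda * (1 - y) ->
  ball v k \subset Typ -> (0 < k)%N ->
  lambda / d <= delta / (1 + delta) -> delta <= 3^-1 ->
  (1 - y) * expR (- (4 * delta * lambda * k%:R)) *
    (1 - mu^-1 * (mu * expR ((1 - mu) * (1 + 3 * delta))) ^+ k) <=
  bexp (lambda / d) (edges G) (fun F => (#|cluster F v| < k)%N%:R).
Proof.
move=> lambdad lambda1 y01 survival muE vT k0 ld de3; have /andP[y0 y1] := y01; have /andP[de0 de1] := delta01.
have /andP[mu0 mu1] := dual_lt1 lambda1 y01 survival muE.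
have l01 : 0 <= lambda / d <= 1 by apply: prob_div_d; lra.
have q01 : 0 <= mu / d <= 1 by apply: prob_div_d; lra.
have o01 : 0 <= 1 / d <= 1 by apply: prob_div_d; lra.
have ldlt : 1 / (1 - lambda / d) <= 1 + delta.
  have E : 1 - delta / (1 + delta) = (1 + delta)^-1 by field; lra.
  rewrite div1r invf_ple ?posrE; [lra | |lra].
  have : 0 < (1 + delta)^-1 by rewrite invr_gt0; lra.
  lra.
have dlt1 : 0 < 1 - lambda / d.
  have : delta / (1 + delta) < 1 by rewrite ltr_pdivrMr; lra.
  lra.
have STyp (S : {set G}) : S \subset ball v #|S|.-1 -> (#|S| <= k)%N -> S \subset Typ.
  move=> Sb Sk; apply: subset_trans vT; apply: subset_trans Sb _; apply: ball_le.
  by apply: leq_trans (leq_pred _) Sk.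
set M := mu^-1 * _ ^+ k.
(* Here the probability is raised from [mu / d] to the critical [1 / d]. The exploration stops at
   [k] vertices, so the ratio of weights is evaluated at this one size. *)
have large : bexp (mu / d) (edges G) (fun F => (k <= #|cluster F v|)%N%:R) <= M.
  have M0 : 0 <= M.
    by rewrite mulr_ge0 ?invr_ge0 ?exprn_ge0 ?mulr_ge0 ?expR_ge0 ?(ltW mu0).
  apply: (@le_trans _ _ (M * bexp (1 / d) (edges G) (fun F => (k <= #|cluster F v|)%N%:R)));
    last by rewrite ler_piMr// bexp_pred_le1.
  apply: (@exploration_comparison _ _ _ _ _ v k (fun S : {set G} => (k <= #|S|)%N)) => //.
    by move=> S S' -> ->.
  move=> S z vS Sb Sk zS _ kS.
  have Sk' : #|S| = k by apply/eqP; rewrite eqn_leq Sk.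
  have ST := STyp _ Sb Sk; rewrite Sk'.
  apply: (@weight_le_increase _ _ _ _ ((1 + delta) * d * k%:R)).
  - by case/andP: q01.
  - by rewrite ler_pM2r ?invr_gt0// ltW.
  - by rewrite ltr_pdivrMr// mul1r.
  - by apply: le_trans (_ : (volume S)%:R <= _); rewrite ?ler_nat// -Sk' volume_typical.
  have -> : (1 / d - mu / d) / (1 - 1 / d) * ((1 + delta) * d * k%:R) =
      (1 - mu) * ((1 + delta) / (1 - 1 / d)) * k%:R by field; lra.
  rewrite div1r (exprMn _ mu d^-1) mulrAC ler_wpM2r ?exprn_ge0 ?invr_ge0 ?(ltW d0)//.
  have muk : mu^-1 * mu ^+ k = mu ^+ k.-1.
    by case: (k) k0 => // m _; rewrite exprS mulKf ?gt_eqF.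
  rewrite expRM_natr /M exprMn [leRHS]mulrA muk.
  rewrite ler_wpM2l ?exprn_ge0 ?(ltW mu0)// lerXn2r ?nnegrE ?expR_ge0// ler_expR.
  rewrite ler_wpM2l//; first lra.
  have h1 : 1 / (1 - d^-1) <= 1 + delta.
    apply: le_trans ldlt; rewrite !div1r lef_pV2 ?posrE//; last first.
      by rewrite subr_gt0 invf_lt1.
    by rewrite lerD2l lerN2 ler_peMl ?invr_ge0 ?(ltW d0)// ltW.
  rewrite -[(1 - d^-1)^-1]div1r.
  apply: (@le_trans _ _ ((1 + delta) * (1 + delta))); last by nra.
  by rewrite ler_wpM2l//; lra.
have small : bexp (mu / d) (edges G) (fun F => (#|cluster F v| < k)%N%:R) <=
    ((1 - y)^-1 * expR (4 * delta * lambda * k%:R)) *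
    bexp (lambda / d) (edges G) (fun F => (#|cluster F v| < k)%N%:R).
  apply: (@exploration_comparison _ _ _ _ _ v k (fun S : {set G} => (#|S| < k)%N)) => //.
    by move=> S S' hS hS'; rewrite !ltnNge hS hS'.
  move=> S z vS Sb Sk zS _ Sltk; have ST := STyp _ Sb Sk.
  have S0 : (0 < #|S|)%N by apply/card_gt0P; exists v.
  apply: (@weight_le_increase _ _ _ _ ((1 + delta) * d * #|S|%:R)).
  - by case/andP: q01.
  - by rewrite ler_pM2r ?invr_gt0// muE ler_piMr; lra.
  - by lra.
  - by apply: le_trans (_ : (volume S)%:R <= _); rewrite ?ler_nat// volume_typical.
  have -> : (lambda / d - mu / d) / (1 - lambda / d) * ((1 + delta) * d * #|S|%:R) =
      lambda * y * ((1 + delta) * (1 / (1 - lambda / d))) * #|S|%:R.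
    by rewrite muE div1r; set u := (1 - _)^-1; field; lra.
  have -> : mu / d = lambda / d * (1 - y) by rewrite muE; ring.
  rewrite !(exprMn _ (lambda / d) (1 - y)) -[leLHS]mulrA [leRHS]mulrC.
  apply: ler_wpM2l; first by apply: exprn_ge0; case/andP: l01.
  have y1' : 0 < 1 - y by lra.
  rewrite -(ler_pM2l y1') [leLHS]mulrA -exprS prednK// [leRHS]mulrA mulfV ?gt_eqF// !mul1r.
  rewrite -survival -expRM_natr -expRD ler_expR; set c := (1 + delta) * _.
  have Sk' : (#|S|%:R : R) <= k%:R by rewrite ler_nat.
  have S0' : 0 <= (#|S|%:R : R) by [].
  have h1 : c <= 1 + 4 * delta.
    apply: (@le_trans _ _ ((1 + delta) * (1 + delta))); last by nra.
    by rewrite ler_wpM2l//; [lra | rewrite -div1r].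
  have ly0 : 0 <= lambda * y by rewrite mulr_ge0//; lra.
  have ly1 : lambda * y <= lambda by rewrite ler_piMr//; lra.
  have h2 := ler_wpM2l (mulr_ge0 ly0 S0') h1.
  have h3 := ler_wpM2l de0 (ler_pM ly0 S0' ly1 Sk').
  by lra.
have tot : bexp (mu / d) (edges G) (fun F => (#|cluster F v| < k)%N%:R) =
    1 - bexp (mu / d) (edges G) (fun F => (k <= #|cluster F v|)%N%:R).
  rewrite -[X in X - _](bexp_cst (mu / d) (edges G)) -bexpB; apply: eq_bexp => F _.
  by rewrite ltnNge; case: (k <= _)%N; rewrite ?subrr ?subr0.
rewrite tot in small; have {}small := le_trans (lerB (lexx 1) large) small.
have y1' : 0 < 1 - y by lra.
have := ler_wpM2l (mulr_ge0 (ltW y1') (expR_ge0 (- (4 * delta * lambda * k%:R)))) small.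
move=> /le_trans; apply; rewrite !mulrA.
rewrite [X in X * bexp _ _ _](_ : _ = 1) ?mul1r//.
by rewrite expRN; field; rewrite !gt_eqF ?expR_gt0.
Qed.

End ClusterSize.

(** * The number of vertices in large clusters *)

Section LargeClusters.
Variable G : sgraph.
Implicit Types (x y v : G) (S Q T : {set G}) (F : {set {set G}}).

Definition large F (m : nat) : {set G} := [set x | (m <= #|cluster F x|)%N].

Definition far F (m L : nat) : {set G} := [set v | ball v L :&: large F m == set0].

Lemma in_large F m x : (x \in large F m) = (m <= #|cluster F x|)%N.
Proof. by rewrite inE. Qed.

Lemma large_mono F F' m : F \subset F' -> large F m \subset large F' m.
Proof.
move=> FF'; apply/subsetP => x; rewrite !in_large => /leq_trans; apply.
exact/subset_leq_card/cluster_mono.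
Qed.

Definition pivotal F m (e : {set G}) : {set G} := large (e |: F) m :\: large F m.

Lemma pivotal_touches F m e x : e \in edges G -> x \in pivotal F m e ->
  exists2 a, a \in e & a \in cluster F x.
Proof.
move=> eE; rewrite inE !in_large -ltnNge => /andP[small big].
have [/existsP[a /andP[ae ax]]|/existsPn none] := boolP [exists a in e, a \in cluster F x].
  by exists a.
suff sub : cluster (e |: F) x \subset cluster F x.
  by have := leq_trans big (subset_leq_card sub); rewrite leqNgt small.
apply: cluster_sub; first exact: cluster_id.
move=> a b ax bx ab; rewrite in_setU1 negb_or; apply/andP; split.
  by apply/eqP => E; have := none a; rewrite ax -E !inE eqxx.
by apply: contra bx => abF; apply: cluster_step abF.
Qed.

(** Adding [e] enlarges only the clusters of its two endpoints, and a vertex that becomes large was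
    in a cluster of order below [m]. *)
Lemma card_pivotal F m e : e \in edges G -> (#|pivotal F m e| <= 2 * m)%N.
Proof.
move=> eE; have /edgesP[a [b [_ eab]]] := eE.
pose C z := if (#|cluster F z| < m)%N then cluster F z else set0.
have cC z : (#|C z| <= m)%N by rewrite /C; case: ifP => [/ltnW|]; rewrite ?cards0.
apply: (@leq_trans #|C a :|: C b|); last first.
  by apply: leq_trans (leq_card_setU _ _) _; rewrite mul2n -addnn leq_add.
apply/subset_leq_card/subsetP => x xp.
have [z ze zx] := pivotal_touches eE xp.
have xC : x \in C z.
  rewrite /C (cluster_eq zx); move: xp; rewrite inE in_large -ltnNge => /andP[-> _].
  exact: cluster_id.
by move: ze; rewrite eab !inE => /orP[] /eqP <-; rewrite xC ?orbT.
Qed.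

(** Double counting: [x] can become large only through an edge touching its cluster, which has fewer
    than [m] vertices. *)
Lemma sum_pivotal F m Q :
  (\sum_(e in edges G) #|Q :&: pivotal F m e| <= #|Q| * (m * max_degree G))%N.
Proof.
rewrite -sum_nat_const.
have -> : (\sum_(e in edges G) #|Q :&: pivotal F m e| =
    \sum_(x in Q) #|[set e in edges G | x \in pivotal F m e]|)%N.
  transitivity (\sum_(e in edges G) \sum_(x in Q) (x \in pivotal F m e))%N.
    apply: eq_bigr => e _; rewrite -sum1_card big_mkcond [RHS]big_mkcond.
    by apply: eq_bigr => x _; rewrite in_setI; case: (x \in Q) => //=; case: (x \in _).
  rewrite exchange_big; apply: eq_bigr => x _ /=.
  by rewrite -sum1dep_card big_mkcondr; apply: eq_bigr => e _; case: (x \in _).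
apply: leq_sum => x xQ.
have [small|big] := ltnP #|cluster F x| m; last first.
  rewrite (_ : [set e in edges G | _] = set0) ?cards0//.
  by apply/setP => e; rewrite !in_set big /= andbF.
apply: leq_trans (card_edges_touching (S := cluster F x) _ _) _.
- by apply/subsetP => e; rewrite in_set => /andP[].
- move=> e; rewrite in_set => /andP[eE xp].
  by have [a ae ax] := pivotal_touches eE xp; exists a.
- by apply: leq_trans (volume_le _) _; rewrite leq_mul2r ltnW ?orbT.
Qed.

(** * Variance of the number of vertices in large clusters, and far vertices *)

Section Variance.
Variables (R : realType) (p : R).
Hypothesis p01 : 0 <= p <= 1.

(** In the Efron-Stein sum, one factor of each squared increment is bounded by [2 * m] and the other
    is summed by double counting. The result is linear in [#|Q|], so it is useful for a ball as well
    as for the whole graph. *)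
Lemma variance_large m Q :
  bvar p (edges G) (fun F => #|Q :&: large F m|%:R) <=
  p * (2 * m * (#|Q| * (m * max_degree G)))%:R.
Proof.
have /andP[p0 p1] := p01.
apply: le_trans (efron_stein p01 _ _) _; rewrite ler_wpM2l// -bexp_sum.
apply: bexp_le_cst => // F _.
apply: (@le_trans _ _ (\sum_(e in edges G) (2 * m * #|Q :&: pivotal F m e|)%:R)); last first.
  by rewrite -natr_sum ler_nat -big_distrr leq_mul2l sum_pivotal orbT.
apply: ler_sum => e eE; case: (e \notin F); last by rewrite mul0r.
have sub := large_mono m (subsetUr [set e] F).
have -> : #|Q :&: large (e |: F) m|%:R - #|Q :&: large F m|%:R =
    #|Q :&: pivotal F m e|%:R :> R.
  apply/eqP; rewrite subr_eq -natrD eqr_nat; apply/eqP.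
  rewrite -(cardsID (large F m)) addnC; congr (_ + _)%N; apply: eq_card => x.
    by rewrite !inE andbCA.
  have := subsetP sub x; rewrite !inE; case: (x \in Q) => //=.
  by case: (m <= #|cluster F x|)%N => [->|] //; rewrite andbF.
rewrite mul1r -natrX ler_nat -mulnn leq_mul2r.
rewrite (leq_trans (subset_leq_card (subsetIr _ _)))// ?orbT// card_pivotal//.
Qed.

Lemma bexp_card (H : {set {set G}} -> {set G}) :
  bexp p (edges G) (fun F => #|H F|%:R) = \sum_x bexp p (edges G) (fun F => (x \in H F)%:R).
Proof.
rewrite -bexp_sum; apply: eq_bexp => F _.
by rewrite -sum1_card natr_sum big_mkcond; apply: eq_bigr => x _; case: (x \in _).
Qed.

Lemma prob_no_large m Q (c0 : R) : 0 < c0 -> Q != set0 ->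
  c0 * #|Q|%:R <= bexp p (edges G) (fun F => #|Q :&: large F m|%:R) ->
  bexp p (edges G) (fun F => (Q :&: large F m == set0)%:R) <=
  p * (2 * m * (m * max_degree G))%:R / (c0 ^+ 2 * #|Q|%:R).
Proof.
move=> c00 Q0 mean; set mu := bexp _ _ _ in mean.
have q0 : 0 < (#|Q|%:R : R) by rewrite ltr0n card_gt0.
have a0 : 0 < c0 * #|Q|%:R by rewrite mulr_gt0.
apply: (@le_trans _ _ (bexp p (edges G)
    (fun F => (c0 * #|Q|%:R <= `|#|Q :&: large F m|%:R - mu|)%R%:R))).
  apply: ler_bexp => // F _; case: eqP => [->|_]; last exact: ler0n.
  by rewrite cards0 sub0r normrN ger0_norm ?mean// (le_trans (ltW a0)).
apply: le_trans (bexp_chebyshev p01 _ _ a0) _.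
rewrite ler_pdivrMr ?exprn_gt0//; apply: le_trans (variance_large _ _) _.
rewrite le_eqVlt; apply/orP; left; apply/eqP; rewrite !natrM; field.
by rewrite !gt_eqF.
Qed.

Lemma sum_ball L (g : G -> R) : (forall x, 0 <= g x) ->
  \sum_v \sum_(x in ball v L) g x <= (((max_degree G).+1 ^ L)%N)%:R * \sum_x g x.
Proof.
move=> g0; rewrite (exchange_big_dep predT)//= mulr_sumr; apply: ler_sum => x _.
rewrite (eq_bigl (fun v => v \in ball x L)); last by move=> v; rewrite ball_sym.
by rewrite sumr_const -[leLHS]mulr_natl ler_wpM2r// ler_nat card_ball.
Qed.

(** A deterministic count: an atypical vertex spoils only its own cluster, and only if that has
    fewer than [m] vertices. *)
Lemma card_small_atypical F m T :
  (#|[set x | (#|cluster F x| < m)%N && ~~ (cluster F x \subset T)]| <= m * #|~: T|)%N.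
Proof.
pose C z := if (#|cluster F z| < m)%N then cluster F z else set0.
have cC z : (#|C z| <= m)%N by rewrite /C; case: ifP => [/ltnW|]; rewrite ?cards0.
apply: (@leq_trans (\sum_(a in ~: T) #|C a|)); last first.
  by rewrite mulnC -sum_nat_const; apply: leq_sum.
apply: leq_trans (_ : #|\bigcup_(a in ~: T) C a| <= _)%N.
  apply/subset_leq_card/subsetP => x; rewrite inE => /andP[small /subsetPn[a ax aT]].
  apply/bigcupP; exists a; first by rewrite inE.
  by rewrite /C (cluster_eq ax) small cluster_id.
elim/big_rec2: _ => [|a k S _ IH]; first by rewrite cards0.
by apply: leq_trans (leq_card_setU _ _) _; rewrite leq_add2l.
Qed.

Lemma sum_prob_small_atypical m T :
  \sum_x bexp p (edges G) (fun F => ((#|cluster F x| < m)%N && ~~ (cluster F x \subset T))%:R)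
  <= (m * #|~: T|)%:R.
Proof.
apply: (@le_trans _ _ (bexp p (edges G)
  (fun F => #|[set x | (#|cluster F x| < m)%N && ~~ (cluster F x \subset T)]|%:R))).
  by rewrite bexp_card; apply: ler_sum => x _; apply: ler_bexp => // F _; rewrite inE.
by apply: bexp_le_cst => // F _; rewrite ler_nat card_small_atypical.
Qed.

Section Density.
Variables (Typ : {set G}) (m K L N0 : nat) (u c0 h : R).

(** The variance bound is quadratic in the threshold, so it is applied inside balls with [m] instead
    of [K], and clusters of order between [m] and [K] are charged to [h]. The three terms pay for
    balls where atypical clusters lower the mean, for Chebyshev's inequality in the other balls, and
    for the intermediate clusters. *)
Lemma expected_far :
  0 < c0 -> c0 < u -> (0 < N0)%N -> (m <= K)%N -> 0 <= h ->
  (forall v, (N0 <= #|ball v L|)%N) ->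
  (forall x, bexp p (edges G)
    (fun F => ((#|cluster F x| < m)%N && (cluster F x \subset Typ))%:R) <= 1 - u) ->
  (forall x, bexp p (edges G)
    (fun F => ((m <= #|cluster F x| < K)%N && (cluster F x \subset Typ))%:R) <= h) ->
  forall B : R, B = (((max_degree G).+1 ^ L)%N)%:R ->
  bexp p (edges G) (fun F => #|far F K L|%:R) <=
  B * (m * #|~: Typ|)%:R / (u - c0) +
  #|G|%:R * (p * (2 * m * (m * max_degree G))%:R / (c0 ^+ 2 * N0%:R)) +
  B * (#|G|%:R * h + (K * #|~: Typ|)%:R).
Proof.
move=> c00 c0u N00 mK h0 ballN small middle B BE.
have /andP[p0 p1] := p01.
pose b x := bexp p (edges G)
  (fun F => ((#|cluster F x| < m)%N && ~~ (cluster F x \subset Typ))%:R).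
pose g x := bexp p (edges G) (fun F => (m <= #|cluster F x| < K)%N%:R).
have nat_ge0 (c : bool) : 0 <= (c%:R : R) by [].
have b0 x : 0 <= b x by apply: bexp_ge0.
have g0 x : 0 <= g x by apply: bexp_ge0.
have B0 : 0 <= B by rewrite BE.
pose e2 : R := p * (2 * m * (m * max_degree G))%:R / (c0 ^+ 2 * N0%:R).
have e20 : 0 <= e2 by rewrite divr_ge0 ?mulr_ge0 ?exprn_ge0 ?(ltW c00).
have uc0 : 0 < u - c0 by lra.
have pointwise v : bexp p (edges G) (fun F => (v \in far F K L)%:R) <=
    (\sum_(x in ball v L) b x) / (u - c0) + e2 + \sum_(x in ball v L) g x.
  have Q0 : ball v L != set0 by apply/set0Pn; exists v; apply: ball_center.
  have q1 : 1 <= (#|ball v L|%:R : R) by rewrite ler1n card_gt0.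
  apply: (@le_trans _ _ (bexp p (edges G) (fun F => (ball v L :&: large F m == set0)%:R) +
      \sum_(x in ball v L) g x)).
    rewrite -bexp_sum -bexpD; apply: ler_bexp => // F _; rewrite inE.
    case: eqP => [none|_]; last by rewrite addr_ge0// sumr_ge0.
    case: eqP => [_|some]; first by rewrite lerDl sumr_ge0.
    have /set0Pn[x] : ball v L :&: large F m != set0 by apply/eqP.
    rewrite inE in_large => /andP[xb xm].
    have xK : (#|cluster F x| < K)%N.
      rewrite ltnNge; apply/negP => xK; move/setP: none => /(_ x).
      by rewrite inE xb in_large xK inE.
    by rewrite add0r (bigD1 x)//= xm xK lerDl sumr_ge0.
  rewrite lerD2r.
  (* If the mean is below [c0 * #|ball v L|], the sum of [b] over the ball is at least [u - c0], so
     the first term alone exceeds the trivial bound 1. *)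
  have [good|bad] := lerP (c0 * #|ball v L|%:R)
      (bexp p (edges G) (fun F => #|ball v L :&: large F m|%:R)).
    apply: le_trans (prob_no_large c00 Q0 good) _.
    apply: (@le_trans _ _ e2); last by rewrite lerDr divr_ge0 ?sumr_ge0// ltW.
    rewrite /e2 ler_wpM2l ?mulr_ge0// lef_pV2 ?posrE ?mulr_gt0 ?exprn_gt0 ?ltr0n//.
      by rewrite ler_pM2l ?exprn_gt0// ler_nat.
    exact: leq_trans N00 (ballN v).
  apply: (@le_trans _ _ 1).
    by apply: bexp_le_cst => // F _; case: (_ == _).
  apply: (@le_trans _ _ ((\sum_(x in ball v L) b x) / (u - c0))); last by rewrite lerDl.
  rewrite ler_pdivlMr// mul1r.
  have mean : bexp p (edges G) (fun F => #|ball v L :&: large F m|%:R) >=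
      \sum_(x in ball v L) (u - b x).
    rewrite bexp_card [leRHS](bigID (mem (ball v L))) /= -[leLHS]addr0 lerD//; last first.
      by apply: sumr_ge0 => x _; apply: bexp_ge0.
    apply: ler_sum => x xb.
    have -> : bexp p (edges G) (fun F => (x \in ball v L :&: large F m)%:R) =
        1 - (bexp p (edges G)
           (fun F => ((#|cluster F x| < m)%N && (cluster F x \subset Typ))%:R) + b x).
      rewrite /b -bexpD -[X in X - _](bexp_cst p (edges G)) -bexpB; apply: eq_bexp => F _.
      rewrite inE xb in_large /= leqNgt; case: (_ < _)%N; case: (_ \subset _) => //=;
      by rewrite ?addr0 ?add0r ?subrr ?subr0.
    by have := small x; lra.
  rewrite sumrB sumr_const -[u *+ _]mulr_natr in mean.
  have : (u - c0) * #|ball v L|%:R <= \sum_(x in ball v L) b x by lra.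
  by apply: le_trans; rewrite ler_peMr// ltW.
rewrite bexp_card; apply: le_trans (ler_sum _ (fun v _ => pointwise v)) _.
rewrite !big_split /= -mulr_suml sumr_const -[e2 *+ _]mulr_natl.
have sb : \sum_v \sum_(x in ball v L) b x <= B * (m * #|~: Typ|)%:R.
  by apply: le_trans (sum_ball _ b0) _; rewrite -BE ler_wpM2l// sum_prob_small_atypical.
have sg : \sum_v \sum_(x in ball v L) g x <= B * (#|G|%:R * h + (K * #|~: Typ|)%:R).
  apply: le_trans (sum_ball _ g0) _; rewrite -BE ler_wpM2l//.
  apply: (@le_trans _ _ (\sum_x (h + bexp p (edges G)
      (fun F => ((#|cluster F x| < K)%N && ~~ (cluster F x \subset Typ))%:R)))).
    apply: ler_sum => x _; apply: le_trans (lerD (middle x) (lexx _)).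
    rewrite -bexpD; apply: ler_bexp => // F _.
    case: (_ \subset _); rewrite /= ?andbT ?andbF ?addr0 ?add0r//.
    by case: (m <= _)%N.
  rewrite big_split /= sumr_const -[h *+ _]mulr_natl lerD2l.
  exact: sum_prob_small_atypical.
by rewrite !lerD// ler_pM2r// invr_gt0.
Qed.

End Density.
End Variance.
End LargeClusters.

(** * Merging large clusters by sprinkling *)

Section Merging.
Variable G : sgraph.
Implicit Types (x y z a b v : G) (A B S X : {set G}) (F : {set {set G}}).

Definition closed_in F S := forall x y, x \in cluster F y -> y \in S -> x \in S.

Lemma connecting_path x a L : a \in ball x L ->
  exists P : {set {set G}}, [/\ P \subset edges G, (#|P| <= L)%N, a \in cluster P x &
    forall e, e \in P -> e \subset ball x L].
Proof.
elim: L a => [|L IH] a.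
  rewrite inE => /eqP ->; exists set0; rewrite sub0set cards0 cluster_id; split => // e.
  by rewrite inE.
rewrite ballS => /orP[/IH [P [PE Pc aP Pb]]|/existsP[z /andP[zb za]]].
  exists P; split => //; first exact: leqW.
  by move=> e /Pb /subset_trans; apply; apply: ball_le.
have [P [PE Pc zP Pb]] := IH z zb; exists ([set z; a] |: P); split.
- by rewrite subUset PE andbT sub1set mem_edges.
- by rewrite cardsU1; case: (_ \notin _) => //=; rewrite ?add0n; apply: leqW.
- apply: (@cluster_step _ _ _ z) => //; last by rewrite in_setU1 eqxx.
  exact: (subsetP (cluster_mono x (subsetUr _ _))).
- move=> e; rewrite in_setU1 => /orP[/eqP ->|/Pb eb]; last first.
    by apply: subset_trans eb (ball_le _ _).
  apply/subsetP => w; rewrite in_set2 => /orP[] /eqP ->; last exact: ball_adj zb za.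
  by apply: (subsetP (ball_le _ (leqnSn L))).
Qed.

Lemma connecting_pair x a b L : a \in ball x L -> b \in ball x L ->
  exists P : {set {set G}}, [/\ P \subset edges G, (#|P| <= 2 * L)%N, a \in cluster P b &
    forall e, e \in P -> e \subset ball x L].
Proof.
move=> /connecting_path[P [PE Pc aP Pb]] /connecting_path[Q [QE Qc bQ Qb]].
exists (P :|: Q); split.
- by rewrite subUset PE.
- by apply: leq_trans (leq_card_setU _ _) _; rewrite mul2n -addnn leq_add.
- have ax := subsetP (cluster_mono x (subsetUl P Q)) _ aP.
  have bx := subsetP (cluster_mono x (subsetUr P Q)) _ bQ.
  by rewrite (cluster_eq bx).
- by move=> e; rewrite inE => /orP[/Pb|/Qb].
Qed.

(** Greedy choice: each chosen point discards only its own ball of radius [l]. *)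
Lemma separated_subset (N : {set G}) l :
  exists X, [/\ X \subset N,
    (forall x y, x \in X -> y \in X -> x != y -> y \notin ball x l) &
    (#|N| <= #|X| * (max_degree G).+1 ^ l)%N].
Proof.
move: {2}#|N| (leqnn #|N|) => n; elim: n N => [|n IH] N Nn.
  exists set0; rewrite sub0set; split=> // [x y|]; first by rewrite inE.
  by move: Nn; rewrite leqn0 cards0 mul0n leqn0.
have [->|/set0Pn[z zN]] := eqVneq N set0.
  by exists set0; rewrite sub0set cards0; split=> // x y; rewrite inE.
have [|X [XN Xsep Xc]] := IH (N :\: ball z l).
  rewrite -ltnS; apply: leq_trans Nn; rewrite -(cardsID (ball z l) N).
  rewrite -[X in (X < _)%N]add0n ltn_add2r card_gt0; apply/set0Pn; exists z.
  by rewrite inE zN ball_center.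
have Xz x : x \in X -> x \notin ball z l by move=> /(subsetP XN); rewrite inE => /andP[].
exists (z |: X); split.
- by rewrite subUset sub1set zN (subset_trans XN (subsetDl _ _)).
- move=> x y; rewrite !in_setU1 => /orP[/eqP ->|xX] /orP[/eqP ->|yX].
  + by rewrite eqxx.
  + by move=> _; apply: Xz.
  + by move=> _; rewrite ball_sym Xz.
  + exact: Xsep.
- rewrite cardsU1 (_ : z \notin X); last by apply: contraL (ball_center z l) => /Xz.
  rewrite mulnDl mul1n -(cardsID (ball z l) N) leq_add//.
  by apply: leq_trans (subset_leq_card (subsetIr _ _)) (card_ball _ _).
Qed.

Definition meeting A B L : {set G} :=
  [set x | [exists a in A, a \in ball x L] && [exists b in B, b \in ball x L]].

Section Connection.
Variables (R : realType) (iso : R).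
Hypothesis iso0 : 0 <= iso.
Hypothesis isoperimetry : forall S : {set G},
  iso * (#|S| * #|~: S|)%:R <= (#|G| * edge_boundary S)%:R.

(** Isoperimetry is applied to the set [A'] of vertices within [L] of [A]. The outer end of an edge
    leaving [A'] is either far from every large cluster, or within [L] of [B] and [L.+1] of [A].
    Points of [B] inside [A'] are meeting points themselves, whence the subtraction. *)
Lemma card_meeting F K L A B : A :|: B = large F K ->
  iso * (#|A|%:R * (#|B|%:R - #|meeting A B L.+1|%:R)) <=
  #|G|%:R * (max_degree G * (#|meeting A B L.+1| + #|far F K L|))%:R.
Proof.
move=> AB; set N := meeting A B L.+1.
pose A' := [set x | [exists a in A, a \in ball x L]].
have AA' : A \subset A'.
  by apply/subsetP => a aA; rewrite inE; apply/existsP; exists a; rewrite aA ball_center.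
have BN : B :\: N \subset ~: A'.
  apply/subsetP => b; rewrite inE => /andP[bN bB]; rewrite inE; apply: contra bN.
  rewrite inE => /existsP[a /andP[aA ab]]; rewrite inE; apply/andP; split; apply/existsP.
    by exists a; rewrite aA; apply: (subsetP (ball_le _ (leqnSn L))).
  by exists b; rewrite bB ball_center.
have cBN : (#|B|%:R : R) - #|N|%:R <= #|~: A'|%:R.
  rewrite lerBlDr -natrD ler_nat -(cardsID N B) addnC leq_add ?subset_leq_card//.
  exact: subsetIr.
have [neg|pos] := lerP ((#|B|%:R : R) - #|N|%:R) 0.
  by apply: (@le_trans _ _ 0) => //; rewrite mulr_ge0_le0// mulr_ge0_le0.
apply: (@le_trans _ _ (iso * (#|A'| * #|~: A'|)%:R)).
  by rewrite ler_wpM2l// natrM; apply: ler_pM; rewrite ?ler_nat ?subset_leq_card// ltW.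
apply: le_trans (isoperimetry _) _; rewrite natrM ler_wpM2l// ler_nat.
rewrite /edge_boundary.
apply: (@leq_trans #|[set u : G * G | (u.1 \in N :|: far F K L) && adj u.1 u.2]|); last first.
  rewrite -volumeE; apply: leq_trans (volume_le _) _; rewrite mulnC leq_mul2l.
  by rewrite leq_card_setU orbT.
have swap_inj : injective (fun u : G * G => (u.2, u.1)) by move=> [? ?] [? ?] [-> ->].
rewrite -(card_imset _ swap_inj).
apply/subset_leq_card/subsetP => yx /imsetP[[x y] xyA ->].
move: xyA; rewrite inE /= => /and3P[xA yA xy]; rewrite inE /= adj_sym xy andbT inE.
have [|yfar] := boolP (y \in far F K L); first by rewrite orbT.
rewrite orbF; move: yfar; rewrite inE => /set0Pn[w].
rewrite inE -AB => /andP[wb wAB].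
have wB : w \in B.
  move: wAB; rewrite inE => /orP[wA|//]; move: yA; rewrite inE => /existsP[].
  by exists w; rewrite wA.
move: xA; rewrite inE => /existsP[a /andP[aA ax]].
rewrite inE; apply/andP; split; apply/existsP.
  by exists a; rewrite aA ball_sym (ball_adj _ xy)// ball_sym.
by exists w; rewrite wB (subsetP (ball_le _ (leqnSn L))).
Qed.

(** Centres at distance more than [2 * l] have disjoint balls of radius [l], so the connecting paths
    chosen inside these balls share no edge and fail independently. *)
Lemma prob_disconnected (p : R) A B l M : 0 <= p <= 1 ->
  (M * (max_degree G).+1 ^ (2 * l) <= #|meeting A B l|)%N ->
  bexp p (edges G)
    (fun F => [forall a in A, forall b in B, a \notin cluster F b]%:R) <=
  (1 - p ^+ (2 * l)) ^+ M.
Proof.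
move=> p01 MN; have /andP[p0 p1] := p01.
have [X [XN Xsep Xc]] := separated_subset (meeting A B l) (2 * l).
have MX : (M <= #|X|)%N.
  by have := leq_trans MN Xc; rewrite leq_pmul2r// expn_gt0.
have ex x : x \in X -> exists P : {set {set G}}, [&& P \subset edges G,
    (#|P| <= 2 * l)%N, [exists a in A, exists b in B, a \in cluster P b] &
    [forall e in P, e \subset ball x l]].
  move/(subsetP XN); rewrite inE => /andP[/existsP[a /andP[aA ax]] /existsP[b /andP[bB bx]]].
  have [P [PE Pc ab Pb]] := connecting_pair ax bx; exists P.
  rewrite PE Pc /=; apply/andP; split; last exact/forall_inP.
  by apply/existsP; exists a; rewrite aA; apply/existsP; exists b; rewrite bB.
pose ok x (P : {set {set G}}) := [&& P \subset edges G,
    (#|P| <= 2 * l)%N, [exists a in A, exists b in B, a \in cluster P b] &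
    [forall e in P, e \subset ball x l]].
(* The default [set0] is never reached for [x] in [X]. *)
pose P x := odflt set0 [pick Q | ok x Q].
have okP x : x \in X -> ok x (P x).
  by move=> /ex[Q okQ]; rewrite /P; case: pickP => [//|/(_ Q)]; rewrite /ok okQ.
apply: (@le_trans _ _ (bexp p (edges G) (fun F => [forall x in X, ~~ (P x \subset F)]%:R))).
  apply: ler_bexp => // F _; rewrite ler_nat; case: (boolP [forall a in A, _]) => // disc.
  rewrite lt0b; apply/forall_inP => x /okP /and4P[_ _ /existsP[a /andP[aA /existsP[b /andP[bB ab]]]] _].
  apply/negP => PF; have := forall_inP (forall_inP disc a aA) b bB.
  by rewrite (subsetP (cluster_mono _ PF) _ ab).
apply: le_trans (bexp_none_sub p01 (l := 2 * l) _ _ _) _.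
- by move=> x /okP /and4P[].
- by move=> x /okP /and4P[].
- move=> x y xX yX xy; have /and4P[PE _ _ Px] := okP _ xX; have /and4P[_ _ _ Py] := okP _ yX.
  apply/pred0P => e /=; apply/negbTE/negP => /andP[ex' ey].
  have /edgesP[a [b [_ eab]]] := subsetP PE _ ex'.
  have ae : a \in e by rewrite eab !inE eqxx.
  have ax := subsetP (forall_inP Px e ex') _ ae.
  have ay := subsetP (forall_inP Py e ey) _ ae.
  have := Xsep _ _ xX yX xy; rewrite mul2n -addnn (ball_trans ax)//.
  by rewrite ball_sym.
by apply: ler_wiXn2l; rewrite ?subr_ge0 ?lerBlDr ?lerDl ?exprn_ge0 ?exprn_ile1.
Qed.

End Connection.

(** * Splittings of the large clusters *)

Definition splits F S (W : {set G}) (c : nat) :=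
  [&& [forall x, forall y, (x \in cluster F y) && (y \in S) ==> (x \in S)],
    (c <= #|W :&: S|)%N & (c <= #|W :\: S|)%N].

Lemma closedP F S :
  reflect (closed_in F S) [forall x, forall y, (x \in cluster F y) && (y \in S) ==> (x \in S)].
Proof.
apply: (iffP forallP) => [h x y xy yS|h x].
  by have /forallP/(_ y) := h x; rewrite xy yS.
by apply/forallP => y; apply/implyP => /andP[]; apply: h.
Qed.

(* Take a union [S] of clusters that is minimal among those meeting [W] in at least
   [c] points: if the complement contains few points of [W], the cluster of any
   point of [S] in [W] must contain nearly all of [W]. *)
Lemma giant_or_split F (W : {set G}) c : (0 < c)%N -> (c <= #|W|)%N ->
  ~~ [exists S, splits F S W c] -> exists x, (#|W| <= #|W :&: cluster F x| + 2 * c)%N.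
Proof.
move=> c0 cW nosplit.
pose ok (S : {set G}) := [forall x, forall y, (x \in cluster F y) && (y \in S) ==> (x \in S)]
   && (c <= #|W :&: S|)%N.
have okT : ok setT.
  rewrite /ok setIT cW andbT; apply/closedP => x y _ _; exact: in_setT.
case: (arg_minnP (fun S : {set G} => #|W :&: S|) okT) => S /andP[/closedP clS cS] min.
have WS : (#|W :\: S| < c)%N.
  rewrite ltnNge; apply: contra nosplit => big; apply/existsP; exists S.
  by rewrite /splits cS big !andbT; apply/closedP.
have /set0Pn[x] : W :&: S != set0 by rewrite -card_gt0 (leq_trans c0).
rewrite inE => /andP[xW xS]; exists x.
have clD : closed_in F (S :\: cluster F x).
  move=> z y zy; rewrite !in_setD => /andP[yx yS]; rewrite (clS _ _ zy yS) andbT.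
  apply: contra yx => zx; by rewrite -(cluster_eq zx) cluster_sym.
have rest : (#|W :&: (S :\: cluster F x)| < c)%N.
  rewrite ltnNge; apply/negP => big.
  have := min (S :\: cluster F x); rewrite /ok big andbT => /(_ (introT (closedP _ _) clD)).
  rewrite leqNgt => /negP; apply; apply: proper_card; apply/properP; split.
    by apply: setIS; apply: subsetDl.
  by exists x; rewrite !inE ?xW ?xS// connect0 ?andbF.
have : (#|W| <= #|W :&: cluster F x| + #|W :&: (S :\: cluster F x)| + #|W :\: S|)%N.
  rewrite -addnA; apply: (@leq_trans #|(W :&: cluster F x) :|: ((W :&: (S :\: cluster F x)) :|: (W :\: S))|).
    apply/subset_leq_card/subsetP => z zW; rewrite !in_setU !in_setI !in_setD zW /=.
    by case: (z \in cluster F x); case: (z \in S).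
  apply: leq_trans (leq_card_setU _ _) _; rewrite leq_add2l.
  exact: leq_card_setU.
by lia.
Qed.

(** Such a set is determined by the clusters it contains, and at most [#|G| %/ K] clusters have
    order at least [K]. *)
Lemma card_closed_subsets F K : (0 < K)%N ->
  (#|[set A : {set G} | (A \subset large F K) &&
      [forall x, forall y, (x \in cluster F y) && (y \in A) ==> (x \in A)]]| <= 2 ^ (#|G| %/ K))%N.
Proof.
move=> K0; pose C := [set cluster F x | x in large F K].
have cC : (#|C| <= #|G| %/ K)%N.
  rewrite leq_divRL// -sum_nat_const.
  have triv : trivIset C.
    apply/trivIsetP => _ _ /imsetP[x _ ->] /imsetP[y _ ->] xy.
    apply/pred0P => z /=; apply/negbTE/negP => /andP[zx zy].
    by move: xy; rewrite -(cluster_eq zx) (cluster_eq zy) eqxx.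
  apply: leq_trans (_ : \sum_(A in C) #|A| <= _)%N.
    by apply: leq_sum => _ /imsetP[x xK ->]; rewrite in_large in xK.
  by rewrite (eqP triv) max_card.
apply: (@leq_trans #|powerset C|); last by rewrite card_powerset leq_exp2l.
rewrite -(card_in_imset (f := fun A : {set G} => [set cluster F x | x in A])).
  apply/subset_leq_card/subsetP => S /imsetP[A AU ->]; move: AU; rewrite inE => /andP[AK _].
  by rewrite powersetE; apply: imsetS.
move=> A B; rewrite !inE => /andP[_ /closedP clA] /andP[_ /closedP clB] E.
have half (A' B' : {set G}) : closed_in F B' ->
    [set cluster F x | x in A'] = [set cluster F x | x in B'] -> A' \subset B'.
  move=> cl E'; apply/subsetP => x xA.
  have : cluster F x \in [set cluster F x | x in B'] by rewrite -E'; apply: imset_f.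
  by case/imsetP => y yB xy; apply: (cl x y) => //; rewrite -xy cluster_id.
by apply/eqP; rewrite eqEsubset !half.
Qed.

(** Union bound over the traces [large F K :&: S]: they are unions of clusters of the first round
    alone, so their number does not depend on [F2]. If a splitting survives, [F2] joins no point of
    the trace to the rest of [large F K]. *)
Lemma prob_split (R : realType) (p : R) F K c l M : 0 <= p <= 1 -> (0 < K)%N ->
  (forall A B, A :|: B = large F K -> (c <= #|A|)%N -> (c <= #|B|)%N ->
    (M * (max_degree G).+1 ^ (2 * l) <= #|meeting A B l|)%N) ->
  bexp p (edges G) (fun F2 => [exists S, splits (F :|: F2) S (large F K) c]%:R) <=
  (2 ^ (#|G| %/ K))%:R * (1 - p ^+ (2 * l)) ^+ M.
Proof.
move=> p01 K0 meet; have /andP[p0 p1] := p01.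
pose U := [set A : {set G} | (A \subset large F K) &&
      [forall x, forall y, (x \in cluster F y) && (y \in A) ==> (x \in A)]].
pose U' := [set A in U | (c <= #|A|)%N && (c <= #|large F K :\: A|)%N].
apply: (@le_trans _ _ (\sum_(A in U') bexp p (edges G) (fun F2 =>
   [forall a in A, forall b in large F K :\: A, a \notin cluster F2 b]%:R))).
  rewrite -bexp_sum; apply: ler_bexp => // F2 _.
  case: (boolP [exists S, _]) => [/existsP[S /and3P[/closedP cl c1 c2]]|_]; last first.
    by apply: sumr_ge0 => A _; case: [forall a in A, _].
  have WSD : large F K :\: (large F K :&: S) = large F K :\: S.
    by apply/setP => z; rewrite !inE; case: (K <= _)%N => //=; rewrite ?andbF.
  have AU : large F K :&: S \in U'.
    suff AU0 : large F K :&: S \in U by rewrite /U' in_set AU0 WSD c1 c2.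
    rewrite /U in_set subsetIl /=; apply/(closedP F (large F K :&: S)) => x y xy.
    rewrite !in_setI !in_large (cluster_eq xy) => /andP[-> yS] /=.
    by apply: cl yS; apply: (subsetP (cluster_mono _ (subsetUl _ _))).
  rewrite (bigD1 _ AU)/= (_ : [forall a in _, _] = true); last first.
    apply/forall_inP => a; rewrite inE => /andP[aW aS]; apply/forall_inP => b.
    rewrite WSD inE => /andP[bS bW]; apply: contra bS => ab.
    apply: (cl b a) => //; rewrite cluster_sym.
    exact: (subsetP (cluster_mono _ (subsetUr _ _))).
  by rewrite lerDl sumr_ge0// => A _; case: [forall a in A, _].
have UU' : (#|U'| <= 2 ^ (#|G| %/ K))%N.
  apply: leq_trans (card_closed_subsets F K0); apply/subset_leq_card/subsetP => A.
  by rewrite /U' in_set => /andP[].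
have pow0 : 0 <= (1 - p ^+ (2 * l)) ^+ M by rewrite exprn_ge0// subr_ge0 exprn_ile1.
apply: (@le_trans _ _ (\sum_(A in U') (1 - p ^+ (2 * l)) ^+ M)); last first.
  by rewrite sumr_const -[leLHS]mulr_natl ler_wpM2r// ler_nat.
apply: ler_sum => A; rewrite /U' in_set => /andP[AU /andP[c1 c2]].
have AK : A \subset large F K by move: AU; rewrite /U in_set => /andP[].
apply: prob_disconnected => //; apply: meet => //.
by apply/setP => z; rewrite !inE; case: (boolP (z \in A)) => //= /(subsetP AK); rewrite inE.
Qed.

End Merging.

(** * The giant component in a general graph *)

Lemma percolation_probE (R : realType) (G : sgraph) (p : R) (P : sgraph -> bool) :
  percolation_prob G p P = bexp p (edges G) (fun F => (P (spanning_subgraph F))%:R).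
Proof.
rewrite /percolation_prob /bexp big_mkcondr; apply: eq_bigr => F _.
by case: (P _); rewrite ?mulr1 ?mulr0.
Qed.

Lemma indicator_ge (R : realType) (b : bool) (x : R) : 0 <= x -> (b -> 1 <= x) -> b%:R <= x.
Proof. by case: b => // _ /(_ isT). Qed.

Section Assembly.
Variables (R : realType) (G : sgraph).
Implicit Types (F : {set {set G}}) (p u tau y kappa : R).
Let n : R := #|G|%:R.
Let Delta := max_degree G.

Lemma large_upper_tail p m u tau : 0 <= p <= 1 -> 0 < tau -> (0 < #|G|)%N ->
  bexp p (edges G) (fun F => #|large F m|%:R) <= u * n ->
  bexp p (edges G) (fun F => ((u + tau) * n < #|large F m|%:R)%R%:R) <=
  p * (2 * m * (#|G| * (m * Delta)))%:R / (tau * n) ^+ 2.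
Proof.
move=> p01 tau0 n0 mean; have n0' : 0 < n by rewrite ltr0n.
have a0 : 0 < tau * n by rewrite mulr_gt0.
have H := bexp_chebyshev p01 (edges G) (fun F => #|[set: G] :&: large F m|%:R) a0.
have V := variance_large p01 m [set: G]; rewrite cardsT in V.
apply: le_trans (le_trans H _); last by rewrite ler_wpM2r// invr_ge0 exprn_ge0// ltW.
have E : bexp p (edges G) (fun F => #|[set: G] :&: large F m|%:R) =
    bexp p (edges G) (fun F => #|large F m|%:R) by apply: eq_bexp => F _; rewrite setTI.
apply: ler_bexp => // F _; rewrite E setTI; apply: indicator_ge => // h.
rewrite ler1n lt0b.
by apply: le_trans (ler_norm _); rewrite mulrDl in h; lra.
Qed.

Lemma large_lower_tail p m u tau : 0 <= p <= 1 -> 0 < tau -> (0 < #|G|)%N ->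
  u * n <= bexp p (edges G) (fun F => #|large F m|%:R) ->
  bexp p (edges G) (fun F => (#|large F m|%:R < (u - tau) * n)%R%:R) <=
  p * (2 * m * (#|G| * (m * Delta)))%:R / (tau * n) ^+ 2.
Proof.
move=> p01 tau0 n0 mean; have n0' : 0 < n by rewrite ltr0n.
have a0 : 0 < tau * n by rewrite mulr_gt0.
have H := bexp_chebyshev p01 (edges G) (fun F => #|[set: G] :&: large F m|%:R) a0.
have V := variance_large p01 m [set: G]; rewrite cardsT in V.
apply: le_trans (le_trans H _); last by rewrite ler_wpM2r// invr_ge0 exprn_ge0// ltW.
have E : bexp p (edges G) (fun F => #|[set: G] :&: large F m|%:R) =
    bexp p (edges G) (fun F => #|large F m|%:R) by apply: eq_bexp => F _; rewrite setTI.
apply: ler_bexp => // F _; rewrite E setTI; apply: indicator_ge => // h.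
rewrite ler1n lt0b.
by rewrite distrC; apply: le_trans (ler_norm _); rewrite mulrBl in h; lra.
Qed.

Lemma mean_large_ge p m (Typ : {set G}) u tau : 0 <= p <= 1 ->
  (forall x, bexp p (edges G)
    (fun F => ((#|cluster F x| < m)%N && (cluster F x \subset Typ))%:R) <= 1 - u) ->
  (m * #|~: Typ|)%:R <= tau * n ->
  (u - tau) * n <= bexp p (edges G) (fun F => #|large F m|%:R).
Proof.
move=> p01 small atyp; rewrite bexp_card.
pose b x := bexp p (edges G)
  (fun F => ((#|cluster F x| < m)%N && ~~ (cluster F x \subset Typ))%:R).
apply: (@le_trans _ _ (\sum_x (u - b x))).
  rewrite sumrB sumr_const -[u *+ _]mulr_natr mulrBl lerD2l lerN2.
  by apply: le_trans (sum_prob_small_atypical p01 m Typ) atyp.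
apply: ler_sum => x _.
have -> : bexp p (edges G) (fun F => (x \in large F m)%:R) =
    1 - (bexp p (edges G)
        (fun F => ((#|cluster F x| < m)%N && (cluster F x \subset Typ))%:R) + b x).
  rewrite /b -bexpD -[X in X - _](bexp_cst p (edges G)) -bexpB; apply: eq_bexp => F _.
  rewrite in_large leqNgt; case: (_ < _)%N; case: (_ \subset _) => //=;
  by rewrite ?addr0 ?add0r ?subrr ?subr0.
by have := small x; lra.
Qed.

Lemma mean_large_le p k (Typ : {set G}) u tau : 0 <= p <= 1 -> 0 <= u ->
  (forall x, ball x k \subset Typ ->
    1 - u <= bexp p (edges G) (fun F => (#|cluster F x| < k)%N%:R)) ->
  (Delta.+1 ^ k * #|~: Typ|)%:R <= tau * n ->
  bexp p (edges G) (fun F => #|large F k|%:R) <= (u + tau) * n.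
Proof.
move=> p01 u0 small atyp; rewrite bexp_card mulrDl.
apply: (@le_trans _ _ (\sum_x (u + (~~ (ball x k \subset Typ))%:R))).
  apply: ler_sum => x _.
  have [good|bad] := boolP (ball x k \subset Typ); last first.
    apply: (@le_trans _ _ 1); first by apply: bexp_le_cst => // F _; case: (_ \in _).
    by rewrite lerDr.
  have -> : bexp p (edges G) (fun F => (x \in large F k)%:R) =
      1 - bexp p (edges G) (fun F => (#|cluster F x| < k)%N%:R).
    rewrite -[X in X - _](bexp_cst p (edges G)) -bexpB; apply: eq_bexp => F _.
    by rewrite in_large leqNgt; case: (_ < _)%N; rewrite ?subrr ?subr0.
  by have := small x good; rewrite addr0; lra.
rewrite big_split /= sumr_const -[u *+ _]mulr_natr lerD2l.
apply: le_trans atyp; rewrite -natr_sum ler_nat.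
apply: (@leq_trans (\sum_(a in ~: Typ) #|ball a k|)); last first.
  by rewrite mulnC -sum_nat_const; apply: leq_sum => a _; apply: card_ball.
apply: (@leq_trans (\sum_x \sum_(a in ~: Typ) (x \in ball a k))).
  apply: leq_sum => x _; have [//|/subsetPn[a ax aT]] := boolP (ball x k \subset Typ).
  by rewrite (bigD1 a) ?inE//= ball_sym ax.
rewrite exchange_big /=; apply: leq_sum => a _.
by rewrite -sum1_card [leqRHS]big_mkcond /=; apply: leq_sum => x _; case: (x \in _).
Qed.

(** The cluster given by [giant_or_split] has at least [(y - 6 * tau) * n] vertices, while at most
    [(y + 3 * tau) * n] lie in clusters of order at least [k]; any other cluster thus has at most
    [9 * tau * n], that is [kappa * y * n / 2]. The constant 18 keeps both errors within those
    allowed by [kappa]. *)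
Lemma giant_of_events F F1 K k c tau y kappa : F1 \subset F ->
  0 < kappa <= 2^-1 -> 0 < y <= 1 -> tau = kappa * y / 18 ->
  tau * n <= c%:R -> 2 * c%:R <= 3 * tau * n -> k%:R <= tau * n -> 0 < n ->
  #|large F k|%:R <= (y + 3 * tau) * n ->
  (y - 3 * tau) * n <= #|large F1 K|%:R ->
  ~~ [exists S, splits F S (large F1 K) c] ->
  unique_giant_component (spanning_subgraph F) y kappa kappa.
Proof.
move=> F1F /andP[ka0 ka1] /andP[y0 y1] tauE ctau c2 ktau n0 up low nosplit.
have tau0 : 0 < tau by rewrite tauE; nra.
have tauy : 36 * tau <= y by rewrite tauE; nra.
have cn0 : 0 < tau * n by rewrite mulr_gt0.
have c0 : (0 < c)%N by rewrite -(ltr0n R); lra.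
have yn : 36 * (tau * n) <= y * n by rewrite mulrA ler_pM2r.
have cW : (c <= #|large F1 K|)%N by rewrite -(ler_nat R); rewrite mulrBl in low; lra.
have [x big] := giant_or_split c0 cW nosplit.
have {}big : (y - 6 * tau) * n <= #|cluster F x|%:R.
  have : (#|large F1 K| <= #|cluster F x| + 2 * c)%N.
    by apply: leq_trans big _; rewrite leq_add2r subset_leq_card// subsetIr.
  by rewrite -(ler_nat R) natrD natrM; rewrite mulrBl in low; lra.
have xk : x \in large F k.
  by rewrite in_large -(ler_nat R); rewrite mulrBl in big; lra.
have sub_large z : z \in large F k -> cluster F z \subset large F k.
  by rewrite in_large => zk; apply/subsetP => w wz; rewrite in_large (cluster_eq wz).
have compE : components (spanning_subgraph F) = [set cluster F z | z : G] by [].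
have other z : cluster F z != cluster F x -> #|cluster F z|%:R <= 9 * (tau * n).
  move=> zx; have [small|zk] := ltnP #|cluster F z| k.
    by apply: (@le_trans _ _ (tau * n)); [apply: le_trans ktau; rewrite ler_nat ltnW | lra].
  have : (#|cluster F z| + #|cluster F x| <= #|large F k|)%N.
    rewrite -cardsUI (_ : _ :&: _ = set0) ?cards0 ?addn0.
      by rewrite subset_leq_card// subUset !sub_large// in_large.
    apply/setP => w; rewrite in_setI in_set0; apply/negbTE/negP => /andP[wz wx].
    by move: zx; rewrite -(cluster_eq wz) (cluster_eq wx) eqxx.
  rewrite -(ler_nat R) natrD mulrDl in up *; rewrite mulrBl in big; lra.
apply/existsP; exists (cluster F x); rewrite compE imset_f//=; apply/and3P; split.
- have := subset_leq_card (sub_large _ xk); rewrite -(ler_nat R) => xup.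
  rewrite /giant_order ler_norml -/n; rewrite mulrDl in up; rewrite mulrBl in big.
  have : 6 * (tau * n) <= kappa * (y * n).
    rewrite tauE; have : 0 <= kappa * (y * n) by rewrite !mulr_ge0// ltW.
    by lra.
  by move=> h; apply/andP; split; lra.
- apply/forall_inP => _ /imsetP[z _ ->]; apply/implyP => zg.
  apply: contraTT zg => /other zs; rewrite /giant_order -ltNge -/n.
  apply: lt_le_trans (_ : y * n - #|cluster F z|%:R <= _); last by rewrite distrC ler_norm.
  have yn0 : 0 < y * n by rewrite mulr_gt0.
  have : kappa * (y * n) <= 2^-1 * (y * n) by rewrite ler_pM2r.
  by lra.
- apply/forall_inP => _ /imsetP[z _ ->]; apply/implyP => /other zs.
  apply: le_trans zs _; rewrite -/n mulrA ler_pM2r// tauE.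
  by have : kappa * y <= kappa * 1; [rewrite ler_pM2l | lra].
Qed.

Section Probability.
Variables (p p1 p2 y tau kappa beta iso : R) (k K L c M : nat).

(** Four bad events get [kappa / 4] each: too many vertices in clusters of order [k] after both
    rounds, too few in clusters of order [K] after the first, too many far vertices after the first,
    and a splitting that survives the second. *)
Lemma giant_probability :
  0 <= p <= 1 -> 0 <= p1 <= 1 -> 0 <= p2 <= 1 -> 1 - p = (1 - p1) * (1 - p2) ->
  (0 < #|G|)%N -> (0 < K)%N -> 0 < kappa <= 2^-1 -> 0 < y <= 1 -> tau = kappa * y / 18 ->
  tau * n <= c%:R -> 2 * c%:R <= 3 * tau * n -> k%:R <= tau * n ->
  bexp p (edges G) (fun F => #|large F k|%:R) <= (y + 2 * tau) * n ->
  (y - 2 * tau) * n <= bexp p1 (edges G) (fun F => #|large F K|%:R) ->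
  p * (2 * k * (#|G| * (k * Delta)))%:R / (tau * n) ^+ 2 <= kappa / 4 ->
  p1 * (2 * K * (#|G| * (K * Delta)))%:R / (tau * n) ^+ 2 <= kappa / 4 ->
  0 < beta ->
  bexp p1 (edges G) (fun F => #|far F K L|%:R) <= kappa / 4 * (beta * n) ->
  0 <= iso -> iso <= 1 -> iso * tau ^+ 2 = 2 * beta * Delta%:R -> (0 < Delta)%N -> tau <= 1 ->
  (forall S : {set G}, iso * (#|S| * #|~: S|)%:R <= (#|G| * edge_boundary S)%:R) ->
  (M * Delta.+1 ^ (2 * L.+1))%:R <= iso * tau ^+ 2 * n / (4 * Delta%:R) ->
  (2 ^ (#|G| %/ K))%:R * (1 - p2 ^+ (2 * L.+1)) ^+ M <= kappa / 4 ->
  1 - kappa <= percolation_prob G p (fun H => unique_giant_component H y kappa kappa).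
Proof.
move=> p01 p101 p201 sprinkle G0 K0 ka y01 tauE ctau c2 ktau mean_up mean_low T1 T2
  beta0 T3 iso0 iso1 isoE D0 tau1 isoper MN T4.
have n0 : 0 < n by rewrite ltr0n.
have tau0 : 0 < tau by rewrite tauE; case/andP: ka; case/andP: y01; nra.
have D0' : 0 < (Delta%:R : R) by rewrite ltr0n.
pose good F := unique_giant_component (spanning_subgraph F) y kappa kappa.
pose e1 F : R := ((y + 2 * tau + tau) * n < #|large F k|%:R)%R%:R.
pose e2 F : R := (#|large F K|%:R < (y - 2 * tau - tau) * n)%R%:R.
pose e3 F : R := (beta * n <= #|far F K L|%:R)%R%:R.
pose e4 F F2 : R := [exists S, splits (F :|: F2) S (large F K) c]%:R.
have P1 : bexp p (edges G) e1 <= kappa / 4.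
  exact: le_trans (large_upper_tail p01 tau0 G0 mean_up) T1.
have P2 : bexp p1 (edges G) e2 <= kappa / 4.
  exact: le_trans (large_lower_tail p101 tau0 G0 mean_low) T2.
have bn0 : 0 < beta * n by rewrite mulr_gt0.
have P3 : bexp p1 (edges G) e3 <= kappa / 4.
  apply: le_trans (bexp_markov p101 bn0 _) _; first by [].
  by rewrite ler_pdivrMr.
(* Either the meeting set exceeds [tau * n], or isoperimetry applies to two sides of at least
   [tau * n] vertices; [beta] is chosen so that far vertices absorb only half of
   [iso * tau ^+ 2 * n]. *)
have meet F A B : #|far F K L|%:R < beta * n -> A :|: B = large F K ->
    (c <= #|A|)%N -> (c <= #|B|)%N ->
    (M * Delta.+1 ^ (2 * L.+1) <= #|meeting A B L.+1|)%N.
  move=> dense AB cA cB; rewrite -(ler_nat R); apply: le_trans MN _.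
  rewrite ler_pdivrMr ?mulr_gt0//.
  have H := card_meeting iso0 isoper L AB.
  set N : R := #|meeting A B L.+1|%:R in H *.
  have N0 : 0 <= N by [].
  have A1 : tau * n <= #|A|%:R by apply: le_trans ctau _; rewrite ler_nat.
  have B1 : tau * n <= #|B|%:R by apply: le_trans ctau _; rewrite ler_nat.
  have tn0 : 0 < tau * n by rewrite mulr_gt0.
  have i1 : iso * tau <= 1 by rewrite mulr_ile1// ltW.
  have D1 : 1 <= (Delta%:R : R) by rewrite ler1n.
  have [small|largeN] := lerP N (tau * n); last first.
    have h1 : iso * tau * (tau * n) <= 1 * N.
      by apply: ler_pM => //; [rewrite mulr_ge0// ltW | exact: ltW | exact: ltW].
    have h2 : N * 1 <= N * Delta%:R by rewrite ler_wpM2l.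
    by rewrite expr2; lra.
  have H1 : iso * (tau * n * (tau * n - N)) <=
      n * (Delta%:R * (N + beta * n)).
    apply: le_trans (le_trans _ H) _.
      by apply: ler_wpM2l => //; apply: ler_pM => //; [exact: ltW | lra | lra].
    by rewrite natrM natrD ler_pM2l// ler_pM2l// lerD2l ltW.
  have H2 : iso * tau * (tau * n - N) <= Delta%:R * (N + beta * n).
    by rewrite -(ler_pM2l n0); apply: le_trans H1; rewrite le_eqVlt; apply/orP; left; apply/eqP; ring.
  have h1 : iso * tau * N <= 1 * N by rewrite ler_wpM2r.
  have h2 : N * 1 <= N * Delta%:R by rewrite ler_wpM2l.
  have h3 : iso * tau ^+ 2 * n = 2 * beta * Delta%:R * n by rewrite isoE.
  by rewrite expr2 in h3 *; lra.
have P4 F : #|far F K L|%:R < beta * n -> bexp p2 (edges G) (e4 F) <= kappa / 4.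
  move=> dense; apply: le_trans T4; apply: prob_split => // A B.
  exact: meet.
(* The event [e4] is charged only where [e3] fails, because its conditional probability is
   controlled only for such [F]. *)
have point F F2 : (~~ good (F :|: F2))%:R <= e1 (F :|: F2) + (e2 F + e3 F + (1 - e3 F) * e4 F F2).
  have e10 : 0 <= e1 (F :|: F2) by [].
  have e20 : 0 <= e2 F by [].
  have e30 : 0 <= e3 F by [].
  have e40 : 0 <= (1 - e3 F) * e4 F F2.
    by apply: mulr_ge0; [rewrite subr_ge0 lern1 leq_b1 | exact: ler0n].
  have good1 : (~~ good (F :|: F2))%:R <= 1 :> R by rewrite lern1 leq_b1.
  have [h1|h1] := lerP #|large (F :|: F2) k|%:R ((y + 2 * tau + tau) * n); last first.
    have E1 : e1 (F :|: F2) = 1 by rewrite /e1 h1.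
    by apply: le_trans good1 _; rewrite E1; lra.
  have [h2|h2] := lerP ((y - 2 * tau - tau) * n) #|large F K|%:R; last first.
    have E2 : e2 F = 1 by rewrite /e2 h2.
    by apply: le_trans good1 _; rewrite E2; lra.
  have [h3|h3] := lerP (beta * n) #|far F K L|%:R.
    have E3 : e3 F = 1 by rewrite /e3 h3.
    by apply: le_trans good1 _; rewrite E3 subrr mul0r; lra.
  have E3 : e3 F = 0 by rewrite /e3 leNgt h3.
  rewrite E3 subr0 mul1r addr0.
  have [split|nosplit] := boolP [exists S, splits (F :|: F2) S (large F K) c].
    have E4 : e4 F F2 = 1 by rewrite /e4 split.
    by apply: le_trans good1 _; rewrite E4; lra.
  have -> : good (F :|: F2).
    apply: (@giant_of_events _ F K k c tau y kappa) => //.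
    - exact: subsetUl.
    - by have -> : y + 3 * tau = y + 2 * tau + tau by ring.
    - by have -> : y - 3 * tau = y - 2 * tau - tau by ring.
  by rewrite /= mulr0n; have e4p : 0 <= e4 F F2 by []; lra.
have bad : bexp p (edges G) (fun F => (~~ good F)%:R) <= kappa.
  rewrite (bexp_sprinkle _ _ sprinkle).
  apply: (@le_trans _ _ (bexp p1 (edges G) (fun F => bexp p2 (edges G) (fun F2 => e1 (F :|: F2)) +
     (e2 F + e3 F + kappa / 4)))).
    apply: ler_bexp => // F _.
    apply: (@le_trans _ _ (bexp p2 (edges G)
      (fun F2 => e1 (F :|: F2) + (e2 F + e3 F + (1 - e3 F) * e4 F F2)))).
      by apply: ler_bexp => // F2 _; apply: point.
    rewrite bexpD lerD2l bexpD bexp_cst lerD2l bexpZ.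
    have k0 : 0 <= kappa / 4 by case/andP: ka => h _; lra.
    have [h3|h3] := lerP (beta * n) #|far F K L|%:R.
      by have -> : e3 F = 1 by [rewrite /e3 h3]; rewrite subrr mul0r.
    have -> : e3 F = 0 by rewrite /e3 leNgt h3.
    by rewrite subr0 mul1r P4.
  rewrite bexpD -(bexp_sprinkle _ _ sprinkle) !bexpD bexp_cst.
  by lra.
rewrite percolation_probE.
have -> : bexp p (edges G) (fun F => (good F)%:R) =
    1 - bexp p (edges G) (fun F => (~~ good F)%:R).
  rewrite -[X in X - _](bexp_cst p (edges G)) -bexpB; apply: eq_bexp => F _.
  by case: (good F); rewrite ?subrr ?subr0.
by lra.
Qed.
End Probability.

End Assembly.

(** * Estimates for the asymptotics *)

Section Isoperimetric.
Variables (R : realType) (G : sgraph) (i0 : R).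
Hypotheses (i0_gt0 : 0 < i0) (i0_le : i0 <= isoperimetric_constant G R).

Lemma isoperimetric_le (A : {set G}) : (0 < #|A|)%N -> (2 * #|A| <= #|G|)%N ->
  i0 * #|A|%:R <= (edge_boundary A)%:R.
Proof.
move=> A0 A2; have A0' : 0 < (#|A|%:R : R) by rewrite ltr0n.
rewrite -ler_pdivlMr//; apply: le_trans i0_le _; apply: ge_inf.
  by exists 0 => _ [S _ <-]; rewrite divr_ge0.
exists A => //; split => //; rewrite ler_pdivlMr// -natrM ler_nat mulnC//.
Qed.

Lemma edge_boundaryC (A : {set G}) : edge_boundary (~: A) = edge_boundary A.
Proof.
have sub (S : {set G}) : (edge_boundary S <= edge_boundary (~: S))%N.
  rewrite /edge_boundary.
  have swap_inj : injective (fun u : G * G => (u.2, u.1)) by move=> [? ?] [? ?] [-> ->].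
  rewrite -(card_imset _ swap_inj).
  apply/subset_leq_card/subsetP => yx /imsetP[[x y] xyA ->].
  by move: xyA; rewrite !inE /= negbK adj_sym => /and3P[-> -> ->].
by apply/eqP; rewrite eqn_leq sub -{2}(setCK A) sub.
Qed.

Lemma isoperimetric_factor (A : {set G}) :
  i0 * (#|A| * #|~: A|)%:R <= (#|G| * edge_boundary A)%:R.
Proof.
wlog A2 : A / (2 * #|A| <= #|G|)%N.
  move=> H; have [/H//|A2] := leqP (2 * #|A|)%N #|G|.
  have := H (~: A); rewrite setCK [(#|~: A| * #|A|)%N]mulnC edge_boundaryC; apply.
  by have := cardsC A; lia.
have [->|A0] := posnP #|A|; first by rewrite mul0n mulr0.
rewrite natrM mulrA [leRHS]natrM [leRHS]mulrC; apply: ler_pM => //.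
- by rewrite mulr_ge0// ltW.
- exact: isoperimetric_le.
- by rewrite ler_nat max_card.
Qed.

(** With at least two vertices, a singleton is an admissible set and must have positive boundary, so
    no vertex is isolated. This yields [d >= t] and the subcubes inside balls. *)
Lemma isoperimetric_degree (x : G) : (1 <= max_degree G)%N -> (1 <= degree x)%N.
Proof.
move=> D1.
have card2 : (2 <= #|G|)%N.
  have [y] : exists y : G, (0 < degree y)%N.
    apply/existsP; apply: contraTT D1 => /existsPn h; rewrite -leqNgt leqn0.
    by rewrite /max_degree big1// => y _; have := h y; rewrite -eqn0Ngt => /eqP.
  rewrite card_gt0 => /set0Pn[z]; rewrite inE => yz.
  by rewrite (cardD1 y) (cardD1 z) !inE eq_sym (adj_neq yz).
have := @isoperimetric_le [set x]; rewrite cards1 muln1 => /(_ isT card2).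
rewrite mulr1 => h; have : 0 < ((edge_boundary [set x])%:R : R) by apply: lt_le_trans h.
rewrite ltr0n => /leq_trans; apply.
have -> : degree x = volume [set x] by rewrite /volume big_set1.
by rewrite volume_boundary leq_addr.
Qed.
End Isoperimetric.

(** * Elementary growth comparisons *)

Section Growth.
Variable R : realType.

Lemma exponential_beats_power (A x : R) (N : nat) : 0 < A -> 1 < x ->
  exists r0 : nat, forall r : nat, (r0 <= r)%N -> A * (r.+1%:R) ^+ N <= x ^+ r.
Proof.
move=> A0 x1; have x0 : 0 < x by lra.
pose l := ln x / N.+1%:R.
have l0 : 0 < l by rewrite divr_gt0 ?ln_gt0.
have q0 : 0 < A * 2 ^+ N / l ^+ N.+1 by rewrite divr_gt0 ?mulr_gt0 ?exprn_gt0.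
exists (Num.truncn (A * 2 ^+ N / l ^+ N.+1)).+1 => r r0.
have rge : A * 2 ^+ N / l ^+ N.+1 <= r%:R.
  by apply: le_trans (ltW (truncnS_gt _)) _; rewrite ler_nat.
have r1 : (0 < r)%N by apply: leq_trans r0.
have r1' : 1 <= (r%:R : R) by rewrite ler1n.
have rr : (r.+1%:R : R) <= 2 * r%:R by rewrite -natr1; lra.
have -> : x ^+ r = expR (l * r%:R) ^+ N.+1.
  rewrite -expRM_natr (_ : l * r%:R * N.+1%:R = ln x * r%:R).
    by rewrite expRM_natr lnK// posrE.
  by rewrite /l mulrAC divfK ?pnatr_eq0.
apply: (@le_trans _ _ ((l * r%:R) ^+ N.+1)); last first.
  have lr : 0 <= l * r%:R by rewrite mulr_ge0// ltW.
  have h : l * r%:R <= expR (l * r%:R) by have := @expR_ge1Dx R (l * r%:R); lra.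
  by rewrite lerXn2r// nnegrE// expR_ge0.
apply: (@le_trans _ _ (A * (2 * r%:R) ^+ N)).
  by rewrite ler_pM2l// lerXn2r ?nnegrE// mulr_ge0.
rewrite ler_pdivrMr ?exprn_gt0// in rge.
rewrite (exprMn N 2) (exprMn N.+1 l) mulrA [r%:R ^+ N.+1]exprS [leRHS]mulrA.
by rewrite ler_wpM2r ?exprn_ge0// [leRHS]mulrC.
Qed.

Lemma fourth_root (t : nat) : exists r, (r ^ 4 <= t < r.+1 ^ 4)%N.
Proof.
elim: t => [|t [r /andP[rt tr]]]; first by exists 0%N.
have [h|h] := ltnP t.+1 (r.+1 ^ 4)%N; first by exists r; rewrite h (leq_trans rt).
exists r.+1; rewrite h /=; apply: leq_ltn_trans tr _.
by rewrite ltn_exp2r.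
Qed.

Lemma small_exponent (a A b : R) : 0 <= A -> 0 < a -> a < b ->
  exists2 d0 : R, 0 < d0 & forall d, d <= d0 -> a * expR (d * A) <= b.
Proof.
move=> A0 a0 ab; have l0 : 0 < ln (b / a) by rewrite ln_gt0// ltr_pdivlMr// mul1r.
exists (ln (b / a) / (A + 1)); first by rewrite divr_gt0//; lra.
move=> d dd; have b0 : 0 < b by exact: lt_trans ab.
rewrite -ler_pdivlMl// [leRHS]mulrC -[leRHS]lnK ?posrE ?divr_gt0//.
rewrite ler_expR; rewrite ler_pdivlMr in dd; last by lra.
have [dneg|dpos] := lerP d 0; first by have := mulr_le0_ge0 dneg A0; lra.
by rewrite mulrDr mulr1 in dd; lra.
Qed.

Lemma small_power (rho e : R) : 0 < rho -> rho < 1 -> 0 < e ->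
  exists k0 : nat, forall k, (k0 <= k)%N -> rho ^+ k <= e.
Proof.
move=> r0 r1 e0.
have i1 : 1 < rho^-1 by rewrite invf_gt1.
have i0 : 0 < e^-1 by rewrite invr_gt0.
have [k0 H] := exponential_beats_power 0 i0 i1.
exists k0 => k /H; rewrite expr0 mulr1 exprVn lef_pV2 ?posrE ?exprn_gt0//.
Qed.

(** As a function of [a], the rate decreases beyond [1 / (1 - 2 * delta)]. *)
Lemma decay_antitone (delta a b : R) : 1 < b -> b <= a -> 1 / b <= 1 - 2 * delta ->
  decay delta a <= decay delta b.
Proof.
move=> b1 ba bd; have b0 : 0 < b by lra.
have h : a <= b * expR ((a - b) / b).
  have -> : a = b * (1 + (a - b) / b) by field; lra.
  by rewrite ler_pM2l// [X in expR X](_ : _ = (a - b) / b) ?expR_ge1Dx//; field; lra.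
rewrite /decay; apply: le_trans (ler_wpM2r (expR_ge0 _) h) _.
rewrite -mulrA ler_pM2l// -expRD ler_expR.
have : (a - b) * (1 / b) <= (a - b) * (1 - 2 * delta) by rewrite ler_wpM2l//; lra.
by rewrite mulrA mulr1; lra.
Qed.

End Growth.

(** * Cluster probabilities up to a fixed error *)

Section ClusterConstants.
Variables (R : realType) (G : sgraph) (d delta lambda y mu a rho tau : R) (K k : nat).
Variable Typ : {set G}.
Hypotheses (d1 : 1 < d) (delta01 : 0 <= delta <= 3^-1).
Hypothesis typical_degree : forall x, x \in Typ ->
  (1 - delta) * d <= (degree x)%:R <= (1 + delta) * d.
Hypothesis small_sets : forall S : {set G}, (#|S| <= K)%N ->
  (volume S)%:R <= (edge_boundary S)%:R + delta * d * #|S|%:R.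
Hypotheses (lambdad : lambda <= d) (lambda1 : 1 < lambda) (y01 : 0 < y < 1).
Hypotheses (survival : expR (- (lambda * y)) = 1 - y) (muE : mu = lambda * (1 - y)).
Hypothesis tau01 : 0 < tau <= 1.

Lemma middle_cluster m v : 1 <= a <= lambda -> decay delta a <= rho -> 0 < rho < 1 ->
  bexp (a / d) (edges G)
    (fun F => ((m <= #|cluster F v| < K)%N && (cluster F v \subset Typ))%:R)
    <= rho ^+ m / (1 - rho).
Proof.
move=> /andP[a1 al] decr /andP[rho0 rho1].
have dl : 0 <= delta <= 2^-1 by have /andP[h1 h2] := delta01; apply/andP; split; lra.
have ad : 1 <= a <= d by rewrite a1 (le_trans al).
have dec0 : 0 <= decay delta a by apply: decay_ge0; lra.
have dec1 : decay delta a < 1 by apply: le_lt_trans rho1.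
apply: le_trans (prob_cluster_range d1 typical_degree small_sets v m ad (leqnSn K) dec1) _.
apply: ler_pM; [exact: exprn_ge0 | rewrite invr_ge0; lra | | ].
  by rewrite lerXn2r// nnegrE// ltW.
by rewrite lef_pV2 ?posrE; lra.
Qed.

(** Clusters are cut at the fixed order [k]: below it duality applies, with an error exponent
    proportional to [k]; from [k] on the geometric tail takes over. Duality alone would put [m] into
    the exponent. *)
Lemma small_cluster_upper m v : 1 <= a <= lambda -> decay delta a <= rho -> 0 < rho < 1 ->
  rho ^+ k / (1 - rho) <= tau / 2 ->
  (lambda - a + 2 * delta * lambda) * k%:R <= tau / 4 -> (k <= K)%N -> (m <= K)%N ->
  bexp (a / d) (edges G)
    (fun F => ((#|cluster F v| < m)%N && (cluster F v \subset Typ))%:R) <= 1 - (y - tau).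
Proof.
move=> al decr rho01 rhok expo kK mK; have /andP[y0 y1] := y01.
have /andP[t0 t1] := tau01.
have dl : 0 <= delta <= 2^-1 by have /andP[h1 h2] := delta01; apply/andP; split; lra.
have [a1 al'] := andP al.
have p01 : 0 <= a / d <= 1 by apply: prob_div_d => //; rewrite (le_trans al' lambdad) andbT; lra.
have S1 := prob_cluster_small d1 dl typical_degree small_sets v lambdad lambda1 y01
  survival muE al (leqW kK).
have S2 := middle_cluster k v al decr rho01.
set e := expR _ in S1.
have e1 : e <= 1 + tau / 2.
  apply: (@le_trans _ _ (expR (tau / 4))); first by rewrite ler_expR.
  by apply: le_trans (expR_le_quadratic _) _; [lra | nra].
have S1' : (1 - y) * e <= (1 - y) + tau / 2.
  apply: (@le_trans _ _ ((1 - y) * (1 + tau / 2))); first by rewrite ler_wpM2l//; lra.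
  by nra.
have S3 := lerD (le_trans S1 S1') (le_trans S2 rhok).
apply: (@le_trans _ _ (1 - y + tau / 2 + tau / 2)); last by lra.
apply: le_trans S3; rewrite -bexpD; apply: ler_bexp => // F _.
rewrite -natrD ler_nat; case: (cluster F v \subset Typ); rewrite ?andbT ?andbF//.
case: (ltnP #|cluster F v| m) => // Cm.
by rewrite (leq_trans Cm mK) andbT; case: ltnP.
Qed.

Lemma small_cluster_lower v : ball v k \subset Typ -> (0 < k)%N ->
  lambda / d <= delta / (1 + delta) -> lambda <= 2 ->
  4 * delta * lambda * k%:R <= tau / 2 ->
  mu^-1 * (mu * expR ((1 - mu) * (1 + 3 * delta))) ^+ k <= tau / 2 ->
  1 - (y + tau) <= bexp (lambda / d) (edges G) (fun F => (#|cluster F v| < k)%N%:R).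
Proof.
move=> vT k0 ld l2 expo muk; have /andP[y0 y1] := y01; have /andP[t0 t1] := tau01.
have /andP[de0 de1] := delta01.
have dl : 0 <= delta <= 2^-1 by apply/andP; split; lra.
apply: le_trans (prob_cluster_small_ge d1 dl typical_degree lambdad lambda1 y01
  survival muE vT k0 ld de1).
set e := expR _; set q := mu^-1 * _ in muk *.
have e1 : 1 - tau / 2 <= e.
  by have := @expR_ge1Dx R (- (4 * delta * lambda * k%:R)); rewrite -/e; lra.
have h1 : (1 - tau / 2) * (1 - tau / 2) <= e * (1 - q) by apply: ler_pM; lra.
have h2 : 1 - tau <= e * (1 - q) by nra.
rewrite -mulrA; apply: (@le_trans _ _ ((1 - y) * (1 - tau))); first by nra.
by rewrite ler_wpM2l//; lra.
Qed.
End ClusterConstants.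

(** * Powers of [r] against powers of [t] *)

Section Numerics.
Variable R : realType.
Implicit Types (U x alpha rho : R) (r : nat).

Lemma le_inv_pow U (i j e : nat) x : 1 <= U -> 0 <= x -> (i + j <= e)%N ->
  U ^+ e * x <= 1 -> U ^+ i * x <= U ^- j.
Proof.
move=> U1 x0 ije H; have U0 : 0 < U by lra.
rewrite -[U ^- j]mul1r ler_pdivlMr ?exprn_gt0//; apply: le_trans H.
by rewrite mulrAC -exprD ler_wpM2r// ler_weXn2l.
Qed.

Lemma exponents_r r : (4 <= r)%N ->
  [/\ (r ^ 2 + r + 4 <= 4 * r ^ 2)%N, (r + 6 <= 8 * r)%N,
      (4 * r ^ 2 + r + 6 <= 8 * r ^ 2)%N & (4 * r ^ 3 <= r ^ 4)%N].
Proof. by move=> r4; split; rewrite ?[(r ^ 4)%N]expnS ?leq_mul2r ?r4 ?orbT//; nia. Qed.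

Section Powers.
Variables (U alpha rho : R) (r : nat).
Hypotheses (U1 : 1 <= U) (r4 : (4 <= r)%N) (U8 : U ^+ 8 <= 2 ^+ r).

Lemma expr_cube (x : R) : x ^+ (r ^ 3) = (x ^+ r) ^+ (r ^ 2).
Proof. by rewrite -exprM -expnS. Qed.

(** [U] will be [H * t], a common bound for all polynomial quantities. The hypothesis
    [U ^+ 8 <= 2 ^+ r] says that [r] beats [log t]; here it is lifted by the factor [r ^ 2]. *)
Lemma pow_U8r2 : U ^+ (8 * r ^ 2) <= 2 ^+ (r ^ 3).
Proof.
have U0 : 0 <= U by exact: le_trans U1.
rewrite expr_cube (exprM U 8).
by apply: lerXn2r; rewrite ?nnegrE ?exprn_ge0.
Qed.

Lemma pow_U8r : U ^+ (8 * r) <= 2 ^+ (r ^ 2).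
Proof.
have U0 : 0 <= U by exact: le_trans U1.
rewrite (exprM U 8) -mulnn (exprM 2 r).
by apply: lerXn2r; rewrite ?nnegrE ?exprn_ge0.
Qed.

Lemma pow_rho : 0 <= rho -> U ^+ 4 * rho ^+ r <= 1 -> U ^+ (4 * r ^ 2) * rho ^+ (r ^ 3) <= 1.
Proof.
move=> rho0 H; have U0 : 0 <= U by exact: le_trans U1.
rewrite expr_cube (exprM U 4) -exprMn.
by rewrite exprn_ile1// mulr_ge0 ?exprn_ge0.
Qed.

Lemma pow_alpha : 0 <= alpha -> 4 ^+ (r ^ 3) * alpha <= 1 ->
  U ^+ (4 * r ^ 2) * (2 ^+ (r ^ 3) * alpha) <= 1.
Proof.
move=> a0; apply: le_trans; rewrite mulrA ler_wpM2r//.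
have -> : 4 ^+ (r ^ 3) = 2 ^+ (r ^ 3) * 2 ^+ (r ^ 3) :> R.
  by rewrite -exprMn; congr (_ ^+ _); ring.
rewrite ler_wpM2r ?exprn_ge0//; apply: le_trans pow_U8r2.
by rewrite ler_weXn2l// leq_mul2r orbT.
Qed.
End Powers.

(* The summands on the left are the error terms of [expected_far]. *)
Lemma far_terms U alpha rho (n X B m w Delta p1 q h KR : R) (r r2 r3 E : nat) :
  1 <= U -> (r2 + r + 4 <= E)%N -> U ^+ (r + 6) <= 2 ^+ r2 ->
  0 <= alpha -> U ^+ E * (2 ^+ r3 * alpha) <= 1 ->
  0 <= rho -> U ^+ E * rho ^+ r3 <= 1 ->
  0 <= n -> 0 <= X <= alpha * n -> 0 <= B <= U ^+ r2 -> 0 <= m <= U -> 0 <= w <= U ->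
  0 <= Delta <= U -> 0 <= p1 <= 1 -> 0 <= q <= U -> 0 <= h <= U * rho ^+ r3 ->
  KR = 2 ^+ r3 ->
  B * (m * X) * w + n * (p1 * (m * (m * Delta)) * q / 2 ^+ r2) + B * (n * h + KR * X)
    <= 4 * (n * U ^- (r + 2)).
Proof.
move=> U1 eE U6 a0 aH rho0 rhoH n0 /andP[X0 Xn] /andP[B0 BU] /andP[m0 mU] /andP[w0 wU]
  /andP[D0 DU] /andP[p0 p1'] /andP[q0 qU] /andP[h0 hU] KE.
have U0 : 0 < U by exact: lt_le_trans U1.
have n1 : (r2 + 2 + (r + 2) <= E)%N by clear -eE; lia.
have n2 : (r2 + (r + 2) <= E)%N by clear -eE; lia.
have n3 : (r2 + 1 + (r + 2) <= E)%N by clear -eE; lia.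
have n4 : (4 + (r + 2) <= r + 6)%N by clear; lia.
have two0 : 0 <= 2 ^+ r3 :> R by rewrite exprn_ge0.
have A1 : U ^+ (r2 + 2) * alpha <= U ^- (r + 2).
  apply: (le_inv_pow U1 a0 n1).
  apply: le_trans aH; apply: ler_wpM2l; first by apply: exprn_ge0; exact: ltW.
  by rewrite ler_peMl// exprn_ege1// ler1n.
have A4 : U ^+ r2 * (2 ^+ r3 * alpha) <= U ^- (r + 2).
  exact: (le_inv_pow U1 (mulr_ge0 two0 a0) n2).
have A3 : U ^+ (r2 + 1) * rho ^+ r3 <= U ^- (r + 2).
  exact: (le_inv_pow U1 (exprn_ge0 _ rho0) n3).
have A2 : U ^+ 4 * (2 ^+ r2)^-1 <= U ^- (r + 2).
  have i0 : 0 <= (2 ^+ r2)^-1 :> R by rewrite invr_ge0 exprn_ge0.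
  apply: (le_inv_pow U1 i0 n4).
  by rewrite ler_pdivrMr ?exprn_gt0// mul1r.
have B1 : B * (m * X) * w <= n * U ^- (r + 2).
  apply: (@le_trans _ _ (U ^+ r2 * (U * (alpha * n)) * U)).
    by rewrite !ler_pM ?mulr_ge0.
  have -> : U ^+ r2 * (U * (alpha * n)) * U = n * (U ^+ (r2 + 2) * alpha).
    by rewrite exprD; ring.
  by rewrite ler_wpM2l.
have B2 : n * (p1 * (m * (m * Delta)) * q / 2 ^+ r2) <= n * U ^- (r + 2).
  rewrite ler_wpM2l//; apply: le_trans A2; rewrite ler_wpM2r ?invr_ge0 ?exprn_ge0//.
  have -> : U ^+ 4 = 1 * (U * (U * U)) * U by ring.
  by rewrite !ler_pM ?mulr_ge0.
have B3 : B * (n * h) <= n * U ^- (r + 2).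
  apply: (@le_trans _ _ (U ^+ r2 * (n * (U * rho ^+ r3)))).
    by rewrite ler_pM ?mulr_ge0// ler_wpM2l.
  have -> : U ^+ r2 * (n * (U * rho ^+ r3)) = n * (U ^+ (r2 + 1) * rho ^+ r3).
    by rewrite exprD; ring.
  by rewrite ler_wpM2l.
have B4 : B * (KR * X) <= n * U ^- (r + 2).
  apply: (@le_trans _ _ (U ^+ r2 * (2 ^+ r3 * (alpha * n)))).
    by rewrite KE ler_pM ?mulr_ge0// ler_wpM2l.
  have -> : U ^+ r2 * (2 ^+ r3 * (alpha * n)) =
      n * (U ^+ r2 * (2 ^+ r3 * alpha)) by ring.
  by rewrite ler_wpM2l.
by rewrite [B * (_ + _)]mulrDr; lra.
Qed.

(* The union bound over [2 ^ s] splittings beats the probability that [M] disjoint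
   path systems all fail. *)
Lemma union_bound_small (x X b e : R) (s M : nat) : 0 <= x <= 1 -> X <= M.+1%:R ->
  s%:R <= b -> 3 * b <= x * X -> 4 / e <= b -> 1 <= b -> 0 < e ->
  (2 ^ s)%:R * (1 - x) ^+ M <= e / 4.
Proof.
move=> /andP[x0 x1] XM sb bx eb b1 e0.
have h1 : ((2 ^ s)%:R : R) <= expR s%:R.
  rewrite natrX -[s%:R]mul1r expRM_natr lerXn2r ?nnegrE ?expR_ge0//.
  by have := @expR_ge1Dx R 1; lra.
have h2 : (1 - x) ^+ M <= expR (- (x * M%:R)).
  rewrite -mulNr expRM_natr lerXn2r ?nnegrE ?expR_ge0//; first lra.
  exact: expR_ge1Dx.
apply: (@le_trans _ _ (expR s%:R * expR (- (x * M%:R)))).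
  by rewrite ler_pM// exprn_ge0//; lra.
rewrite -expRD.
have h3 : x * X <= x * M%:R + 1.
  by have := ler_wpM2l x0 XM; rewrite -natr1 mulrDr mulr1; lra.
apply: (@le_trans _ _ (expR (- b))); first by rewrite ler_expR; lra.
rewrite expRN; have h4 : 4 / e <= expR b by have := @expR_ge1Dx R b; lra.
have fe : 0 < 4 / e by rewrite divr_gt0.
have -> : e / 4 = (4 / e)^-1 by rewrite invf_div.
by rewrite lef_pV2 ?posrE ?expR_gt0.
Qed.
End Numerics.

(** * Products of bounded-degree graphs *)

Section ProductSetting.
Variables (R : realType) (t c r : nat) (G : 'I_t -> sgraph).
Notation V := (cartesian_product G).
Hypothesis degree_bounds : forall k (a : G k), (1 <= degree a <= c)%N.
Hypothesis nonempty : forall k, (0 < #|G k|)%N.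
Hypotheses (rt : (r ^ 4 <= t)%N) (r4 : (4 <= r)%N).
Let d : R := average_degree V R.
Let n : R := #|V|%:R.

Lemma dimension_gt : (r < t)%N.
Proof.
apply: leq_trans rt; rewrite -[X in (X < _)%N]expn1 ltn_exp2l//.
exact: leq_trans r4.
Qed.

Lemma factor_max_degree k : (max_degree (G k) <= c)%N.
Proof. by apply/bigmax_leqP => a _; have /andP[] := degree_bounds a. Qed.

Lemma product_max_degree : (0 < max_degree V <= c * t)%N.
Proof.
apply/andP; split; last exact: max_degree_product factor_max_degree.
have V0 : (0 < #|V|)%N.
  by apply: leq_trans (card_product degree_bounds nonempty); rewrite expn_gt0.
have /card_gt0P[x _] := V0; apply: leq_trans (degree_le x).
rewrite degree_product; have t0 : (0 < t)%N by apply: leq_ltn_trans dimension_gt.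
rewrite (bigD1 (Ordinal t0))//= ltn_addr//.
by have /andP[] := degree_bounds (x (Ordinal t0)).
Qed.

Lemma typical_degree_bounds (delta : R) x : x \in ~: atypical G delta ->
  (1 - delta) * d <= (degree x)%:R <= (1 + delta) * d.
Proof.
rewrite !inE -leNgt ler_norml -/d => /andP[h1 h2].
by rewrite mulrBl mulrDl mul1r; apply/andP; split; lra.
Qed.

(** A set of at most [2 ^ (r ^ 3)] vertices loses at most [2 * c * r ^ 3] of degree per vertex, and
    [r ^ 4 <= t <= d] makes this at most [delta * d]. *)
Lemma small_sets_expand (delta : R) (S : {set V}) : 2 * c%:R <= delta * r%:R ->
  (#|S| <= 2 ^ (r ^ 3))%N ->
  (volume S)%:R <= (edge_boundary S)%:R + delta * d * #|S|%:R.
Proof.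
move=> cr SK; have Sm : (#|S| < 2 ^ (r ^ 3).+1)%N by apply: leq_ltn_trans SK _; rewrite ltn_exp2l.
have := small_boundary factor_max_degree Sm; rewrite -(ler_nat R) natrD => /le_trans; apply.
rewrite lerD2l natrM ler_wpM2r// (natrM _ 2) (natrM _ c) natrX.
have /andP[td _] : t%:R <= d <= (c * t)%:R := average_degree_product_bounds R degree_bounds nonempty.
have r0 : 0 <= (r%:R : R) ^+ 3 by rewrite exprn_ge0.
have delta0 : 0 <= delta.
  have rpos : 0 < (r%:R : R) by rewrite ltr0n (leq_trans _ r4).
  by rewrite -(ler_pM2r rpos) mul0r; apply: le_trans cr; rewrite mulr_ge0.
have r4t : (r%:R : R) ^+ 4 <= d by apply: le_trans td; rewrite -natrX ler_nat.
rewrite mulrA; apply: le_trans (ler_wpM2r r0 cr) _.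
by rewrite -mulrA -exprS ler_wpM2l.
Qed.

Let alpha (delta : R) : R := 2 * expR (- (delta ^+ 2 / (8 * c%:R ^+ 2) * t%:R)).

Lemma card_atypical_le (delta : R) : 0 < delta <= 1 ->
  0 <= (#|~: ~: atypical G delta|%:R : R) <= alpha delta * n.
Proof.
move=> de; rewrite setCK ler0n /=.
by apply: le_trans (card_atypical degree_bounds nonempty de) _; rewrite /alpha -/n mulrAC.
Qed.

(** The fraction of atypical vertices is at most [2 * 8 ^- (r ^ 3)], and one factor [2 ^+ (r ^ 3)]
    absorbs the constant. Of the remaining [4 ^+ (r ^ 3)], half is for the cluster order [K] and
    half for powers of [U]. *)
Lemma alpha_small (delta : R) : 8 <= expR (delta ^+ 2 / (8 * c%:R ^+ 2) * r%:R) ->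
  0 <= alpha delta /\ 4 ^+ (r ^ 3) * alpha delta <= 1.
Proof.
set g := _ / _ => h8; split; first by rewrite mulr_ge0 ?expR_ge0.
have g0 : 0 <= g by rewrite divr_ge0 ?sqr_ge0 ?mulr_ge0 ?sqr_ge0.
have h1 : expR (- (g * t%:R)) <= (8 ^+ (r ^ 3))^-1.
  rewrite expRN lef_pV2 ?posrE ?expR_gt0 ?exprn_gt0//.
  apply: (@le_trans _ _ (expR (g * r%:R) ^+ (r ^ 3))).
    by apply: lerXn2r; rewrite ?nnegrE ?expR_ge0.
  rewrite -expRM_natr ler_expR -mulrA ler_wpM2l// -natrM -expnS ler_nat//.
have e8 : 8 ^+ (r ^ 3) = 4 ^+ (r ^ 3) * 2 ^+ (r ^ 3) :> R.
  by rewrite -exprMn; congr (_ ^+ _); ring.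
have p4 : 0 < 4 ^+ (r ^ 3) :> R by rewrite exprn_gt0.
have p2 : 0 < 2 ^+ (r ^ 3) :> R by rewrite exprn_gt0.
have h2 : 2 <= 2 ^+ (r ^ 3) :> R.
  by rewrite -[leLHS]expr1 ler_weXn2l ?ler1n// expn_gt0 (leq_trans _ r4).
rewrite mulrCA; apply: (@le_trans _ _ (2 * (4 ^+ (r ^ 3) * (8 ^+ (r ^ 3))^-1))).
  by rewrite ler_pM2l// ler_pM2l.
by rewrite e8 invfM mulVKf ?gt_eqF// ler_pdivrMr// mul1r.
Qed.

Lemma product_card_ge : 2 ^+ (4 * r ^ 3) <= n.
Proof.
rewrite -natrX ler_nat; apply: leq_trans (card_product degree_bounds nonempty).
by rewrite leq_exp2l//; apply: leq_trans rt; have [] := exponents_r r4.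
Qed.

Section Scales.
Variables (H : R) (kappa tau y eta rho : R).
Let U := H * t%:R.
Hypotheses (c1 : (0 < c)%N) (Hc : 2 * c%:R <= H) (U8 : U ^+ 8 <= 2 ^+ r).

Lemma U_bounds : [/\ 2 <= U, (r ^ 3)%:R <= U, (max_degree V).+1%:R <= U,
  (max_degree V)%:R <= c%:R * t%:R :> R & t%:R <= U].
Proof.
have /andP[D0 Dct] := product_max_degree.
have t1 : 1 <= (t%:R : R) by rewrite ler1n; apply: leq_ltn_trans dimension_gt.
have c1' : 1 <= (c%:R : R) by rewrite ler1n.
have Hc' := Hc.
have ct : 1 <= c%:R * t%:R :> R by rewrite mulr_ege1.
have h : 2 * (c%:R * t%:R) <= U by rewrite mulrA ler_wpM2r.
have DD : (max_degree V)%:R <= c%:R * t%:R :> R by rewrite -natrM ler_nat.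
have tct : t%:R <= c%:R * t%:R :> R by rewrite ler_peMl.
split => //; [lra | | by rewrite -natr1; lra | lra].
apply: (@le_trans _ _ t%:R); last by lra.
by rewrite ler_nat (leq_trans _ rt)// leq_exp2l// (leq_trans _ r4).
Qed.

Lemma U_le_pow : U <= 2 ^+ (r ^ 3).
Proof.
have [U2 _ _ _ _] := U_bounds; have U1 : 1 <= U by lra.
apply: (@le_trans _ _ (U ^+ 8)); first by rewrite -[leLHS]expr1 ler_weXn2l.
apply: le_trans U8 _; rewrite ler_weXn2l ?ler1n//.
by rewrite -[X in (X <= _)%N]expn1 leq_exp2l// (leq_trans _ r4).
Qed.

Lemma card_dominates : U * 2 ^+ (r ^ 3) ^+ 3 <= n.
Proof.
apply: le_trans product_card_ge; rewrite [(4 * _)%N]mulnC (exprM 2) [leRHS]exprS.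
by rewrite ler_wpM2r ?exprn_ge0//; apply: U_le_pow.
Qed.

End Scales.
End ProductSetting.

Section Terms.
Variable R : realType.

Lemma tail_term (p K n Delta kappa tau U : R) : 0 <= p <= 1 -> 0 <= K -> 0 < n -> 0 <= Delta ->
  0 < tau -> 8 * Delta <= U * (kappa * tau ^+ 2) -> 0 <= kappa * tau ^+ 2 -> U * K ^+ 2 <= n ->
  p * (2 * K * (n * (K * Delta))) / (tau * n) ^+ 2 <= kappa / 4.
Proof.
move=> /andP[p0 p1] K0 n0 D0 t0 HD kt HK.
rewrite ler_pdivrMr ?exprn_gt0 ?mulr_gt0//.
apply: (@le_trans _ _ (2 * K * (n * (K * Delta)))).
  by rewrite ler_piMl// !mulr_ge0// ltW.
have h1 := ler_wpM2l (sqr_ge0 K) HD.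
have h2 := ler_wpM2r kt HK.
have h3 : 8 * (K ^+ 2 * Delta) <= n * (kappa * tau ^+ 2) by lra.
have h4 := ler_wpM2r (ltW n0) h3.
have -> : 2 * K * (n * (K * Delta)) = 4^-1 * (8 * (K ^+ 2 * Delta) * n) by field.
have -> : kappa / 4 * (tau * n) ^+ 2 = 4^-1 * (n * (kappa * tau ^+ 2) * n) by field.
by rewrite ler_pM2l.
Qed.

Lemma beta_term (kappa tau iso Delta U n : R) (r : nat) : 0 < Delta -> 0 < U -> 0 <= n ->
  U ^- r.+1 <= iso -> 32 * Delta <= U * (kappa * tau ^+ 2) -> 0 <= kappa * tau ^+ 2 ->
  4 * (n * U ^- (r + 2)) <= kappa / 4 * (iso * tau ^+ 2 / (2 * Delta) * n).
Proof.
move=> D0 U0 n0 iU HD kt.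
have -> : kappa / 4 * (iso * tau ^+ 2 / (2 * Delta) * n) =
    n * (iso * (kappa * tau ^+ 2 / (8 * Delta))) by field; rewrite gt_eqF.
rewrite mulrCA ler_wpM2l//.
have h : 4 / U <= kappa * tau ^+ 2 / (8 * Delta).
  rewrite ler_pdivlMr ?mulr_gt0// mulrAC ler_pdivrMr//; lra.
have -> : 4 * U ^- (r + 2) = U ^- r.+1 * (4 / U).
  by rewrite addn2 [U ^+ r.+2]exprS invfM; ring.
have i0 : 0 <= U ^- r.+1 by rewrite invr_ge0 exprn_ge0// ltW.
by apply: ler_pM => //; rewrite divr_ge0// ltW.
Qed.

(** The losses from sprinkling, from isoperimetry, from constants and from separating the paths are
    each at most a power of [U], and [K] exceeds their product. *)
Lemma crossing_term (p2 U iso tau Delta n K D1 : R) (l r e : nat) :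
  0 < U -> 1 <= U -> U^-1 <= p2 -> U ^- r.+1 <= iso -> 0 < Delta -> 12 * Delta <= U * tau ^+ 2 ->
  0 < D1 -> D1 <= U -> 0 <= n -> 0 < K -> (l + (r.+1 + 1 + l) <= e)%N -> U ^+ e <= K ->
  3 * (n / K) <= p2 ^+ l * (iso * tau ^+ 2 * n / (4 * Delta) / D1 ^+ l).
Proof.
move=> U0 U1 p2U isoU D0 HD D10 D1U n0 K0 le UK.
have i0 j : 0 <= U ^- j by rewrite invr_ge0 exprn_ge0// ltW.
have Ui0 : 0 <= U^-1 by rewrite invr_ge0 ltW.
have p20 : 0 <= p2 := le_trans Ui0 p2U.
have h1 : U ^- l <= p2 ^+ l by rewrite -exprVn; apply: lerXn2r; rewrite ?nnegrE.
have h2 : U ^- l <= D1 ^- l.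
  by rewrite lef_pV2 ?posrE ?exprn_gt0//; apply: lerXn2r; rewrite ?nnegrE ?(ltW D10) ?(ltW U0).
have h3 : 3 * U^-1 <= tau ^+ 2 / (4 * Delta).
  rewrite ler_pdivlMr ?mulr_gt0// mulrAC ler_pdivrMr//; lra.
have u0 : 0 <= 3 * U^-1 by rewrite mulr_ge0// invr_ge0 ltW.
have h4 : U ^- l * (U ^- r.+1 * (3 * U^-1) * U ^- l) <=
    p2 ^+ l * (iso * (tau ^+ 2 / (4 * Delta)) * D1 ^- l).
  by apply: ler_pM => //; rewrite ?mulr_ge0//; apply: ler_pM => //; rewrite ?mulr_ge0//; apply: ler_pM.
have h5 : 3 * K^-1 <= U ^- l * (U ^- r.+1 * (3 * U^-1) * U ^- l).
  have -> : U ^- l * (U ^- r.+1 * (3 * U^-1) * U ^- l) = 3 * U ^- (l + (r.+1 + 1 + l)).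
    by rewrite !exprD !invfM expr1; ring.
  rewrite ler_pM2l// lef_pV2 ?posrE ?exprn_gt0//; apply: le_trans UK.
  by rewrite ler_weXn2l.
have h6 := ler_wpM2l n0 (le_trans h5 h4).
have -> : 3 * (n / K) = n * (3 * K^-1) by ring.
apply: le_trans h6 _; rewrite le_eqVlt; apply/orP; left; apply/eqP; ring.
Qed.
Lemma far_rearrange (B m X z n p1 D y W h K : R) : 0 < y -> 0 < W ->
  B * (m * X) / z + n * (p1 * (2 * m * (m * D)) / ((y / 2) ^+ 2 * W)) + B * (n * h + K * X) =
  B * (m * X) * z^-1 + n * (p1 * (m * (m * D)) * (2 / (y / 2) ^+ 2) / W) + B * (n * h + K * X).
Proof.
by move=> y0 W0; congr (_ + _ * _ + _); field; rewrite !gt_eqF.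
Qed.
End Terms.

(** The statement at a fixed [t]: each requirement that [t] be large is an explicit inequality on
    [H], [r] or their combination, so that the choice of constants can be made separately. *)
Lemma product_giant (R : realType) (t c r k : nat) (G : 'I_t -> sgraph)
    (lambda y mu kappa tau delta eta rho H : R) :
  (forall j (a : G j), (1 <= degree a <= c)%N) -> (forall j, (0 < #|G j|)%N) ->
  (r ^ 4 <= t)%N -> (4 <= r)%N ->
  (forall j (A : {set G j}), t%:R ^- r.+1 * (#|A| * #|~: A|)%:R <= (#|G j| * edge_boundary A)%:R :> R) ->
  1 < lambda <= 2 -> 0 < y < 1 -> expR (- (lambda * y)) = 1 - y -> mu = lambda * (1 - y) ->
  0 < kappa <= 2^-1 -> tau = kappa * y / 18 ->
  (0 < k <= r)%N -> 0 < delta <= 3^-1 -> 4 * delta * lambda * k%:R <= tau / 8 ->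
  0 < eta -> eta * k%:R <= tau / 8 -> 1 <= lambda - eta -> decay delta (lambda - eta) <= rho ->
  0 < rho < 1 -> rho ^+ k / (1 - rho) <= tau / 2 ->
  mu^-1 * (mu * expR ((1 - mu) * (1 + 3 * delta))) ^+ k <= tau / 2 ->
  (0 < c)%N -> 2 * c%:R <= H -> c%:R <= H * eta -> 32 * c%:R <= H * (kappa * tau ^+ 2) ->
  8 <= H * y ^+ 2 -> 1 <= H * (1 - rho) ->
  2 * c%:R <= delta * r%:R -> lambda * (1 + delta) <= delta * r%:R ->
  8 <= expR (delta ^+ 2 / (8 * c%:R ^+ 2) * r%:R) ->
  (H * t%:R) ^+ 8 <= 2 ^+ r -> (H * t%:R) ^+ 4 * rho ^+ r <= 1 ->
  1 - kappa <= percolation_prob (cartesian_product G)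
    (lambda / average_degree (cartesian_product G) R)
    (fun F => unique_giant_component F y kappa kappa).
Proof.
move=> degb nonempty rt r4 factor /andP[l1 l2] y01 survival muE ka tauE /andP[k0 kr]
  de dek eta0 etak a1 decr rho01 rhok muk c0 Hc Heta Hkappa Hy Hrho cr ldr exp8 U8 U4.
set V := cartesian_product G; set d := average_degree V R; set a := lambda - eta.
have /andP[y0 y1] := y01; have /andP[ka0 ka1] := ka; have /andP[de0 de1] := de.
have /andP[rho0 rho1] := rho01.
have tau0 : 0 < tau by rewrite tauE; clear -ka0 y0; nra.
have tau1 : tau <= 1 by rewrite tauE; clear -ka0 ka1 y0 y1; nra.
have tauy : 36 * tau <= y by rewrite tauE; clear -ka0 ka1 y0 y1; nra.
have tau01 : 0 < tau <= 1 by rewrite tau0.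
have [U2 mU D1U Dct tU] := U_bounds degb nonempty rt r4 c0 Hc.
have cardn := card_dominates degb nonempty rt r4 c0 Hc U8.
have UK := U_le_pow degb nonempty rt r4 c0 Hc U8.
have /andP[td dct] : t%:R <= d <= (c * t)%:R := average_degree_product_bounds R degb nonempty.
have rlt := dimension_gt rt r4.
have t1 : 1 <= (t%:R : R) by rewrite ler1n; apply: leq_ltn_trans rlt.
have t0 : 0 < (t%:R : R) by exact: lt_le_trans t1.
have c1 : 1 <= (c%:R : R) by rewrite ler1n.
set U := H * t%:R in U2 mU D1U tU cardn UK U8 U4.
have U0 : 0 < U by clear -U2; lra.
have U1 : 1 <= U by clear -U2; lra.
have scale (x z : R) : x <= H * z -> x * t%:R <= U * z.
  by move=> h; rewrite /U mulrAC ler_wpM2r// ltW.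
have UcE : c%:R * t%:R <= U * eta := scale _ _ Heta.
have UcK : 32 * c%:R * t%:R <= U * (kappa * tau ^+ 2) := scale _ _ Hkappa.
have Uy : 8 <= U * y ^+ 2 by apply: le_trans (scale _ _ Hy); rewrite ler_peMr.
have Urho : 1 <= U * (1 - rho) by apply: le_trans (scale _ _ Hrho); rewrite mul1r.
have /andP[D0 _] : (0 < max_degree V <= c * t)%N := product_max_degree degb nonempty rt r4.
have D0' : 0 < ((max_degree V)%:R : R) by rewrite ltr0n.
have kt0 : 0 <= kappa * tau ^+ 2 by rewrite mulr_ge0 ?sqr_ge0// ltW.
have kt1 : kappa * tau ^+ 2 <= tau ^+ 2 by rewrite ler_piMl ?sqr_ge0//; clear -ka1; lra.
have t2 : tau ^+ 2 <= tau by rewrite expr2 ler_piMl// ltW.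
have UD : 32 * (max_degree V)%:R <= U * (kappa * tau ^+ 2).
  by apply: le_trans UcK; rewrite -mulrA ler_pM2l.
have ct1 : 1 <= c%:R * t%:R :> R by rewrite mulr_ege1.
have Utau2 : 32 <= U * tau ^+ 2.
  apply: le_trans (le_trans UcK _); last by rewrite ler_pM2l.
  by rewrite -mulrA ler_peMr.
have Utau : 32 <= U * tau by apply: le_trans Utau2 _; rewrite ler_pM2l.
have Ukappa : 32 <= U * kappa.
  apply: (@le_trans _ _ (U * (kappa * tau ^+ 2))).
    by apply: le_trans UcK; rewrite -mulrA ler_peMr.
  by rewrite ler_pM2l// ler_piMr ?(ltW ka0)// (le_trans t2).
have Uy1 : 8 <= U * y.
  by apply: le_trans Uy _; rewrite ler_pM2l// expr2 ler_piMl ?ltW.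
pose K := (2 ^ (r ^ 3))%N; pose n : R := #|V|%:R.
have KE : (K%:R : R) = 2 ^+ (r ^ 3) by rewrite natrX.
have K1 : 1 <= 2 ^+ (r ^ 3) :> R by rewrite exprn_ege1// ler1n.
have K0 : (0 < K)%N by rewrite expn_gt0.
have KR0 : 0 < 2 ^+ (r ^ 3) :> R by exact: lt_le_trans K1.
have UK2 : U * (2 ^+ (r ^ 3)) ^+ 2 <= n.
  apply: le_trans cardn; rewrite ler_pM2l// ler_weXn2l//.
have n0 : 0 < n by apply: lt_le_trans UK2; rewrite mulr_gt0// exprn_gt0.
have G0 : (0 < #|V|)%N by rewrite -(ltr0n R).
have rK : (r <= K)%N.
  apply: leq_trans (ltnW (ltn_expl r (ltnSn 1))) _; rewrite leq_exp2l//.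
  by rewrite -[X in (X <= _)%N]expn1 leq_exp2l// (leq_trans _ r4).
have kK : (k <= K)%N := leq_trans kr rK.
have mK : (r ^ 3 <= K)%N by rewrite /K; apply/ltnW/ltn_expl.
have rd : (r%:R : R) <= d by apply: le_trans td; rewrite ler_nat ltnW.
have r4R : 4 <= (r%:R : R) by rewrite (ler_nat R 4 r).
have d4 : 4 <= d := le_trans r4R rd.
have d1 : 1 < d by clear -d4; lra.
have d0 : 0 < d by clear -d4; lra.
have ld : lambda <= d by clear -d4 l2; lra.
have al : 1 <= a <= lambda by rewrite a1 /a; clear -eta0; lra.
have p01 : 0 <= lambda / d <= 1 by apply: prob_div_d => //; rewrite ld andbT; clear -l1; lra.
have p101 : 0 <= a / d <= 1.
  by apply: prob_div_d => //; case/andP: al => ? ?; apply/andP; split; [lra | exact: le_trans ld].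
have da : 0 < d - a by rewrite /a; clear -ld eta0; lra.
(* The solution of [1 - lambda / d = (1 - a / d) * (1 - p2)] with [a = lambda - eta]. *)
pose p2 := eta / (d - a).
have p201 : 0 <= p2 <= 1.
  rewrite /p2 divr_ge0 ?(ltW eta0) ?(ltW da)//= ler_pdivrMr// mul1r /a; clear -ld; lra.
have sprinkle : 1 - lambda / d = (1 - a / d) * (1 - p2).
  have -> : lambda = a + eta by rewrite /a; ring.
  by rewrite /p2; field; rewrite !gt_eqF.
have p2U : U^-1 <= p2.
  rewrite -[leLHS]mul1r ler_pdivrMr// /p2 mulrAC ler_pdivlMr// mul1r.
  apply: le_trans (_ : d <= _); first by case/andP: al => h _; clear -h; lra.
  by apply: le_trans dct _; rewrite natrM [leRHS]mulrC.
have typ := @typical_degree_bounds R t G delta.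
have small := fun S => @small_sets_expand R t c r G degb nonempty rt r4 delta S cr.
set Typ := ~: atypical G delta in typ.
have de' : 0 <= delta <= 3^-1 by rewrite de1 ltW.
have de'' : 0 < delta <= 1 by rewrite de0; clear -de1; lra.
have [al0 al4] := alpha_small rt r4 exp8.
have /andP[X0 Xa] := card_atypical_le degb nonempty de''.
rewrite -/Typ in X0 Xa.
set X : R := #|~: Typ|%:R in X0 Xa.
set alpha : R := 2 * expR _ in al0 al4 Xa.
have palpha := pow_alpha U1 U8 al0 al4.
have prho := pow_rho U1 (ltW rho0) U4.
have [e1 e2 e3 _] := exponents_r r4.
have Ualpha (j : nat) : (j <= r.+1)%N -> U ^+ j * (2 ^+ (r ^ 3) * alpha) <= 1.
  move=> jr; apply: le_trans palpha; apply: ler_wpM2r; first by rewrite mulr_ge0// ltW.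
  by rewrite ler_weXn2l//; clear -jr e1; lia.
have KX : (K * #|~: Typ|)%:R <= tau * n.
  rewrite natrM KE; apply: (@le_trans _ _ (2 ^+ (r ^ 3) * (alpha * n))).
    by rewrite ler_pM2l.
  rewrite mulrA ler_pM2r// -(ler_pM2l U0); apply: le_trans (le_trans (Ualpha 1%N _) _) => //.
  by clear -Utau; lra.
have DX : ((max_degree V).+1 ^ k * #|~: Typ|)%:R <= tau * n.
  rewrite natrM natrX; apply: (@le_trans _ _ (U ^+ k * (alpha * n))).
    apply: ler_pM; [exact: exprn_ge0 | exact: X0 | | exact: Xa].
    by apply: lerXn2r; rewrite ?nnegrE ?(ltW U0).
  rewrite mulrA ler_pM2r// -(ler_pM2l U0) mulrA -exprS.
  apply: (@le_trans _ _ 1); last by clear -Utau; lra.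
  apply: le_trans (Ualpha k.+1 _) => //; apply: ler_wpM2l; first by apply: exprn_ge0; exact: ltW.
  by rewrite ler_peMl.
have upper m v : (m <= K)%N -> bexp (a / d) (edges V)
    (fun F => ((#|cluster F v| < m)%N && (cluster F v \subset Typ))%:R) <= 1 - (y - tau).
  move=> mK'; apply: (small_cluster_upper d1 de' typ small ld l1 y01 survival muE tau01
    v al decr rho01 rhok _ kK mK').
  have -> : (lambda - a + 2 * delta * lambda) * k%:R =
      eta * k%:R + 2^-1 * (4 * delta * lambda * k%:R) by rewrite /a; field.
  by clear -etak dek tau0; lra.
have mean_low : (y - 2 * tau) * n <= bexp (a / d) (edges V) (fun F => #|large F K|%:R).
  have -> : y - 2 * tau = y - tau - tau by ring.
  exact: mean_large_ge p101 (fun x => upper K x (leqnn K)) KX.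
have mean_up : bexp (lambda / d) (edges V) (fun F => #|large F k|%:R) <= (y + 2 * tau) * n.
  have -> : y + 2 * tau = y + tau + tau by ring.
  apply: (mean_large_le p01 _ _ DX) => [|x xT]; first by clear -y0 tau0; lra.
  apply: (small_cluster_lower d1 de' typ ld l1 y01 survival muE tau01 xT k0 _ l2 _ muk).
    rewrite ler_pdivrMr// mulrAC ler_pdivlMr; last by clear -de0; lra.
    by apply: le_trans ldr _; rewrite ler_pM2l.
  by clear -dek tau0; lra.
have UD8 : 8 * (max_degree V)%:R <= U * (kappa * tau ^+ 2) by clear -UD D0'; lra.
have T2 : a / d * (2 * K * (#|V| * (K * max_degree V)))%:R / (tau * n) ^+ 2 <= kappa / 4.
  rewrite !natrM KE -/n; exact: (tail_term p101 (ltW KR0) n0 (ltW D0') tau0 UD8 kt0 UK2).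
have T1 : lambda / d * (2 * k * (#|V| * (k * max_degree V)))%:R / (tau * n) ^+ 2 <= kappa / 4.
  rewrite !natrM -/n; apply: (tail_term p01 _ n0 (ltW D0') tau0 UD8 kt0 _) => //.
  apply: le_trans UK2; rewrite ler_pM2l// -KE.
  by apply: lerXn2r; rewrite ?nnegrE// ler_nat.
pose iso : R := t%:R ^- r.+1; pose beta := iso * tau ^+ 2 / (2 * (max_degree V)%:R).
have iso0 : 0 < iso by rewrite invr_gt0 exprn_gt0.
have iso1 : iso <= 1 by rewrite invf_le1 ?exprn_gt0// exprn_ege1.
have isoU : U ^- r.+1 <= iso.
  rewrite lef_pV2 ?posrE ?exprn_gt0//; apply: lerXn2r; rewrite ?nnegrE ?(ltW t0) ?(ltW U0)//.
have beta0 : 0 < beta by rewrite divr_gt0 ?mulr_gt0 ?exprn_gt0.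
have balls v : (2 ^ (r ^ 2) <= #|@ball V v (r ^ 2)|)%N.
  have Lt : (r ^ 2 <= t)%N by apply: leq_trans rt; rewrite leq_exp2l// (leq_trans _ r4).
  have deg0 j (b : G j) : (0 < degree b)%N by have /andP[] := degb j b.
  by have [T [<- Tb _]] := cube_in_ball v Lt deg0; apply: subset_leq_card.
(* The intermediate threshold is [r ^ 3]: then [rho ^+ (r ^ 3)] beats the volume [U ^+ (r ^ 2)] of a
   ball, while the Chebyshev term stays polynomial in [U] up to the division by [2 ^ (r ^ 2)]. *)
have T3 : bexp (a / d) (edges V) (fun F => #|far F K (r ^ 2)|%:R) <= kappa / 4 * (beta * n).
  have c00 : 0 < y / 2 by clear -y0; lra.
  have c0u : y / 2 < y - tau by clear -y0 tauy; lra.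
  have N00 : (0 < 2 ^ (r ^ 2))%N by rewrite expn_gt0.
  have r10 : 0 < 1 - rho by rewrite subr_gt0.
  have h0 : 0 <= rho ^+ (r ^ 3) / (1 - rho) by rewrite divr_ge0 ?exprn_ge0// ltW.
  have middle x := @middle_cluster _ _ _ _ _ _ _ _ _ d1 de' typ small ld (r ^ 3) x al decr rho01.
  apply: le_trans (expected_far p101 c00 c0u N00 mK h0 balls
    (fun x => upper _ x mK) middle erefl) _.
  apply: le_trans (beta_term D0' U0 (ltW n0) isoU UD kt0).
  set B : R := ((max_degree V).+1 ^ (r ^ 2))%:R.
  have B0 : 0 <= B <= U ^+ (r ^ 2).
    by rewrite ler0n /= /B natrX; apply: lerXn2r; rewrite ?nnegrE// ltW.
  have U6 : U ^+ (r + 6) <= 2 ^+ (r ^ 2).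
    by apply: le_trans (pow_U8r U1 U8); rewrite ler_weXn2l.
  have w0 : 0 <= (y - tau - y / 2)^-1 <= U.
    have wp : 0 < y - tau - y / 2 by clear -c0u; lra.
    rewrite invr_ge0 (ltW wp) /= -[leLHS]mul1r ler_pdivrMr//.
    apply: (@le_trans _ _ (U * (y / 4))); first by clear -Uy1; lra.
    by rewrite ler_pM2l//; clear -y0 tauy; lra.
  have q0 : 0 <= 2 / (y / 2) ^+ 2 <= U.
    rewrite divr_ge0 ?exprn_ge0 ?(ltW c00)//= ler_pdivrMr ?exprn_gt0//.
    by rewrite exprMn; clear -Uy; lra.
  have hh : 0 <= rho ^+ (r ^ 3) / (1 - rho) <= U * rho ^+ (r ^ 3).
    rewrite h0 /= mulrC ler_wpM2r ?exprn_ge0 ?(ltW rho0)//.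
    by rewrite -[leLHS]mul1r ler_pdivrMr.
  have X01 : 0 <= X <= alpha * n by rewrite X0.
  have DU : 0 <= ((max_degree V)%:R : R) <= U.
    by rewrite ler0n /=; apply: le_trans D1U; rewrite ler_nat.
  have mU' : 0 <= ((r ^ 3)%:R : R) <= U by rewrite ler0n.
  apply: le_trans (far_terms U1 e1 U6 al0 palpha (ltW rho0) prho (ltW n0) X01 B0 mU' w0 DU
     p101 q0 hh KE).
  have E1 : ((r ^ 3 * #|~: Typ|)%N%:R : R) = (r ^ 3)%N%:R * X by rewrite natrM.
  have E2 (q D : nat) : ((2 * q * (q * D))%N%:R : R) = 2 * q%:R * (q%:R * D%:R) by rewrite !natrM.
  have E3 : ((2 ^ (r ^ 2))%N%:R : R) = 2 ^+ (r ^ 2) by rewrite natrX.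
  have E4 : ((K * #|~: Typ|)%N%:R : R) = K%:R * X by rewrite natrM.
  rewrite E1 E2 E3 E4 -/n le_eqVlt; apply/orP; left; apply/eqP.
  by apply: far_rearrange => //; rewrite exprn_gt0.
pose Z : R := iso * tau ^+ 2 * n / (4 * (max_degree V)%:R) / (max_degree V).+1%:R ^+ (2 * (r ^ 2).+1).
have Z0 : 0 <= Z.
  rewrite /Z divr_ge0 ?exprn_ge0// divr_ge0 ?mulr_ge0 ?exprn_ge0 ?(ltW iso0) ?(ltW tau0) ?(ltW n0)//.
have D10 : 0 < ((max_degree V).+1%:R : R) by rewrite ltr0n.
pose M := Num.truncn Z.
have MN : (M * (max_degree V).+1 ^ (2 * (r ^ 2).+1))%:R <= iso * tau ^+ 2 * n / (4 * (max_degree V)%:R).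
  by rewrite natrM natrX -ler_pdivlMr ?exprn_gt0// truncn_le.
have nK : n / K%:R >= U.
  rewrite ler_pdivlMr ?ltr0n// KE; apply: le_trans UK2; rewrite ler_pM2l//.
  by rewrite expr2 ler_peMl// ltW.
have T4 : (2 ^ (#|V| %/ K))%:R * (1 - p2 ^+ (2 * (r ^ 2).+1)) ^+ M <= kappa / 4.
  have /andP[p20 p21] := p201.
  apply: (@union_bound_small _ _ Z (n / K%:R)) => //.
  - by rewrite exprn_ge0//= exprn_ile1.
  - exact/ltW/truncnS_gt.
  - by rewrite ler_pdivlMr ?ltr0n// -natrM ler_nat leq_trunc_div.
  - have UD12 : 12 * (max_degree V)%:R <= U * tau ^+ 2.
      apply: (@le_trans _ _ (U * (kappa * tau ^+ 2))); last by rewrite ler_pM2l.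
      by clear -UD D0'; lra.
    rewrite KE /Z; apply: (crossing_term U0 U1 p2U isoU D0' UD12 D10 D1U (ltW n0) KR0
       (e := (8 * r ^ 2)%N)); last exact: pow_U8r2.
    by clear -e3; lia.
  - apply: le_trans nK; rewrite ler_pdivrMr//; clear -Ukappa; lra.
  - exact: le_trans nK.
have tn : 2 <= tau * n.
  have : U * tau <= tau * n.
    rewrite mulrC ler_pM2l//; apply: le_trans UK2; rewrite ler_peMr ?(ltW U0)//.
    by rewrite exprn_ege1.
  by clear -Utau; lra.
have kn : k%:R <= tau * n.
  apply: (@le_trans _ _ (2 ^+ (r ^ 3))); first by rewrite -KE ler_nat.
  apply: (@le_trans _ _ (tau * (U * (2 ^+ (r ^ 3)) ^+ 2))); last by rewrite ler_pM2l.
  rewrite mulrA expr2 mulrA ler_peMl ?(ltW KR0)//.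
  by rewrite mulr_ege1// mulrC; clear -Utau; lra.
(* The size [c'] must lie between [tau * n] and [3 / 2 * tau * n]; rounding up is harmless because
   [2 <= tau * n]. *)
pose c' := (Num.truncn (tau * n)).+1.
have tn0 : 0 <= tau * n by clear -tn; lra.
apply: (@giant_probability R V (lambda / d) (a / d) p2 y tau kappa beta iso k K (r ^ 2) c' M) => //.
- by rewrite y0 ltW.
- exact/ltW/truncnS_gt.
- have : (Num.truncn (tau * n))%:R <= tau * n by rewrite truncn_le.
  by rewrite /c' -natr1; clear -tn; lra.
- exact: ltW.
- by rewrite /beta; field; rewrite gt_eqF.
- by move=> S; apply: product_isoperimetry (ltW iso0) factor S.
Qed.

(** * Choice of constants and passage to the limit *)

Lemma survival_probP (R : realType) (eps : R) : 0 < eps ->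
  survival_equation eps (survival_prob eps).
Proof.
move=> /survival_equation_unique[z [zs _]].
exact: (@xgetPex _ 0 [set y | survival_equation eps y]%classic (ex_intro _ z zs)).
Qed.

Lemma percolation_prob_le1 (R : realType) (G : sgraph) (p : R) P :
  0 <= p <= 1 -> percolation_prob G p P <= 1.
Proof. by move=> p01; rewrite percolation_probE bexp_pred_le1. Qed.

(** Trades the real exponent for an integer one: [r.+1] exceeds the fourth root of [t]. *)
Lemma powR_isoperimetric (R : realType) (t r : nat) : (0 < t)%N -> (t < r.+1 ^ 4)%N ->
  t%:R ^- r.+1 <= t%:R `^ (- (t%:R `^ (1 / 4))) :> R.
Proof.
move=> t0 tr; have t1 : 1 <= (t%:R : R) by rewrite ler1n.
have root : (t%:R : R) `^ (1 / 4) <= r.+1%:R.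
  have -> : (r.+1%:R : R) = ((r.+1%:R : R) `^ 4%:R) `^ (1 / 4).
    by rewrite -powRrM (_ : 4%:R * (1 / 4) = 1 :> R) ?powRr1//; field.
  rewrite ge0_ler_powR ?nnegrE ?powR_ge0//.
  by rewrite powR_mulrn// -natrX ler_nat ltnW.
rewrite -powR_mulrn// -powRN ler_powR// lerN2//.
Qed.

(** [rho] is placed halfway between the unperturbed rate and 1, so that it also bounds the rates
    perturbed by a small [d]; it is fixed before [d0]. *)
Lemma subcritical_rate (R : realType) (x A : R) : 0 < x -> x != 1 -> 0 <= A ->
  exists2 rho : R, 0 < rho < 1 &
    (forall e, 0 < e -> exists k0 : nat, forall k, (k0 <= k)%N -> rho ^+ k <= e) /\
    exists2 d0 : R, 0 < d0 & forall d, d <= d0 -> x * expR (1 - x) * expR (d * A) <= rho.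
Proof.
move=> x0 x1 A0; have := mul_expR1B_lt1 x1; set r0 := x * _ => r01.
have r00 : 0 < r0 by rewrite mulr_gt0 ?expR_gt0.
exists ((1 + r0) / 2); first by apply/andP; split; lra.
split; first by move=> e e0; apply: small_power => //; lra.
by apply: small_exponent => //; lra.
Qed.

(** The order of choice avoids circularity: [rho] and [rho'] depend on [eps] only, [k] also on
    [kappa], then [delta] and [eta] are taken at most of order [tau / k], then [H], and finally [r]
    and hence [t] large. *)
Lemma giant_eventually (R : realType) (C eps kappa : R) (G : forall t : nat, 'I_t -> sgraph) :
  0 < C -> 0 < eps < 1 -> 0 < kappa <= 2^-1 ->
  (forall (t : nat) (j : 'I_t),
    [/\ (1 <= max_degree (G t j))%N,
        (max_degree (G t j))%:R <= C &
        t%:R `^ (- (t%:R `^ (1 / 4))) <= isoperimetric_constant (G t j) R]) ->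
  exists T : nat, forall t, (T <= t)%N ->
    1 - kappa <= percolation_prob (cartesian_product (G t))
        ((1 + eps) / average_degree (cartesian_product (G t)) R)
        (fun H => unique_giant_component H (survival_prob eps) kappa kappa) <= 1.
Proof.
move=> C0 /andP[eps0 eps1] /andP[ka0 ka1] HG.
have [/andP[y0 y1] yE] := survival_probP eps0.
set y := survival_prob eps in y0 y1 yE *.
pose lambda := 1 + eps; pose mu := lambda * (1 - y).
have l1 : 1 < lambda by rewrite /lambda; lra.
have l2 : lambda <= 2 by rewrite /lambda; lra.
have survival : expR (- (lambda * y)) = 1 - y.
  by rewrite {2}yE subKr mulNr.
have y01 : 0 < y < 1 by rewrite y0.
have /andP[mu0 mu1] : 0 < mu < 1 := dual_lt1 l1 y01 survival erefl.
pose tau := kappa * y / 18.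
have tau0 : 0 < tau by rewrite divr_gt0 ?mulr_gt0.
(* As [eta] will be at most [eps / 2], [b] is a lower bound for [lambda - eta] known in advance;
   [decay_antitone] transfers the rate [rho] fixed at [b]. *)
pose b := 1 + eps / 2.
have b1 : 1 < b by rewrite /b; lra.
have b0 : 0 < b by lra.
have A1 : 0 <= 2 * (b - 1) by lra.
have A2 : 0 <= 3 * (1 - mu) by lra.
have [rho rho01 [small1 [dl1 dl10 Hdl1]]] := subcritical_rate b0 (negbT (gt_eqF b1)) A1.
have [rho' rho'01 [small2 [dl2 dl20 Hdl2]]] := subcritical_rate mu0 (negbT (lt_eqF mu1)) A2.
have /andP[rho0 rho1] := rho01.
have r10 : 0 < 1 - rho by rewrite subr_gt0.
have th0 : 0 < tau / 2 by rewrite divr_gt0.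
have [k1 Hk1] := small1 _ (mulr_gt0 th0 r10).
have [k2 Hk2] := small2 _ (mulr_gt0 mu0 th0).
pose k := (maxn k1 k2).+1.
have kk1 : (k1 <= k)%N by rewrite leqW// leq_maxl.
have kk2 : (k2 <= k)%N by rewrite leqW// leq_maxr.
have kpos : 0 < (k%:R : R) by rewrite ltr0n.
have tk0 : 0 < tau / (64 * k%:R) by rewrite divr_gt0// mulr_gt0.
have bb0 : 0 < (1 - 1 / b) / 2.
  by rewrite divr_gt0// subr_gt0 ltr_pdivrMr// mul1r.
pose delta := Num.min (Num.min dl1 dl2) (Num.min (Num.min (3^-1) (tau / (64 * k%:R))) ((1 - 1 / b) / 2)).
have [de0 [d1 [d2 [d3 [d4 d5]]]]] : 0 < delta /\ delta <= dl1 /\ delta <= dl2 /\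
    delta <= 3^-1 /\ delta <= tau / (64 * k%:R) /\ delta <= (1 - 1 / b) / 2.
  have third0 : 0 < 3^-1 :> R by rewrite invr_gt0.
  by do !split; rewrite /delta ?lt_min ?dl10 ?dl20 ?third0 ?tk0 ?bb0 ?ge_min ?lexx ?orbT.
pose eta := Num.min (eps / 2) (tau / (8 * k%:R)).
have te0 : 0 < tau / (8 * k%:R) by rewrite divr_gt0// mulr_gt0.
have [eta0 [eta1 eta2]] : 0 < eta /\ eta <= eps / 2 /\ eta <= tau / (8 * k%:R).
  by split; [rewrite lt_min te0 andbT divr_gt0 | rewrite /eta !ge_min !lexx !orbT].
pose c := (Num.truncn C).+1.
have c1 : 1 <= (c%:R : R) by rewrite ler1n.
pose H := 2 * c%:R + c%:R / eta + 32 * c%:R / (kappa * tau ^+ 2) + 8 / y ^+ 2 + 1 / (1 - rho).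
have kt0 : 0 < kappa * tau ^+ 2 by rewrite mulr_gt0// exprn_gt0.
have y20 : 0 < y ^+ 2 by rewrite exprn_gt0.
have p1 : 0 <= 2 * c%:R :> R by rewrite mulr_ge0.
have p2 : 0 <= c%:R / eta :> R by rewrite divr_ge0// ltW.
have p3 : 0 <= 32 * c%:R / (kappa * tau ^+ 2) :> R by rewrite divr_ge0 ?mulr_ge0// ltW.
have p4 : 0 <= 8 / y ^+ 2 :> R by rewrite divr_ge0// ltW.
have p5 : 0 <= 1 / (1 - rho) :> R by rewrite divr_ge0// ltW.
have H1 : 2 * c%:R <= H by rewrite /H; lra.
have H2 : c%:R <= H * eta by rewrite -ler_pdivrMr// /H; lra.
have H3 : 32 * c%:R <= H * (kappa * tau ^+ 2) by rewrite -ler_pdivrMr// /H; lra.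
have H4 : 8 <= H * y ^+ 2 by rewrite -ler_pdivrMr// /H; lra.
have H5 : 1 <= H * (1 - rho) by rewrite -ler_pdivrMr// /H; lra.
have H0 : 0 < H by clear -H1 c1; lra.
have two1 : 1 < 2 :> R by rewrite ltr1n.
have irho1 : 1 < rho^-1 by rewrite invf_gt1.
have [q1 Hq1] := exponential_beats_power 32 (exprn_gt0 8 H0) two1.
have [q2 Hq2] := exponential_beats_power 16 (exprn_gt0 4 H0) irho1.
pose gam := delta ^+ 2 / (8 * c%:R ^+ 2).
have gam0 : 0 < gam by rewrite divr_gt0 ?exprn_gt0// mulr_gt0// exprn_gt0//; exact: lt_le_trans c1.
pose big (z : R) := (Num.truncn z).+1.
have bigP z : z <= (big z)%:R by apply/ltW/truncnS_gt.
pose R0 := (4 + k + q1 + q2 + big (7 / gam) + big (2 * c%:R / delta) + big (lambda * (1 + delta) / delta))%N.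
exists (R0 ^ 4)%N => t Rt.
have [r /andP[rt tr]] := fourth_root t.
have Rr : (R0 <= r)%N by rewrite -ltnS -(@ltn_exp2r _ _ 4)//; apply: leq_ltn_trans tr.
have r4 : (4 <= r)%N by apply: leq_trans Rr; rewrite /R0; clear; lia.
have kr : (k <= r)%N by apply: leq_trans Rr; rewrite /R0; clear; lia.
have qr1 : (q1 <= r)%N by apply: leq_trans Rr; rewrite /R0; clear; lia.
have qr2 : (q2 <= r)%N by apply: leq_trans Rr; rewrite /R0; clear; lia.
have g1 : 7 / gam <= r%:R.
  apply: le_trans (bigP _) _; rewrite ler_nat; apply: leq_trans Rr; rewrite /R0.
  by move: (big (7 / gam)) (big (2 * c%:R / delta)) (big (lambda * (1 + delta) / delta)) => x1 x2 x3;
    clear; lia.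
have g2 : 2 * c%:R / delta <= r%:R.
  apply: le_trans (bigP _) _; rewrite ler_nat; apply: leq_trans Rr; rewrite /R0.
  by move: (big (7 / gam)) (big (2 * c%:R / delta)) (big (lambda * (1 + delta) / delta)) => x1 x2 x3;
    clear; lia.
have g3 : lambda * (1 + delta) / delta <= r%:R.
  apply: le_trans (bigP _) _; rewrite ler_nat; apply: leq_trans Rr; rewrite /R0.
  by move: (big (7 / gam)) (big (2 * c%:R / delta)) (big (lambda * (1 + delta) / delta)) => x1 x2 x3;
    clear; lia.
have rlt := dimension_gt rt r4.
have t0 : (0 < t)%N by apply: leq_ltn_trans rlt.
have iso0 : 0 < t%:R `^ (- (t%:R `^ (1 / 4))) :> R.
  by apply: powR_gt0; rewrite ltr0n.
have degb (j : 'I_t) (a : G t j) : (1 <= degree a <= c)%N.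
  have [D1 DC iso] := HG t j; apply/andP; split.
    exact: isoperimetric_degree iso0 iso a D1.
  apply: leq_trans (degree_le a) _; rewrite -(ler_nat R); apply: le_trans DC _.
  exact/ltW/truncnS_gt.
have nonempty (j : 'I_t) : (0 < #|G t j|)%N.
  have [D1 _ _] := HG t j; rewrite lt0n; apply: contraTneq D1 => /card0_eq e0.
  by rewrite -leqNgt /max_degree big1// => x; have := e0 x; rewrite inE.
have factor (j : 'I_t) (A : {set G t j}) :
    t%:R ^- r.+1 * (#|A| * #|~: A|)%:R <= (#|G t j| * edge_boundary A)%:R :> R.
  have [_ _ iso] := HG t j; apply: le_trans (isoperimetric_factor iso0 iso A).
  by rewrite ler_wpM2r//; apply: powR_isoperimetric.
have bE : b = 1 + eps / 2 by [].
have etak : eta * k%:R <= tau / 8.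
  apply: le_trans (ler_wpM2r (ltW kpos) eta2) _; rewrite le_eqVlt; apply/orP; left; apply/eqP.
  by field; rewrite gt_eqF.
have dek : 4 * delta * lambda * k%:R <= tau / 8.
  apply: (@le_trans _ _ (4 * (tau / (64 * k%:R)) * 2 * k%:R)).
    apply: ler_wpM2r; first exact: ltW.
    by apply: ler_pM => //; [rewrite mulr_ge0// ltW | clear -l1; lra | rewrite ler_pM2l].
  by rewrite le_eqVlt; apply/orP; left; apply/eqP; field; rewrite gt_eqF.
have ba : b <= lambda - eta by rewrite /b /lambda; clear -eta1; lra.
have decr : decay delta (lambda - eta) <= rho.
  apply: le_trans (decay_antitone b1 ba _) _; first by clear -d5; lra.
  apply: le_trans (Hdl1 _ d1); rewrite /decay -mulrA ler_pM2l// -expRD ler_expR.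
  by rewrite le_eqVlt; apply/orP; left; apply/eqP; ring.
have rhok : rho ^+ k / (1 - rho) <= tau / 2 by rewrite ler_pdivrMr// Hk1.
have muk : mu^-1 * (mu * expR ((1 - mu) * (1 + 3 * delta))) ^+ k <= tau / 2.
  rewrite ler_pdivrMl//; apply: le_trans (Hk2 _ kk2).
  have e0 : 0 <= mu * expR ((1 - mu) * (1 + 3 * delta)) by rewrite mulr_ge0 ?expR_ge0// ltW.
  have rho'0 : 0 <= rho' by case/andP: rho'01 => /ltW.
  apply: lerXn2r; rewrite ?nnegrE//; apply: le_trans (Hdl2 _ d2).
  rewrite -mulrA ler_pM2l// -expRD ler_expR.
  by rewrite le_eqVlt; apply/orP; left; apply/eqP; ring.
have tr' : (t%:R : R) <= r.+1%:R ^+ 4 by rewrite -natrX ler_nat ltnW.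
have U8 : (H * t%:R) ^+ 8 <= 2 ^+ r.
  apply: le_trans (Hq1 _ qr1); rewrite exprMn ler_pM2l ?exprn_gt0//.
  by rewrite (exprM _ 4 8); apply: lerXn2r; rewrite ?nnegrE ?exprn_ge0.
have U4 : (H * t%:R) ^+ 4 * rho ^+ r <= 1.
  rewrite -ler_pdivlMr ?exprn_gt0// div1r -exprVn; apply: le_trans (Hq2 _ qr2).
  rewrite exprMn ler_pM2l ?exprn_gt0//.
  by rewrite (exprM _ 4 4); apply: lerXn2r; rewrite ?nnegrE ?exprn_ge0.
have exp8 : 8 <= expR (delta ^+ 2 / (8 * c%:R ^+ 2) * r%:R).
  rewrite -/gam; have h : 7 <= gam * r%:R by rewrite mulrC -ler_pdivrMr.
  by have := @expR_ge1Dx R (gam * r%:R); clear -h; lra.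
have cr : 2 * c%:R <= delta * r%:R by rewrite [leRHS]mulrC -ler_pdivrMr.
have ldr : lambda * (1 + delta) <= delta * r%:R by rewrite [leRHS]mulrC -ler_pdivrMr.
apply/andP; split.
  apply: (@product_giant R t c r k (G t) lambda y mu kappa tau delta eta rho H) => //.
  - by rewrite l1.
  - by rewrite ka0.
  - by rewrite de0.
  - by apply: le_trans ba; rewrite ltW.
apply: percolation_prob_le1.
have /andP[td _] : t%:R <= average_degree (cartesian_product (G t)) R <= (c * t)%:R :=
  average_degree_product_bounds R degb nonempty.
have t4 : 4 <= (t%:R : R) by rewrite (ler_nat R 4) (leq_trans r4)// ltnW.
have d4' := le_trans t4 td; rewrite -/lambda.
apply/andP; split; first by apply: divr_ge0; [clear -l1; lra | clear -d4'; lra].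
by rewrite ler_pdivrMr ?mul1r; clear -d4' l2; lra.
Qed.

(** Turns the statements at fixed accuracy into one vanishing sequence: at time [t] the accuracy is
    that of the largest [m <= t] whose threshold [T m] has been passed. The thresholds need not be
    monotone. *)
Lemma diagonal_rate (R : realType) (P : nat -> R -> R) :
  (forall e : R, 0 < e <= 2^-1 -> exists T, forall t, (T <= t)%N -> 1 - e <= P t e <= 1) ->
  exists o : nat -> R, (o t @[t --> \oo] --> (0 : R))%classic /\
    (P t (o t) @[t --> \oo] --> (1 : R))%classic.
Proof.
(* The sequence starts at 1/2, the coarsest accuracy that the hypothesis covers. *)
move=> HP; pose e (m : nat) : R := (m.+2%:R)^-1.
have e01 m : 0 < e m <= 2^-1.
  by rewrite invr_gt0 ltr0n /= lef_pV2 ?posrE ?ltr0n// ler_nat.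
have /choice[T HT] m := HP (e m) (e01 m).
(* If no threshold has been passed the maximum is 0 by default; nothing is claimed then, as [idx_T]
   asks for [T 0 <= t]. *)
pose idx t := (\max_(m < t.+1 | (T m <= t)%N) m)%N.
have idx_ge m t : (m <= t)%N -> (T m <= t)%N -> (m <= idx t)%N.
  move=> mt Tt; rewrite -ltnS in mt.
  exact: (@leq_bigmax_cond _ (fun i : 'I_t.+1 => (T i <= t)%N) (fun i : 'I_t.+1 => i : nat) (Ordinal mt)).
have idx_T t : (T 0%N <= t)%N -> (T (idx t) <= t)%N.
  move=> T0.
  have nonempty : (0 < #|[pred i : 'I_t.+1 | (T i <= t)%N]|)%N by apply/card_gt0P; exists ord0.
  have [i iT E] := eq_bigmax_cond (fun i : 'I_t.+1 => i : nat) nonempty.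
  by rewrite /idx E.
have small (eps : R) : 0 < eps -> exists N, forall t, (N <= t)%N ->
    [/\ (T 0%N <= t)%N & e (idx t) <= eps].
  move=> eps0; pose m := (Num.truncn eps^-1).+1.
  exists (maxn m (maxn (T m) (T 0%N))) => t; rewrite !geq_max => /and3P[mt Tmt T0t].
  split=> //; have := idx_ge _ _ mt Tmt => mi.
  rewrite /e -[leRHS]invrK lef_pV2 ?posrE ?invr_gt0 ?ltr0n//.
  apply: le_trans (ltW (truncnS_gt _)) _; rewrite ler_nat -/m.
  by apply: leq_trans mi _; rewrite -addn2 leq_addr.
exists (fun t => e (idx t)); split; apply/cvgrPdist_le => eps eps0;
  have [N HN] := small eps eps0; exists N => // t /= Nt; have [T0 ei] := HN t Nt.
- rewrite sub0r normrN ger0_norm//; have /andP[h _] := e01 (idx t); exact: ltW.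
- have /andP[h1 h2] := HT (idx t) t (idx_T t T0).
  by rewrite ger0_norm ?subr_ge0//; lra.
Qed.

Local Open Scope classical_set_scope.
Local Open Scope ring_scope.

Theorem theorem1p8 (R : realType) (C : R) (hC : 0 < C) :
  exists2 eps0 : R, 0 < eps0 &
  forall eps : R, 0 < eps < eps0 ->
  forall G : forall t : nat, 'I_t -> sgraph,
  (forall (t : nat) (j : 'I_t),
    [/\ (1 <= max_degree (G t j))%N,
        (max_degree (G t j))%:R <= C &
        t%:R `^ (- (t%:R `^ (1 / 4))) <= isoperimetric_constant (G t j) R]) ->
  exists o1 o2 : nat -> R,
  [/\ o1 t @[t --> \oo] --> (0 : R),
      o2 t @[t --> \oo] --> (0 : R) &
      percolation_prob (cartesian_product (G t))
        ((1 + eps) / average_degree (cartesian_product (G t)) R)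
        (fun H => unique_giant_component H (survival_prob eps) (o1 t) (o2 t))
      @[t --> \oo] --> (1 : R)].
Proof.
(* It suffices that [eps < 1], which is used in the form [lambda <= 2]. *)
exists 1 => // eps eps01 G HG.
(* One sequence serves as both error terms. *)
pose P t e := percolation_prob (cartesian_product (G t))
  ((1 + eps) / average_degree (cartesian_product (G t)) R)
  (fun H => unique_giant_component H (survival_prob eps) e e).
have [|rate [rate0 Prate]] := @diagonal_rate R P; last by exists rate, rate.
by move=> e e01; apply: giant_eventually hC eps01 e01 HG.
Qed.
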